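(* Let $p(z,t)$, $z\in\mathbb D$, $0\le t<T$, be such that $p(\cdot,t)$ belongs to the Carathéodory class for every $t\in[0,T)$, $p(\cdot,t)$ is $C^2$ in $\overline{\mathbb D}$ for $0\le t<T$, $p(z,\cdot)$ is continuous on $[0,T)$ for every $z\in\overline{\mathbb D}$, and $p(z,t)$, $p'(z,t)$, $p''(z,t)$ are bounded on $\overline{\mathbb D}\times[0,T)$. Let $f(z,t)$ be the solution of the Löwner–Kufarev equation $$\frac{\partial f(z,t)}{\partial t}=-z\frac{\partial f(z,t)}{\partial z}\,p(z,t),\qquad z\in\mathbb D,\ 0\le t<T,$$ with $f(z,0)=z$ (so $\Omega(0)=\mathbb D$), and put $\Omega(t)=f(\mathbb D,t)$, $\Gamma(t)=\partial\Omega(t)$. For each $t$ let $F(\cdot,\tau(t))$ be the conformal map of $\mathbb D^*=\{|z|>1\}$ onto the unbounded complementary component of $\Gamma(t)$ with $F(\infty,\tau(t))=\infty$ and expansion $F(z,\tau(t))=e^{-\tau(t)}z+b_0+b_1z^{-1}+\dots$ near $\infty$ (so $F(\mathbb T,\tau(t))=f(\mathbb T,t)=\Gamma(t)$). Let the conformal welding $\varphi=\varphi(\tilde\varphi)$ of $\Gamma(t)$ be defined by $f(e^{i\varphi},t)=F(e^{i\tilde\varphi},\tau(t))$ (both maps extended continuously to $\mathbb T$, with arguments chosen continuously so that $\varphi\to\tilde\varphi$ as $t\to0$). Then $$\varphi=\tilde\varphi+2\,\operatorname{Im} p(e^{i\tilde\varphi},0)\,t+o(t),\qquad t\to+0.$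$
   Context: $\mathbb D=\{|z|<1\}$, $\mathbb T=\partial\mathbb D$, $\mathbb D^*=\{|z|>1\}$. A function $p(\cdot,t)$ is in the Carathéodory class if it is analytic in $\mathbb D$, $p(z,t)=1+p_1(t)z+p_2(t)z^2+\dots$ and $\operatorname{Re}p(z,t)>0$ in $\mathbb D$. ''$p(\cdot,t)$ is $C^2$ in $\overline{\mathbb D}$'' means $p(\cdot,t)$ and its $z$-derivatives $p',p''$ extend continuously to $\overline{\mathbb D}$; primes denote derivatives in $z$. The solution $f(\cdot,t)$ maps $\mathbb D$ conformally onto $\Omega(t)\subset\mathbb D$, with $f(0,t)=0$, $f'(0,t)=e^{-t}$. *)

(* Defs.v *)
From Stdlib Require Import Reals.
Open Scope R_scope.

Definition Cplx : Type := (R * R)%type.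
Definition Cre (z : Cplx) : R := fst z.
Definition Cim (z : Cplx) : R := snd z.
Definition RtoC (x : R) : Cplx := (x, 0).
Definition Cadd (z w : Cplx) : Cplx := (fst z + fst w, snd z + snd w).
Definition Copp (z : Cplx) : Cplx := (- fst z, - snd z).
Definition Csub (z w : Cplx) : Cplx := Cadd z (Copp w).
Definition Cmul (z w : Cplx) : Cplx :=
  (fst z * fst w - snd z * snd w, fst z * snd w + snd z * fst w).
Definition Cmod (z : Cplx) : R := sqrt (fst z ^ 2 + snd z ^ 2).
Definition Cinv (z : Cplx) : Cplx :=
  (fst z / (fst z ^ 2 + snd z ^ 2), - snd z / (fst z ^ 2 + snd z ^ 2)).
Definition Cdiv (z w : Cplx) : Cplx := Cmul z (Cinv w).
Definition Cexpi (theta : R) : Cplx := (cos theta, sin theta).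
Definition Czero : Cplx := (0, 0).
Definition Cone : Cplx := (1, 0).

Definition has_cderiv (g : Cplx -> Cplx) (z l : Cplx) : Prop :=
  forall eps, eps > 0 -> exists delta, delta > 0 /\
    forall h, 0 < Cmod h < delta ->
      Cmod (Csub (Cdiv (Csub (g (Cadd z h)) (g z)) h) l) < eps.

(* holomorphic on a set U (U open in our uses) *)
Definition holo_on (U : Cplx -> Prop) (g : Cplx -> Cplx) : Prop :=
  forall z, U z -> exists l, has_cderiv g z l.

Definition cont_on (S : Cplx -> Prop) (g : Cplx -> Cplx) : Prop :=
  forall z, S z -> forall eps, eps > 0 -> exists delta, delta > 0 /\
    forall w, S w -> Cmod (Csub w z) < delta -> Cmod (Csub (g w) (g z)) < eps.

Definition inj_on (S : Cplx -> Prop) (g : Cplx -> Cplx) : Prop :=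
  forall z w, S z -> S w -> g z = g w -> z = w.

Definition disk (z : Cplx) : Prop := Cmod z < 1.
Definition cdisk (z : Cplx) : Prop := Cmod z <= 1.
Definition ext_disk (z : Cplx) : Prop := Cmod z > 1.
Definition cext_disk (z : Cplx) : Prop := Cmod z >= 1.

Definition has_tderiv_in (T : R) (u : R -> Cplx) (t : R) (l : Cplx) : Prop :=
  forall eps, eps > 0 -> exists delta, delta > 0 /\
    forall s, 0 <= s < T -> s <> t -> Rabs (s - t) < delta ->
      Cmod (Csub (Cmul (RtoC (/ (s - t))) (Csub (u s) (u t))) l) < eps.

Definition image_disk (g : Cplx -> Cplx) (w : Cplx) : Prop := exists z, disk z /\ g z = w.

(* boundary of the open set g(D): closure minus the (open) set itself *)
Definition boundary_image_disk (g : Cplx -> Cplx) (w : Cplx) : Prop :=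
  (forall eps, eps > 0 -> exists z, disk z /\ Cmod (Csub (g z) w) < eps)
  /\ ~ image_disk g w.

(* w lies in the unbounded connected component of C \ K (K compact):
   w can be joined, inside C \ K, to points of arbitrarily large modulus *)
Definition unbounded_component (K : Cplx -> Prop) (w : Cplx) : Prop :=
  ~ K w /\
  forall M : R, exists gamma : R -> Cplx,
    (forall s, 0 <= s <= 1 -> forall eps, eps > 0 -> exists delta, delta > 0 /\
       forall s', 0 <= s' <= 1 -> Rabs (s' - s) < delta ->
         Cmod (Csub (gamma s') (gamma s)) < eps) /\
    gamma 0 = w /\ Cmod (gamma 1) >= M /\
    (forall s, 0 <= s <= 1 -> ~ K (gamma s)).

(* Main.v *)
(** Inside the curve, the Loewner-Kufarev equation is a transport equation whose
    characteristics run inward when followed backwards in time, so a maximum principle along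
    characteristics gives, uniformly on the closed disk,
    [|f z - f w - (z - w)| <= C t |z - w|] and [f z = z - t z p(z, 0) + o(t)].

    Outside the curve, put [A w = w F(1 / w)]. On the unit circle [log |A| = - t Re p + o(t)], so that
    [A - 1 + t conj (p (conj w, 0))] is holomorphic with real part [o(t)]; the claim is that its
    imaginary part is [o(t)] on the circle as well. Inside the disk this is the
    Borel-Caratheodory inequality. To reach the circle one needs a Hoelder bound with a
    factor [t]: the quotients [(F (e z) - F z) / ((e - 1) F z)], [|e| = 1], take boundary values in a
    double cone of opening [O(t)] around the real axis because the curve is [C t]-Lipschitz
    close to a circle; by the maximum principle for their squares and injectivity of [F]
    they stay in a single cone, and the Schwarz lemma for a suitable power gives
    [|A' w| <= C t / sqrt (1 - |w|)]. *)

(* The factor 2 is the sum of two equal contributions: with [x] the angle between the welded points,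
   the interior expansion gives [Im A = x - t Im p + o(t)] on the circle, and the exterior estimate
   gives [Im A = t Im p + o(t)].

   At radius [s] Borel-Caratheodory controls the imaginary part only by [o(t) / (1 - s)], which is
   worthless as [s] tends to 1. The radial increment [O(t sqrt (1 - s))] makes it usable: [s] can be
   fixed first, and [t] sent to 0 afterwards. A Hoelder bound without the factor [t] would not allow
   this.

   Nothing is known about [F'] on the circle, whereas rotation quotients extend continuously to it.
   Their boundary values are controlled only up to a real factor of either sign, because the sense
   in which the curve is traced is not controlled; hence a double cone.

   The normalisation [A 0 = exp (- tau) > 0] fixes the imaginary constant that the real part leaves
   undetermined. *)
From Stdlib Require Import Reals Ranalysis5 Lra Lia Classical ClassicalEpsilon.
From Coquelicot Require Import Coquelicot.
Require Defs.
Open Scope R_scope.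

(** * Complex differentiability *)

(** The condition is free of division, so sums, products and compositions need no separate case
    [h = 0]. *)
Definition is_cderiv (g : C -> C) (z l : C) : Prop :=
  forall eps, eps > 0 -> exists delta, delta > 0 /\
    forall h, Cmod h < delta ->
      Cmod (g (z + h) - g z - l * h)%C <= eps * Cmod h.

Definition cderivable (g : C -> C) (z : C) : Prop := exists l, is_cderiv g z l.

Definition cont_within (S : C -> Prop) (g : C -> C) (z : C) : Prop :=
  forall eps, eps > 0 -> exists delta, delta > 0 /\
    forall w, S w -> Cmod (w - z)%C < delta -> Cmod (g w - g z)%C < eps.

Lemma Rlt_min_l {x a b : R} : x < Rmin a b -> x < a.
Proof. intros H. apply (Rlt_le_trans _ _ _ H), Rmin_l. Qed.

Lemma Rlt_min_r {x a b : R} : x < Rmin a b -> x < b.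
Proof. intros H. apply (Rlt_le_trans _ _ _ H), Rmin_r. Qed.

Lemma Cmod_minus_sym (a b : C) : Cmod (a - b)%C = Cmod (b - a)%C.
Proof. rewrite <- Cmod_opp. f_equal. ring. Qed.

Lemma Cmod_triangle_minus (a b : C) : Cmod (a - b)%C <= Cmod a + Cmod b.
Proof. unfold Cminus. rewrite <- (Cmod_opp b). apply Cmod_triangle. Qed.

Lemma Cmod_triangle_via (c a b : C) : Cmod (a - b)%C <= Cmod (a - c)%C + Cmod (c - b)%C.
Proof. replace (a - b)%C with ((a - c) + (c - b))%C by ring. apply Cmod_triangle. Qed.

Lemma Cmod_minus_ge (a b : C) : Cmod a - Cmod b <= Cmod (a - b)%C.
Proof.
  assert (H := Cmod_triangle (a - b)%C b).
  replace (a - b + b)%C with a in H by ring. lra.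
Qed.

Lemma im_le_Cmod (c : C) : Rabs (Im c) <= Cmod c.
Proof. apply Rle_trans with (2 := Rmax_Cmod c). apply Rmax_r. Qed.

Lemma Cmod_le_re_im (c : C) : Cmod c <= Rabs (Re c) + Rabs (Im c).
Proof.
  replace c with (RtoC (Re c) + Ci * RtoC (Im c))%C at 1.
  - eapply Rle_trans; [apply Cmod_triangle|].
    rewrite Cmod_mult, Cmod_Ci, !Cmod_R. lra.
  - unfold Ci, RtoC, Cplus, Cmult, Re, Im; destruct c; simpl. f_equal; ring.
Qed.

Lemma is_cderiv_ext_loc (f g : C -> C) (z l : C) (d : R) :
  d > 0 -> (forall h, Cmod h < d -> f (z + h)%C = g (z + h)%C) ->
  is_cderiv f z l -> is_cderiv g z l.
Proof.
  intros Hd E Hf eps He. destruct (Hf eps He) as [d1 [Hd1 H]].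
  exists (Rmin d d1). split; [apply Rmin_pos; lra|].
  intros h Hh.
  assert (Cmod h < d) by (eapply Rlt_le_trans; [apply Hh|apply Rmin_l]).
  assert (Cmod h < d1) by (eapply Rlt_le_trans; [apply Hh|apply Rmin_r]).
  rewrite <- E by assumption.
  assert (E0 := E (RtoC 0)). rewrite Cplus_0_r in E0. rewrite <- E0; auto.
  rewrite Cmod_0; lra.
Qed.

Lemma is_cderiv_const (c z : C) : is_cderiv (fun _ => c) z 0.
Proof.
  intros eps He. exists 1. split; [lra|]. intros h _.
  replace (c - c - 0 * h)%C with (RtoC 0) by ring. rewrite Cmod_0.
  apply Rmult_le_pos; [lra|apply Cmod_ge_0].
Qed.

Lemma is_cderiv_id (z : C) : is_cderiv (fun w => w) z 1.
Proof.
  intros eps He. exists 1. split; [lra|]. intros h _.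
  replace (z + h - z - 1 * h)%C with (RtoC 0) by ring. rewrite Cmod_0.
  apply Rmult_le_pos; [lra|apply Cmod_ge_0].
Qed.

Lemma is_cderiv_plus (f g : C -> C) (z l m : C) :
  is_cderiv f z l -> is_cderiv g z m -> is_cderiv (fun w => f w + g w)%C z (l + m)%C.
Proof.
  intros Hf Hg eps He.
  destruct (Hf (eps / 2)) as [d1 [Hd1 H1]]; [lra|].
  destruct (Hg (eps / 2)) as [d2 [Hd2 H2]]; [lra|].
  exists (Rmin d1 d2). split; [apply Rmin_pos; lra|]. intros h Hh.
  assert (A1 := H1 h (Rlt_min_l Hh)).
  assert (A2 := H2 h (Rlt_min_r Hh)).
  replace (f (z + h) + g (z + h) - (f z + g z) - (l + m) * h)%C
    with ((f (z + h) - f z - l * h) + (g (z + h) - g z - m * h))%C by ring.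
  eapply Rle_trans; [apply Cmod_triangle|]. lra.
Qed.

Lemma is_cderiv_bound (f : C -> C) (z l : C) :
  is_cderiv f z l -> exists delta, delta > 0 /\
    forall h, Cmod h < delta -> Cmod (f (z + h) - f z)%C <= (Cmod l + 1) * Cmod h.
Proof.
  intros Hf. destruct (Hf 1) as [d [Hd H]]; [lra|].
  exists d. split; [exact Hd|]. intros h Hh. specialize (H h Hh).
  replace (f (z + h) - f z)%C with ((f (z + h) - f z - l * h) + l * h)%C by ring.
  eapply Rle_trans; [apply Cmod_triangle|]. rewrite Cmod_mult. lra.
Qed.

Lemma is_cderiv_cont (f : C -> C) (z l : C) (S : C -> Prop) :
  is_cderiv f z l -> cont_within S f z.
Proof.
  intros Hf eps He. destruct (is_cderiv_bound f z l Hf) as [d [Hd H]].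
  assert (Hl := Cmod_ge_0 l).
  exists (Rmin d (eps / (Cmod l + 2))). split.
  { apply Rmin_pos; [lra|]. apply Rdiv_lt_0_compat; lra. }
  intros w _ Hw.
  assert (A := H (w - z)%C (Rlt_min_l Hw)).
  replace (z + (w - z))%C with w in A by ring.
  assert (B := Rlt_min_r Hw).
  apply (Rmult_lt_compat_r (Cmod l + 2)) in B; [|lra].
  replace (eps / (Cmod l + 2) * (Cmod l + 2)) with eps in B by (field; lra).
   nra.
Qed.

(** Absorbs a constant into the error once and for all. Restricting to [e <= 1] lets quadratic error
    terms be bounded by linear ones. *)
Lemma is_cderiv_scaled (K : R) (f : C -> C) (z l : C) :
  (forall e, 0 < e <= 1 -> exists delta, delta > 0 /\
    forall h, Cmod h < delta -> Cmod (f (z + h) - f z - l * h)%C <= e * K * Cmod h) ->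
  is_cderiv f z l.
Proof.
  intros H eps He.
  assert (HK := Rabs_pos K).
  set (e := Rmin 1 (eps / (Rabs K + 1))).
  assert (He' : e > 0) by (apply Rmin_pos; [lra|apply Rdiv_lt_0_compat; lra]).
  destruct (H e) as [d [Hd H1]]; [split; [exact He'|apply Rmin_l]|].
  exists d. split; [exact Hd|]. intros h Hh.
  eapply Rle_trans; [apply H1, Hh|].
  apply Rmult_le_compat_r; [apply Cmod_ge_0|].
  assert (e * (Rabs K + 1) <= eps).
  { apply Rle_trans with (eps / (Rabs K + 1) * (Rabs K + 1)).
    - apply Rmult_le_compat_r; [lra|apply Rmin_r].
    - right; field; lra. }
  assert (K <= Rabs K) by apply Rle_abs. nra.
Qed.

Lemma is_cderiv_mult (f g : C -> C) (z l m : C) :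
  is_cderiv f z l -> is_cderiv g z m ->
  is_cderiv (fun w => f w * g w)%C z (l * g z + f z * m)%C.
Proof.
  intros Hf Hg.
  destruct (is_cderiv_bound f z l Hf) as [d0 [Hd0 H0]].
  apply (is_cderiv_scaled (Cmod (g z) + Cmod (f z) + (Cmod l + 1) * (Cmod m + 1))).
  intros e [He' He1].
  destruct (Hf e He') as [d1 [Hd1 H1]].
  destruct (Hg e He') as [d2 [Hd2 H2]].
  (* Including [e] forces [|h| < e], so the product of the two increments, of order [|h|^2], is at
     most a constant times [e |h|]. *)
  exists (Rmin (Rmin d0 e) (Rmin d1 d2)). split; [repeat apply Rmin_pos; lra|]. intros h Hh.
  assert (B1 := Rlt_min_l Hh).
  assert (B2 := Rlt_min_r Hh).
  assert (A0 := H0 h (Rlt_min_l B1)).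
  assert (Ae := Rlt_min_r B1).
  assert (A1 := H1 h (Rlt_min_l B2)).
  assert (A2 := H2 h (Rlt_min_r B2)).
  replace (f (z + h) * g (z + h) - f z * g z - (l * g z + f z * m) * h)%C
    with ((f (z + h) - f z - l * h) * g z + (f z * (g (z + h) - g z - m * h)
      + (f (z + h) - f z) * ((g (z + h) - g z - m * h) + m * h)))%C by ring.
  eapply Rle_trans; [apply Cmod_triangle|].
  eapply Rle_trans; [apply Rplus_le_compat_l; apply Cmod_triangle|].
  rewrite !Cmod_mult.
  assert (T := Cmod_triangle (g (z + h) - g z - m * h)%C (m * h)%C).
  rewrite Cmod_mult in T.
  set (a := Cmod (f (z + h) - f z - l * h)%C) in *.
  set (b := Cmod (g (z + h) - g z - m * h)%C) in *.
  set (c := Cmod (f (z + h) - f z)%C) in *.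
  set (u := Cmod (g (z + h) - g z - m * h + m * h)%C) in *.
    assert (P2 := Cmod_ge_0 m).
  assert (P3 := Cmod_ge_0 (f z)). assert (P4 := Cmod_ge_0 (g z)).
  assert (Pc : 0 <= c) by apply Cmod_ge_0.
  assert (Pu : 0 <= u) by apply Cmod_ge_0.
  set (H := Cmod h) in *.
  assert (T1 : a * Cmod (g z) <= (e * H) * Cmod (g z)) by (apply Rmult_le_compat_r; lra).
  assert (T2 : Cmod (f z) * b <= Cmod (f z) * (e * H)) by (apply Rmult_le_compat_l; lra).
  assert (T3 : c * u <= ((Cmod l + 1) * H) * ((Cmod m + 1) * e)).
  { apply Rmult_le_compat; try assumption. nra. }
  lra.
Qed.

Lemma is_cderiv_inv (f : C -> C) (z l : C) :
  is_cderiv f z l -> f z <> 0 -> is_cderiv (fun w => / f w)%C z (- l / (f z * f z))%C.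
Proof.
  intros Hf Hz.
  assert (Pz : 0 < Cmod (f z)) by (apply Cmod_gt_0; exact Hz).
  destruct (is_cderiv_bound f z l Hf) as [d0 [Hd0 H0]].
  destruct (is_cderiv_cont f z l (fun _ => True) Hf (Cmod (f z) / 2)) as [d3 [Hd3 H3]]; [lra|].
  set (F := Cmod (f z)) in *.
  apply (is_cderiv_scaled (2 / (F * F) + 2 * (Cmod l + 1) * (Cmod l + 1) / (F * F * F))).
  intros e [He' He1].
  destruct (Hf e He') as [d1 [Hd1 H1]].
  exists (Rmin (Rmin d0 e) (Rmin d1 d3)). split; [repeat apply Rmin_pos; lra|]. intros h Hh.
  assert (B1 := Rlt_min_l Hh).
  assert (B2 := Rlt_min_r Hh).
  assert (A0 := H0 h (Rlt_min_l B1)).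
  assert (Ae := Rlt_min_r B1).
  assert (A1 := H1 h (Rlt_min_l B2)).
  assert (A3 : Cmod (f (z + h) - f z)%C < F / 2).
  { apply H3; [exact I|]. replace (z + h - z)%C with h by ring.
    apply (Rlt_min_r B2). }
  assert (Hlow : F / 2 <= Cmod (f (z + h)%C)).
  { assert (Q := Cmod_minus_ge (f z) (f (z + h)%C)). rewrite Cmod_minus_sym in Q. unfold F in *. lra. }
  assert (Hnz : f (z + h)%C <> 0) by (apply Cmod_gt_0; lra).
  replace (/ f (z + h) - / f z - - l / (f z * f z) * h)%C
    with (((f (z + h) - f z) * (f (z + h) - f z)) / (f (z + h) * (f z * f z))
          - (f (z + h) - f z - l * h) / (f z * f z))%C by (field; auto).
  eapply Rle_trans; [apply Cmod_triangle_minus|].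
  assert (Hff : (f z * f z)%C <> 0) by (apply Cmult_neq_0; auto).
  rewrite !Cmod_div, !Cmod_mult; [|apply Cmult_neq_0; auto|apply Cmult_neq_0; auto].
  fold F.
  set (a := Cmod (f (z + h) - f z - l * h)%C) in *.
  set (c := Cmod (f (z + h) - f z)%C) in *.
  set (G := Cmod (f (z + h)%C)) in *.
  set (H := Cmod h) in *.
   assert (P1 := Cmod_ge_0 l).
  assert (Pc : 0 <= c) by apply Cmod_ge_0.
  assert (Pa : 0 <= a) by apply Cmod_ge_0.
  assert (T1 : a / (F * F) <= e * (2 / (F * F)) * H).
  { unfold Rdiv. assert (0 < / (F * F)) by (apply Rinv_0_lt_compat; nra).
    apply Rle_trans with ((e * H) * / (F * F)); [apply Rmult_le_compat_r; lra|]. nra. }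
  assert (T2 : c * c / (G * (F * F)) <= e * (2 * (Cmod l + 1) * (Cmod l + 1) / (F * F * F)) * H).
  { apply Rle_trans with (c * c / (F / 2 * (F * F))).
    - unfold Rdiv. apply Rmult_le_compat_l; [nra|].
      apply Rinv_le_contravar; [|apply Rmult_le_compat_r; nra].
      apply Rmult_lt_0_compat; nra.
    - replace (c * c / (F / 2 * (F * F))) with (c * c * (2 / (F * F * F))) by (field; lra).
      replace (e * (2 * (Cmod l + 1) * (Cmod l + 1) / (F * F * F)) * H)
        with ((e * (Cmod l + 1)) * ((Cmod l + 1) * H) * (2 / (F * F * F))) by (field; lra).
      apply Rmult_le_compat_r.
      { apply Rlt_le, Rdiv_lt_0_compat; [lra|]. repeat apply Rmult_lt_0_compat; lra. }
      apply Rmult_le_compat; nra. }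
  lra.
Qed.

Lemma is_cderiv_comp (f g : C -> C) (z l m : C) :
  is_cderiv f z l -> is_cderiv g (f z) m -> is_cderiv (fun w => g (f w)) z (m * l)%C.
Proof.
  intros Hf Hg.
  destruct (is_cderiv_bound f z l Hf) as [d0 [Hd0 H0]].
  apply (is_cderiv_scaled ((Cmod l + 1) + Cmod m)).
  intros e [He' He1].
  destruct (Hf e He') as [d1 [Hd1 H1]].
  destruct (Hg e He') as [d2 [Hd2 H2]].
  assert (P1 := Cmod_ge_0 l). assert (P2 := Cmod_ge_0 m).
  exists (Rmin (Rmin d0 d1) (d2 / (Cmod l + 1))).
  assert (0 < d2 / (Cmod l + 1)) by (apply Rdiv_lt_0_compat; lra).
  split; [repeat apply Rmin_pos; lra|]. intros h Hh.
  assert (B1 := Rlt_min_l Hh).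
  assert (B2 := Rlt_min_r Hh).
  assert (A0 := H0 h (Rlt_min_l B1)).
  assert (A1 := H1 h (Rlt_min_r B1)).
  apply (Rmult_lt_compat_r (Cmod l + 1)) in B2; [|lra].
  replace (d2 / (Cmod l + 1) * (Cmod l + 1)) with d2 in B2 by (field; lra).
  assert (A2 := H2 (f (z + h) - f z)%C ltac:(lra)).
  replace (f z + (f (z + h) - f z))%C with (f (z + h)%C) in A2 by ring.
  replace (g (f (z + h)) - g (f z) - m * l * h)%C
   with ((g (f (z + h)) - g (f z) - m * (f (z + h) - f z)) + m * (f (z + h) - f z - l * h))%C by ring.
  eapply Rle_trans; [apply Cmod_triangle|]. rewrite Cmod_mult.
  assert (Cmod m * Cmod (f (z + h) - f z - l * h)%C <= Cmod m * (e * Cmod h))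
    by (apply Rmult_le_compat_l; lra).
  assert (e * Cmod (f (z + h) - f z)%C <= e * ((Cmod l + 1) * Cmod h))
    by (apply Rmult_le_compat_l; lra).
  lra.
Qed.

Lemma cderivable_ext_loc (f g : C -> C) (z : C) (d : R) :
  d > 0 -> (forall h, Cmod h < d -> f (z + h)%C = g (z + h)%C) ->
  cderivable f z -> cderivable g z.
Proof. intros Hd E [l H]. exists l. eapply is_cderiv_ext_loc; eauto. Qed.

Lemma cderivable_const (c z : C) : cderivable (fun _ => c) z.
Proof. exists (RtoC 0). apply is_cderiv_const. Qed.

Lemma cderivable_id (z : C) : cderivable (fun w => w) z.
Proof. exists (RtoC 1). apply is_cderiv_id. Qed.

Lemma cderivable_plus (f g : C -> C) (z : C) :
  cderivable f z -> cderivable g z -> cderivable (fun w => f w + g w)%C z.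
Proof. intros [l Hl] [m Hm]. eexists. apply is_cderiv_plus; eauto. Qed.

Lemma cderivable_mult (f g : C -> C) (z : C) :
  cderivable f z -> cderivable g z -> cderivable (fun w => f w * g w)%C z.
Proof. intros [l Hl] [m Hm]. eexists. apply is_cderiv_mult; eauto. Qed.

Lemma cderivable_opp (f : C -> C) (z : C) :
  cderivable f z -> cderivable (fun w => - f w)%C z.
Proof.
  intros H. apply (cderivable_ext_loc (fun w => (- (1)) * f w)%C _ z 1); [lra|intros; ring|].
  apply cderivable_mult; [apply cderivable_const|exact H].
Qed.

Lemma cderivable_minus (f g : C -> C) (z : C) :
  cderivable f z -> cderivable g z -> cderivable (fun w => f w - g w)%C z.
Proof. intros Hf Hg. apply cderivable_plus; [exact Hf|apply cderivable_opp, Hg]. Qed.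

Lemma cderivable_inv (f : C -> C) (z : C) :
  cderivable f z -> f z <> 0 -> cderivable (fun w => / f w)%C z.
Proof. intros [l Hl] Hz. eexists. apply is_cderiv_inv; eauto. Qed.

Lemma cderivable_div (f g : C -> C) (z : C) :
  cderivable f z -> cderivable g z -> g z <> 0 -> cderivable (fun w => f w / g w)%C z.
Proof. intros Hf Hg Hz. apply cderivable_mult; [exact Hf|apply cderivable_inv; assumption]. Qed.

Lemma cderivable_comp (f g : C -> C) (z : C) :
  cderivable f z -> cderivable g (f z) -> cderivable (fun w => g (f w)) z.
Proof. intros [l Hl] [m Hm]. eexists. eapply is_cderiv_comp; eauto. Qed.

Lemma cderivable_pow (f : C -> C) (z : C) (n : nat) :
  cderivable f z -> cderivable (fun w => f w ^ n)%C z.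
Proof.
  intros H. induction n; simpl; [apply cderivable_const|apply cderivable_mult; assumption].
Qed.

Lemma cderivable_cont (S : C -> Prop) (f : C -> C) (z : C) :
  cderivable f z -> cont_within S f z.
Proof. intros [l H]. eapply is_cderiv_cont; eauto. Qed.

Lemma cont_within_const (S : C -> Prop) (c z : C) : cont_within S (fun _ => c) z.
Proof. apply cderivable_cont, cderivable_const. Qed.

Lemma cont_within_id (S : C -> Prop) (z : C) : cont_within S (fun w => w) z.
Proof. apply cderivable_cont, cderivable_id. Qed.

Lemma cont_within_comp (S S' : C -> Prop) (f g : C -> C) (z : C) :
  (forall w, S w -> S' (f w)) ->
  cont_within S f z -> cont_within S' g (f z) -> cont_within S (fun w => g (f w)) z.
Proof.
  intros HS Hf Hg eps He. destruct (Hg eps He) as [d [Hd H]].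
  destruct (Hf d Hd) as [d' [Hd' H']]. exists d'. split; [exact Hd'|].
  intros w Sw Hw. apply H; auto.
Qed.

Lemma cont_within_plus (S : C -> Prop) (f g : C -> C) (z : C) :
  cont_within S f z -> cont_within S g z -> cont_within S (fun w => f w + g w)%C z.
Proof.
  intros Hf Hg eps He.
  destruct (Hf (eps / 2)) as [d1 [Hd1 H1]]; [lra|].
  destruct (Hg (eps / 2)) as [d2 [Hd2 H2]]; [lra|].
  exists (Rmin d1 d2). split; [apply Rmin_pos; lra|]. intros w Sw Hw.
  assert (A1 := H1 w Sw (Rlt_min_l Hw)).
  assert (A2 := H2 w Sw (Rlt_min_r Hw)).
  replace (f w + g w - (f z + g z))%C with ((f w - f z) + (g w - g z))%C by ring.
  eapply Rle_lt_trans; [apply Cmod_triangle|]. lra.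
Qed.

Lemma cont_within_mult (S : C -> Prop) (f g : C -> C) (z : C) :
  cont_within S f z -> cont_within S g z -> cont_within S (fun w => f w * g w)%C z.
Proof.
  intros Hf Hg eps He.
  set (K := Cmod (f z) + Cmod (g z) + 2).
  assert (HK : K >= 2) by (unfold K; generalize (Cmod_ge_0 (f z)) (Cmod_ge_0 (g z)); lra).
  set (e := Rmin 1 (eps / K)).
  assert (He' : e > 0) by (apply Rmin_pos; [lra|apply Rdiv_lt_0_compat; lra]).
  assert (He1 : e <= 1) by apply Rmin_l.
  assert (He2 : e * K <= eps).
  { apply Rle_trans with (eps / K * K).
    - apply Rmult_le_compat_r; [lra|apply Rmin_r].
    - right; field; lra. }
  destruct (Hf e He') as [d1 [Hd1 H1]].
  destruct (Hg e He') as [d2 [Hd2 H2]].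
  exists (Rmin d1 d2). split; [apply Rmin_pos; lra|]. intros w Sw Hw.
  assert (A1 := H1 w Sw (Rlt_min_l Hw)).
  assert (A2 := H2 w Sw (Rlt_min_r Hw)).
  replace (f w * g w - f z * g z)%C
    with ((f w - f z) * g z + (f z * (g w - g z) + (f w - f z) * (g w - g z)))%C by ring.
  eapply Rle_lt_trans; [apply Cmod_triangle|].
  eapply Rle_lt_trans; [apply Rplus_le_compat_l, Cmod_triangle|].
  rewrite !Cmod_mult. unfold K in *.
  assert (P1 := Cmod_ge_0 (f z)). assert (P2 := Cmod_ge_0 (g z)).
  assert (P3 := Cmod_ge_0 (f w - f z)%C). assert (P4 := Cmod_ge_0 (g w - g z)%C).
  nra.
Qed.

Lemma cont_within_opp (S : C -> Prop) (f : C -> C) (z : C) :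
  cont_within S f z -> cont_within S (fun w => - f w)%C z.
Proof.
  intros Hf eps He. destruct (Hf eps He) as [d [Hd H]]. exists d. split; [exact Hd|].
  intros w Sw Hw. replace (- f w - - f z)%C with (- (f w - f z))%C by ring.
  rewrite Cmod_opp. auto.
Qed.

Lemma cont_within_minus (S : C -> Prop) (f g : C -> C) (z : C) :
  cont_within S f z -> cont_within S g z -> cont_within S (fun w => f w - g w)%C z.
Proof. intros Hf Hg. apply cont_within_plus; [exact Hf|apply cont_within_opp, Hg]. Qed.

Lemma cont_within_inv (S : C -> Prop) (f : C -> C) (z : C) :
  cont_within S f z -> f z <> 0 -> cont_within S (fun w => / f w)%C z.
Proof.
  intros Hf Hz.
  apply (cont_within_comp S (fun _ => True) f (fun w => / w)%C); auto.
  apply cderivable_cont. apply (cderivable_inv (fun w => w)); [apply cderivable_id|exact Hz].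
Qed.

Lemma cont_within_div (S : C -> Prop) (f g : C -> C) (z : C) :
  cont_within S f z -> cont_within S g z -> g z <> 0 ->
  cont_within S (fun w => f w / g w)%C z.
Proof. intros Hf Hg Hz. apply cont_within_mult; [exact Hf|apply cont_within_inv; assumption]. Qed.

Lemma cont_within_subset (S S' : C -> Prop) (f : C -> C) (z : C) :
  (forall w, S w -> S' w) -> cont_within S' f z -> cont_within S f z.
Proof.
  intros HS Hf eps He. destruct (Hf eps He) as [d [Hd H]]. exists d. split; [exact Hd|].
  intros w Sw Hw. auto.
Qed.

(** * Compactness *)

(** Instead of monotonicity only [n <= phi n] is recorded: it survives repeated extraction and is
    enough for every later limit. *)
Lemma R_convergent_subseq (u : nat -> R) (a b : R) :
  (forall n, a <= u n <= b) ->
  exists (phi : nat -> nat) (l : R), (forall n, (n <= phi n)%nat) /\ a <= l <= b /\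
    forall eps, eps > 0 -> exists N, forall n, (N <= n)%nat -> Rabs (u (phi n) - l) < eps.
Proof.
  intros Hu.
  destruct (Bolzano_Weierstrass u (fun x => a <= x <= b) (compact_P3 a b) Hu) as [l Hl].
  assert (Hc : forall k : nat, exists n, (k <= n)%nat /\ Rabs (u n - l) < / (INR k + 1)).
  { intros k. assert (Hk : 0 < / (INR k + 1)) by (apply Rinv_0_lt_compat; generalize (pos_INR k); lra).
    destruct (Hl (disc l (mkposreal _ Hk)) k) as [n [Hn Hd]].
    - exists (mkposreal _ Hk). intros x Hx; exact Hx.
    - exists n. split; [exact Hn|exact Hd]. }
  destruct (choice _ Hc) as [phi Hphi].
  assert (Hlim : forall eps, eps > 0 -> exists N, forall n, (N <= n)%nat -> Rabs (u (phi n) - l) < eps).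
  { intros eps He. destruct (nfloor_ex (/ eps)) as [N [_ HN]].
    { apply Rlt_le, Rinv_0_lt_compat; lra. }
    exists N. intros n Hn. eapply Rlt_le_trans; [apply Hphi|].
    rewrite <- (Rinv_inv eps). apply Rinv_le_contravar; [apply Rinv_0_lt_compat; lra|].
    apply le_INR in Hn. lra. }
  exists phi, l. split; [intros n; apply Hphi|]. split; [|exact Hlim].
  split; apply Rnot_lt_le; intros Hlt.
  - destruct (Hlim (a - l)) as [N HN]; [lra|]. specialize (HN N (le_n _)).
    specialize (Hu (phi N)). apply Rabs_def2 in HN. lra.
  - destruct (Hlim (l - b)) as [N HN]; [lra|]. specialize (HN N (le_n _)).
    specialize (Hu (phi N)). apply Rabs_def2 in HN. lra.
Qed.

Lemma C_convergent_subseq (u : nat -> C) (r : R) :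
  (forall n, Cmod (u n) <= r) ->
  exists (phi : nat -> nat) (l : C), (forall n, (n <= phi n)%nat) /\
    forall eps, eps > 0 -> exists N, forall n, (N <= n)%nat -> Cmod (u (phi n) - l)%C < eps.
Proof.
  intros Hu.
  destruct (R_convergent_subseq (fun n => Re (u n)) (- r) r) as [p1 [l1 [Hp1 [_ H1]]]].
  { intros n. apply Rabs_le_between. eapply Rle_trans; [apply re_le_Cmod|apply Hu]. }
  destruct (R_convergent_subseq (fun n => Im (u (p1 n))) (- r) r) as [p2 [l2 [Hp2 [_ H2]]]].
  { intros n. apply Rabs_le_between. eapply Rle_trans; [apply im_le_Cmod|apply Hu]. }
  exists (fun n => p1 (p2 n)), (l1, l2). split.
  { intros n. eapply Nat.le_trans; [apply Hp2|apply Hp1]. }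
  intros eps He. destruct (H1 (eps / 2)) as [N1 HN1]; [lra|].
  destruct (H2 (eps / 2)) as [N2 HN2]; [lra|].
  exists (Nat.max N1 N2). intros n Hn.
  eapply Rle_lt_trans; [apply Cmod_le_re_im|].
  assert (Q2 := Hp2 n). assert (A1 := HN1 (p2 n) ltac:(lia)).
  assert (A2 := HN2 n ltac:(lia)).
  change (Rabs (Re (u (p1 (p2 n))) - l1) + Rabs (Im (u (p1 (p2 n))) - l2) < eps). lra.
Qed.

Lemma joint_cluster_point (z w : nat -> C) (s : nat -> R) (r a b : R) :
  (forall n, Cmod (z n) <= r) -> (forall n, Cmod (w n) <= r) -> (forall n, a <= s n <= b) ->
  exists z0 w0 s0, a <= s0 <= b /\ forall eps (N : nat), eps > 0 -> exists n, (N <= n)%nat /\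
    Cmod (z n - z0)%C < eps /\ Cmod (w n - w0)%C < eps /\ Rabs (s n - s0) < eps.
Proof.
  intros Hz Hw Hs.
  destruct (C_convergent_subseq z r Hz) as [p1 [z0 [Hp1 H1]]].
  destruct (C_convergent_subseq (fun n => w (p1 n)) r) as [p2 [w0 [Hp2 H2]]]; [intros; apply Hw|].
  destruct (R_convergent_subseq (fun n => s (p1 (p2 n))) a b) as [p3 [s0 [Hp3 [Hs0 H3]]]];
    [intros; apply Hs|].
  exists z0, w0, s0. split; [exact Hs0|]. intros eps N He.
  destruct (H1 eps He) as [N1 HN1]. destruct (H2 eps He) as [N2 HN2].
  destruct (H3 eps He) as [N3 HN3].
  set (n := Nat.max N (Nat.max N1 (Nat.max N2 N3))).
  assert (E3 := Hp3 n). assert (E2 := Hp2 (p3 n)). assert (E1 := Hp1 (p2 (p3 n))).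
  exists (p1 (p2 (p3 n))). split; [unfold n in *; lia|].
  split; [apply HN1; unfold n in *; lia|].
  split; [apply HN2; unfold n in *; lia|apply HN3; unfold n; lia].
Qed.

Lemma C_cluster_point (z : nat -> C) (r : R) :
  (forall n, Cmod (z n) <= r) ->
  exists z0, Cmod z0 <= r /\ forall eps (N : nat), eps > 0 -> exists n, (N <= n)%nat /\
    Cmod (z n - z0)%C < eps.
Proof.
  intros Hz. destruct (C_convergent_subseq z r Hz) as [p1 [z0 [Hp1 H1]]].
  exists z0. split.
  - apply Rnot_lt_le; intros Hlt. destruct (H1 (Cmod z0 - r)) as [N HN]; [lra|].
    specialize (HN N (le_n _)). rewrite Cmod_minus_sym in HN.
    assert (Q := Cmod_minus_ge z0 (z (p1 N))). specialize (Hz (p1 N)). lra.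
  - intros eps N He. destruct (H1 eps He) as [N1 HN1].
    exists (p1 (Nat.max N N1)). split; [generalize (Hp1 (Nat.max N N1)); lia|apply HN1; lia].
Qed.

(** A maximising sequence that also exists when [V] is unbounded, so maxima on compact sets are
    found without proving boundedness beforehand. *)
Lemma sup_sequence {X : Type} (D : X -> Prop) (V : X -> R) :
  (exists x, D x) ->
  exists u : nat -> X, (forall n, D (u n)) /\
    forall x, D x -> forall eps, eps > 0 -> exists N, forall n, (N <= n)%nat -> V x - eps < V (u n).
Proof.
  intros [x0 Hx0].
  destruct (classic (bound (fun r => exists x, D x /\ r = V x))) as [Hb|Hb].
  - destruct (completeness _ Hb) as [m [Hm1 Hm2]]; [exists (V x0); eauto|].
    assert (Hc : forall n : nat, exists x, D x /\ m - / (INR n + 1) < V x).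
    { intros n. apply NNPP; intros Hn.
      assert (Hk : 0 < / (INR n + 1)) by (apply Rinv_0_lt_compat; generalize (pos_INR n); lra).
      assert (m <= m - / (INR n + 1)); [|lra].
      apply Hm2. intros r [x [Dx ->]]. apply Rnot_lt_le; intros Hlt. apply Hn; eauto. }
    destruct (choice _ Hc) as [u Hu]. exists u. split; [intros n; apply Hu|].
    intros x Dx eps He. destruct (nfloor_ex (/ eps)) as [N [_ HN]].
    { apply Rlt_le, Rinv_0_lt_compat; lra. }
    exists N. intros n Hn. assert (V x <= m) by (apply Hm1; eauto).
    destruct (Hu n) as [_ H2].
    assert (/ (INR n + 1) <= eps); [|lra].
    rewrite <- (Rinv_inv eps). apply Rinv_le_contravar; [apply Rinv_0_lt_compat; lra|].
    apply le_INR in Hn. lra.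
  - assert (Hc : forall n : nat, exists x, D x /\ INR n < V x).
    { intros n. apply NNPP; intros Hn. apply Hb. exists (INR n).
      intros r [x [Dx ->]]. apply Rnot_lt_le; intros Hlt. apply Hn; eauto. }
    destruct (choice _ Hc) as [u Hu]. exists u. split; [intros n; apply Hu|].
    intros x Dx eps He. destruct (nfloor_ex (Rabs (V x))) as [N [_ HN]]; [apply Rabs_pos|].
    exists (S N). intros n Hn. destruct (Hu n) as [_ H2].
    apply le_INR in Hn. rewrite S_INR in Hn. assert (Q := Rle_abs (V x)). lra.
Qed.

Lemma disk_max_attained (V : C -> R) (c : C) (r : R) :
  0 <= r ->
  (forall z, Cmod (z - c)%C <= r -> forall eps, eps > 0 -> exists delta, delta > 0 /\
     forall w, Cmod (w - c)%C <= r -> Cmod (w - z)%C < delta -> Rabs (V w - V z) < eps) ->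
  exists z, Cmod (z - c)%C <= r /\ forall w, Cmod (w - c)%C <= r -> V w <= V z.
Proof.
  intros Hr HV.
  destruct (sup_sequence (fun z => Cmod (z - c)%C <= r) V) as [u [Hu Hs]].
  { exists c. replace (c - c)%C with (RtoC 0) by ring. rewrite Cmod_0; exact Hr. }
  destruct (C_cluster_point (fun n => u n - c)%C r Hu) as [z0 [Hz0 Hcl]].
  exists (z0 + c)%C. assert (Hin : Cmod (z0 + c - c)%C <= r).
  { replace (z0 + c - c)%C with z0 by ring. exact Hz0. }
  split; [exact Hin|]. intros w Hw. apply Rnot_lt_le; intros Hlt.
  set (e := (V w - V (z0 + c)%C) / 2).
  destruct (HV _ Hin e) as [d [Hd Hc]]; [unfold e; lra|].
  destruct (Hs w Hw e) as [N HN]; [unfold e; lra|].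
  destruct (Hcl d N Hd) as [n [Hn Hdn]].
  specialize (HN n Hn).
  assert (Q := Hc (u n) (Hu n)). replace (u n - (z0 + c))%C with (u n - c - z0)%C in Q by ring.
  specialize (Q Hdn). apply Rabs_def2 in Q. unfold e in *. lra.
Qed.

(** * The maximum principle *)

Lemma continuous_eps_delta (g : R -> R) (x : R) :
  (forall eps, eps > 0 -> exists delta, delta > 0 /\
    forall y, Rabs (y - x) < delta -> Rabs (g y - g x) < eps) -> continuous g x.
Proof.
  intros H. apply filterlim_locally. intros eps.
  destruct (H eps (cond_pos eps)) as [d [Hd Hd']].
  exists (mkposreal d Hd). intros y Hy. apply Hd', Hy.
Qed.

Lemma RInt_near_const (g : R -> R) (a b c E : R) :
  a <= b -> ex_RInt g a b -> (forall x, a < x < b -> Rabs (g x - c) <= E) ->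
  Rabs (RInt g a b - c * (b - a)) <= E * (b - a).
Proof.
  intros Hab Hg H.
  assert (H1 : RInt g a b <= RInt (fun _ => c + E) a b).
  { apply RInt_le; auto; [apply ex_RInt_const|].
    intros x Hx. specialize (H x Hx). apply Rabs_le_between in H. lra. }
  assert (H2 : RInt (fun _ => c - E) a b <= RInt g a b).
  { apply RInt_le; auto; [apply ex_RInt_const|].
    intros x Hx. specialize (H x Hx). apply Rabs_le_between in H. lra. }
  rewrite RInt_const in H1, H2. unfold scal in *; simpl in *; unfold mult in *; simpl in *.
  apply Rabs_le_between. nra.
Qed.

(* The 1-form [P dx + Q dy] is differentiable at the point, with [dP/dy = dQ/dx = b]. *)
Definition closed_form_at (P Q : R -> R -> R) (x0 y0 : R) : Prop :=
  exists a b c, forall eps, eps > 0 -> exists delta, delta > 0 /\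
    forall x y, Rabs (x - x0) < delta -> Rabs (y - y0) < delta ->
      Rabs (P x y - P x0 y0 - a * (x - x0) - b * (y - y0)) <= eps * (Rabs (x - x0) + Rabs (y - y0)) /\
      Rabs (Q x y - Q x0 y0 - b * (x - x0) - c * (y - y0)) <= eps * (Rabs (x - x0) + Rabs (y - y0)).

Lemma diff_continuous_aux (g : R -> R) (x0 a eps delta : R) :
  eps > 0 -> delta > 0 ->
  (forall x, Rabs (x - x0) < delta -> Rabs (g x - g x0 - a * (x - x0)) <= eps * Rabs (x - x0)) ->
  continuous g x0.
Proof.
  intros He Hd H. apply continuous_eps_delta. intros e He'.
  assert (Ha := Rabs_pos a).
  set (d := Rmin delta (e / (Rabs a + eps + 1))).
  assert (Hdd : d > 0).
  { apply Rmin_pos; [lra|]. apply Rdiv_lt_0_compat; lra. }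
  exists d. split; [exact Hdd|]. intros y Hy.
  assert (H1 := H y (Rlt_min_l Hy)).
  assert (H2 := Rlt_min_r Hy).
  apply (Rmult_lt_compat_r (Rabs a + eps + 1)) in H2; [|lra].
  replace (e / (Rabs a + eps + 1) * (Rabs a + eps + 1)) with e in H2 by (field; lra).
  replace (g y - g x0) with ((g y - g x0 - a * (y - x0)) + a * (y - x0)) by ring.
  eapply Rle_lt_trans; [apply Rabs_triang|]. rewrite Rabs_mult.
   nra.
Qed.

Lemma closed_form_continuous (P Q : R -> R -> R) (x0 y0 : R) :
  closed_form_at P Q x0 y0 ->
  continuous (fun x => P x y0) x0 /\ continuous (fun y => Q x0 y) y0.
Proof.
  intros [a [b [c H]]]. destruct (H 1) as [d [Hd H1]]; [lra|].
  assert (Z : forall r, Rabs (r - r) = 0) by (intros r; replace (r - r) with 0 by ring; apply Rabs_R0).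
  split.
  - apply (diff_continuous_aux _ _ a 1 d); try lra. intros x Hx.
    destruct (H1 x y0 Hx) as [H2 _]; [rewrite Z; lra|]. rewrite Z in H2.
    replace (P x y0 - P x0 y0 - a * (x - x0)) with
      (P x y0 - P x0 y0 - a * (x - x0) - b * (y0 - y0)) by ring. lra.
  - apply (diff_continuous_aux _ _ c 1 d); try lra. intros y Hy.
    destruct (H1 x0 y) as [_ H2]; [rewrite Z; lra|exact Hy|]. rewrite Z in H2.
    replace (Q x0 y - Q x0 y0 - c * (y - y0)) with
      (Q x0 y - Q x0 y0 - b * (x0 - x0) - c * (y - y0)) by ring. lra.
Qed.

(** The integral of [P dx + Q dy] around the rectangle, counterclockwise, with opposite sides
    paired. *)
Definition rect_int (P Q : R -> R -> R) (x1 x2 y1 y2 : R) : R :=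
  RInt (fun x => P x y1 - P x y2) x1 x2 + RInt (fun y => Q x2 y - Q x1 y) y1 y2.

(** * Goursat's lemma for rectangles in a half plane *)

Section Goursat.

Variables (P Q : R -> R -> R) (X0 : R).
Hypothesis HPQ : forall x y, x < X0 -> closed_form_at P Q x y.

Let exP (y x1 x2 : R) (h1 : x1 < X0) (h2 : x2 < X0) : ex_RInt (fun x => P x y) x1 x2.
Proof.
  apply (ex_RInt_continuous (fun x => P x y)). intros x Hx.
  assert (x < X0). { apply Rle_lt_trans with (1 := proj2 Hx). apply Rmax_lub_lt; assumption. }
  apply (closed_form_continuous P Q x y), HPQ. assumption.
Qed.

Let exQ (x y1 y2 : R) (h : x < X0) : ex_RInt (fun y => Q x y) y1 y2.
Proof.
  apply (ex_RInt_continuous (fun y => Q x y)). intros y _.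
  apply (closed_form_continuous P Q x y), HPQ. assumption.
Qed.

Lemma rect_int_quarter (x1 x2 x3 y1 y2 y3 : R) :
  x1 < X0 -> x2 < X0 -> x3 < X0 ->
  rect_int P Q x1 x3 y1 y3 =
    rect_int P Q x1 x2 y1 y2 + rect_int P Q x2 x3 y1 y2 +
    (rect_int P Q x1 x2 y2 y3 + rect_int P Q x2 x3 y2 y3).
Proof.
  intros h1 h2 h3. unfold rect_int.
  assert (ED : forall (f g : R -> R) a b, ex_RInt f a b -> ex_RInt g a b ->
     RInt (fun x => f x - g x) a b = RInt f a b - RInt g a b).
  { intros f g a b Hf Hg. apply (RInt_minus f g a b Hf Hg). }
  rewrite !(fun y z => ED (fun x => P x y) (fun x => P x z)) by (apply exP; assumption).
  rewrite !(fun x z => ED (fun y => Q x y) (fun y => Q z y)) by (apply exQ; assumption).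
  assert (CP : forall y, RInt (fun x => P x y) x1 x3 =
     RInt (fun x => P x y) x1 x2 + RInt (fun x => P x y) x2 x3).
  { intros y. symmetry. apply (RInt_Chasles (fun x => P x y)); apply exP; assumption. }
  assert (CQ : forall x, x < X0 -> RInt (fun y => Q x y) y1 y3 =
     RInt (fun y => Q x y) y1 y2 + RInt (fun y => Q x y) y2 y3).
  { intros x Hx. symmetry. apply (RInt_Chasles (fun y => Q x y)); apply exQ; assumption. }
  rewrite !CP, !CQ by assumption. ring.
Qed.

(** The affine part of the form contributes nothing: constants and the terms [a], [c] cancel between
    opposite sides, and the two terms in [b] cancel because the same [b] occurs in [P] and [Q]. Only
    the remainder is left, at most [eps] times the squared size. *)
Lemma rect_int_small (x0 y0 eps : R) :
  x0 < X0 -> eps > 0 -> exists delta, delta > 0 /\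
    forall x1 x2 y1 y2, x1 <= x0 <= x2 -> y1 <= y0 <= y2 -> x2 < X0 ->
      x2 - x1 < delta -> y2 - y1 < delta ->
      Rabs (rect_int P Q x1 x2 y1 y2) <= 2 * eps * (((x2 - x1) + (y2 - y1)) * ((x2 - x1) + (y2 - y1))).
Proof.
  intros Hx0 He. destruct (HPQ x0 y0 Hx0) as [a [b [c H]]].
  destruct (H eps He) as [d [Hd H1]]. exists d. split; [exact Hd|].
  intros x1 x2 y1 y2 Hx Hy HX Dx Dy.
  set (E := eps * ((x2 - x1) + (y2 - y1))).
  assert (HE : forall x y, x1 <= x <= x2 -> y1 <= y <= y2 ->
      Rabs (P x y - P x0 y0 - a * (x - x0) - b * (y - y0)) <= E /\
      Rabs (Q x y - Q x0 y0 - b * (x - x0) - c * (y - y0)) <= E).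
  { intros x y Ix Iy.
    assert (Ax : Rabs (x - x0) <= x2 - x1) by (apply Rabs_le; lra).
    assert (Ay : Rabs (y - y0) <= y2 - y1) by (apply Rabs_le; lra).
    destruct (H1 x y) as [A B]; try lra.
    assert (eps * (Rabs (x - x0) + Rabs (y - y0)) <= E) by (apply Rmult_le_compat_l; lra).
    split; lra. }
  assert (I1 : Rabs (RInt (fun x => P x y1 - P x y2) x1 x2 - (b * (y1 - y2)) * (x2 - x1))
      <= 2 * E * (x2 - x1)).
  { apply RInt_near_const; [lra| |].
    - apply (ex_RInt_minus (fun x => P x y1) (fun x => P x y2)); apply exP; lra.
    - intros x Ix. destruct (HE x y1) as [A1 _]; try lra. destruct (HE x y2) as [A2 _]; try lra.
      apply Rabs_le_between in A1. apply Rabs_le_between in A2. apply Rabs_le_between. lra. }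
  assert (I2 : Rabs (RInt (fun y => Q x2 y - Q x1 y) y1 y2 - (b * (x2 - x1)) * (y2 - y1))
      <= 2 * E * (y2 - y1)).
  { apply RInt_near_const; [lra| |].
    - apply (ex_RInt_minus (fun y => Q x2 y) (fun y => Q x1 y)); apply exQ; lra.
    - intros y Iy. destruct (HE x1 y) as [_ A1]; try lra. destruct (HE x2 y) as [_ A2]; try lra.
      apply Rabs_le_between in A1. apply Rabs_le_between in A2. apply Rabs_le_between. lra. }
  unfold rect_int. unfold E in *.
  apply Rabs_le_between in I1. apply Rabs_le_between in I2. apply Rabs_le_between. lra.
Qed.

Lemma pick_quarter (x y dx dy m : R) :
  x + dx < X0 -> 0 <= dx -> m < Rabs (rect_int P Q x (x + dx) y (y + dy)) ->
  exists q : R * R, (fst q = x \/ fst q = x + dx / 2) /\ (snd q = y \/ snd q = y + dy / 2) /\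
    m / 4 < Rabs (rect_int P Q (fst q) (fst q + dx / 2) (snd q) (snd q + dy / 2)).
Proof.
  intros HX Hdx Hm. apply NNPP; intros Hn.
  assert (A : forall q : R * R, (fst q = x \/ fst q = x + dx / 2) ->
     (snd q = y \/ snd q = y + dy / 2) ->
     Rabs (rect_int P Q (fst q) (fst q + dx / 2) (snd q) (snd q + dy / 2)) <= m / 4).
  { intros q H1 H2. apply Rnot_lt_le; intros Hlt. apply Hn. exists q. auto. }
  assert (A1 := A (x, y) (or_introl eq_refl) (or_introl eq_refl)).
  assert (A2 := A (x + dx / 2, y) (or_intror eq_refl) (or_introl eq_refl)).
  assert (A3 := A (x, y + dy / 2) (or_introl eq_refl) (or_intror eq_refl)).
  assert (A4 := A (x + dx / 2, y + dy / 2) (or_intror eq_refl) (or_intror eq_refl)).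
  simpl in *.
  replace (x + dx / 2 + dx / 2) with (x + dx) in * by field.
  replace (y + dy / 2 + dy / 2) with (y + dy) in * by field.
  rewrite (rect_int_quarter x (x + dx / 2) (x + dx) y (y + dy / 2) (y + dy)) in Hm by lra.
  apply Rabs_le_between in A1. apply Rabs_le_between in A2.
  apply Rabs_le_between in A3. apply Rabs_le_between in A4.
  revert Hm. apply Rle_not_lt. apply Rabs_le_between. lra.
Qed.

Lemma nested_limit (u : nat -> R) (d : R) :
  0 <= d -> (forall n, u n <= u (S n) <= u n + d / 2 ^ (S n)) ->
  exists l, forall n, u n <= l <= u n + d / 2 ^ n.
Proof.
  intros Hd Hu.
  assert (Hp : forall n, 0 < 2 ^ n) by (intros; apply pow_lt; lra).
  assert (Hinc : forall n k, u n <= u (n + k)%nat).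
  { intros n k. induction k; [rewrite Nat.add_0_r; lra|].
    rewrite Nat.add_succ_r. specialize (Hu (n + k)%nat). lra. }
  assert (Hdec : forall n k, u (n + k)%nat + d / 2 ^ (n + k) <= u n + d / 2 ^ n).
  { intros n k. induction k; [rewrite Nat.add_0_r; lra|].
    rewrite Nat.add_succ_r. specialize (Hu (n + k)%nat).
    replace (d / 2 ^ (n + k)) with (2 * (d / 2 ^ S (n + k))) in IHk by (simpl; field; apply pow_nonzero; lra).
    lra. }
  assert (Hpos : forall n, 0 <= d / 2 ^ n).
  { intros n. apply Rmult_le_pos; [lra|]. apply Rlt_le, Rinv_0_lt_compat, Hp. }
  assert (Hall : forall n m, u m <= u n + d / 2 ^ n).
  { intros n m. destruct (Nat.le_ge_cases n m) as [h|h].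
    - replace m with (n + (m - n))%nat by lia. specialize (Hdec n (m - n)%nat).
      specialize (Hpos (n + (m - n))%nat). lra.
    - replace n with (m + (n - m))%nat by lia. specialize (Hinc m (n - m)%nat).
      specialize (Hpos (m + (n - m))%nat). lra. }
  destruct (completeness (fun r => exists n, r = u n)) as [l [H1 H2]].
  - exists (u 0%nat + d / 2 ^ 0). intros r [n ->]. apply Hall.
  - exists (u 0%nat). eauto.
  - exists l. intros n. split; [apply H1; eauto|]. apply H2. intros r [m ->]. apply Hall.
Qed.

Lemma goursat_rectangle (x y dx dy : R) :
  0 <= dx -> 0 <= dy -> x + dx < X0 -> rect_int P Q x (x + dx) y (y + dy) = 0.
Proof.
  intros Hdx Hdy HX. apply NNPP; intros Hne.
  (* Half of the value, so that the strict inequality in [st] holds for the initial rectangle. *)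
  set (m := Rabs (rect_int P Q x (x + dx) y (y + dy)) / 2).
  assert (Hm : 0 < m) by (unfold m; apply Rabs_pos_lt in Hne; lra).
  set (st := fun (n : nat) (q : R * R) =>
    fst q + dx / 2 ^ n < X0 /\
    m / 4 ^ n < Rabs (rect_int P Q (fst q) (fst q + dx / 2 ^ n) (snd q) (snd q + dy / 2 ^ n))).
  assert (Hp : forall n, 0 < 2 ^ n) by (intros; apply pow_lt; lra).
  assert (Hp4 : forall n, 0 < 4 ^ n) by (intros; apply pow_lt; lra).
  assert (Hdn : forall n, 0 <= dx / 2 ^ n).
  { intros n. apply Rmult_le_pos; [lra|]. apply Rlt_le, Rinv_0_lt_compat, Hp. }
  assert (Hdm : forall n, 0 <= dy / 2 ^ n).
  { intros n. apply Rmult_le_pos; [lra|]. apply Rlt_le, Rinv_0_lt_compat, Hp. }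
  assert (Hh : forall d n, d / 2 ^ n / 2 = d / 2 ^ S n).
  { intros d n. simpl. field. apply pow_nonzero; lra. }
  assert (Hh' : forall d n, d / 2 ^ n = 2 * (d / 2 ^ S n)).
  { intros d n. simpl. field. apply pow_nonzero; lra. }
  (* The validity of the state is a premise inside the existential, so that [choice] yields a total
     successor function; invalid states are sent to a dummy corner. *)
  assert (step : forall nq : nat * (R * R), exists q' : R * R, st (fst nq) (snd nq) ->
    st (S (fst nq)) q' /\ fst (snd nq) <= fst q' <= fst (snd nq) + dx / 2 ^ S (fst nq) /\
       snd (snd nq) <= snd q' <= snd (snd nq) + dy / 2 ^ S (fst nq)).
  { intros [n q]; simpl fst; simpl snd. destruct (classic (st n q)) as [[A B]|Hq].
    2: { exists (0, 0). intros; contradiction. }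
    destruct (pick_quarter (fst q) (snd q) (dx / 2 ^ n) (dy / 2 ^ n) (m / 4 ^ n)) as [q' [C1 [C2 C3]]]; auto.
    exists q'. intros _. rewrite !Hh in *.
    assert (D1 := Hdn (S n)). assert (D2 := Hdm (S n)).
    assert (E1 := Hh' dx n).
    split; [split|].
    - destruct C1 as [-> | ->]; lra.
    - replace (m / 4 ^ S n) with (m / 4 ^ n / 4) by (simpl; field; apply pow_nonzero; lra). exact C3.
    - split; [destruct C1 as [-> | ->]|destruct C2 as [-> | ->]]; lra. }
  destruct (choice _ step) as [nxt Hnxt].
  set (q := fix q n := match n with O => (x, y) | S k => nxt (k, q k) end).
  assert (Hq : forall n, st n (q n)).
  { induction n.
    - split; simpl.
      + replace (dx / 1) with dx by field. lra.
      + replace (dx / 1) with dx by field. replace (dy / 1) with dy by field.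
        replace (m / 1) with m by field. unfold m in *. lra.
    - apply (Hnxt (n, q n) IHn). }
  assert (Hx : forall n, fst (q n) <= fst (q (S n)) <= fst (q n) + dx / 2 ^ S n).
  { intros n. apply (Hnxt (n, q n) (Hq n)). }
  assert (Hy : forall n, snd (q n) <= snd (q (S n)) <= snd (q n) + dy / 2 ^ S n).
  { intros n. apply (Hnxt (n, q n) (Hq n)). }
  destruct (nested_limit (fun n => fst (q n)) dx Hdx Hx) as [lx Hlx].
  destruct (nested_limit (fun n => snd (q n)) dy Hdy Hy) as [ly Hly].
  assert (HlX : lx < X0).
  { specialize (Hlx 0%nat). simpl in Hlx. replace (dx / 1) with dx in Hlx by field. lra. }
  (* The added 1 keeps [L] positive for degenerate rectangles. With tolerance [m / (4 * L)] the
     small-rectangle bound falls below the lower bound [m / 4 ^ n]. *)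
  set (L := (dx + dy) * (dx + dy) + 1).
  assert (HL : 0 < L) by (unfold L; nra).
  destruct (rect_int_small lx ly (m / (4 * L)) HlX) as [d [Hd Hsm]].
  { apply Rdiv_lt_0_compat; lra. }
  assert (Hn : exists n, dx / 2 ^ n < d /\ dy / 2 ^ n < d).
  { destruct (Pow_x_infinity 2) with (b := (dx + dy + 1) / d) as [N HN].
    { rewrite Rabs_pos_eq; lra. }
    exists N. specialize (HN N (le_n _)). rewrite Rabs_pos_eq in HN by (specialize (Hp N); lra).
    apply Rge_le in HN. apply (Rmult_le_compat_r d) in HN; [|lra].
    replace ((dx + dy + 1) / d * d) with (dx + dy + 1) in HN by (field; lra).
    specialize (Hp N).
    split; apply (Rmult_lt_reg_r (2 ^ N)); try lra; unfold Rdiv; rewrite Rmult_assoc, Rinv_l; lra. }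
  destruct Hn as [n [N1 N2]].
  destruct (Hq n) as [S1 S2].
  assert (B := Hsm (fst (q n)) (fst (q n) + dx / 2 ^ n) (snd (q n)) (snd (q n) + dy / 2 ^ n)
     (Hlx n) (Hly n) S1 ltac:(lra) ltac:(lra)).
  replace (fst (q n) + dx / 2 ^ n - fst (q n)) with (dx / 2 ^ n) in B by ring.
  replace (snd (q n) + dy / 2 ^ n - snd (q n)) with (dy / 2 ^ n) in B by ring.
  assert (E : (dx / 2 ^ n + dy / 2 ^ n) * (dx / 2 ^ n + dy / 2 ^ n) = (L - 1) / 4 ^ n).
  { unfold L. replace 4 with (2 * 2) by ring. rewrite Rpow_mult_distr. field. apply pow_nonzero; lra. }
  rewrite E in B.
  assert (2 * (m / (4 * L)) * ((L - 1) / 4 ^ n) <= m / 4 ^ n); [|lra].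
  replace (2 * (m / (4 * L)) * ((L - 1) / 4 ^ n)) with (((L - 1) / (2 * L)) * (m / 4 ^ n))
    by (field; split; [apply pow_nonzero|]; lra).
  assert (0 < m / 4 ^ n) by (apply Rdiv_lt_0_compat; auto).
  assert ((L - 1) / (2 * L) <= 1); [|nra].
  apply (Rmult_le_reg_r (2 * L)); [lra|]. unfold Rdiv. rewrite Rmult_assoc, Rinv_l; lra.
Qed.

End Goursat.

(** * The complex exponential and mean values over circles *)

Definition cexp (z : C) : C := (exp (Re z) * cos (Im z), exp (Re z) * sin (Im z)).

Lemma C_eq (z w : C) : Re z = Re w -> Im z = Im w -> z = w.
Proof. destruct z, w; unfold Re, Im; simpl; intros -> ->; reflexivity. Qed.

Lemma Re_plus (z w : C) : Re (z + w)%C = Re z + Re w. Proof. reflexivity. Qed.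
Lemma Im_plus (z w : C) : Im (z + w)%C = Im z + Im w. Proof. reflexivity. Qed.
Lemma Re_minus (z w : C) : Re (z - w)%C = Re z - Re w. Proof. reflexivity. Qed.
Lemma Im_minus (z w : C) : Im (z - w)%C = Im z - Im w. Proof. reflexivity. Qed.
Lemma Re_mult (z w : C) : Re (z * w)%C = Re z * Re w - Im z * Im w. Proof. reflexivity. Qed.
Lemma Im_mult (z w : C) : Im (z * w)%C = Re z * Im w + Im z * Re w. Proof. reflexivity. Qed.

Lemma cexp_plus (z w : C) : cexp (z + w)%C = (cexp z * cexp w)%C.
Proof.
  apply C_eq; unfold cexp; rewrite ?Re_mult, ?Im_mult; unfold Re, Im; simpl;
    rewrite exp_plus, ?cos_plus, ?sin_plus; ring.
Qed.

Lemma Cmod_cexp (z : C) : Cmod (cexp z) = exp (Re z).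
Proof.
  unfold cexp, Cmod; simpl fst; simpl snd.
  replace ((exp (Re z) * cos (Im z)) ^ 2 + (exp (Re z) * sin (Im z)) ^ 2)
    with (exp (Re z) ^ 2).
  - rewrite sqrt_pow2; [reflexivity|apply Rlt_le, exp_pos].
  - assert (H := sin2_cos2 (Im z)). unfold Rsqr in H.
    replace (exp (Re z) ^ 2) with (exp (Re z) ^ 2 * 1) by ring. rewrite <- H. ring.
Qed.

Lemma derivable_pt_lim_0_mult (f : R -> R) (l eps : R) :
  derivable_pt_lim f 0 l -> eps > 0 -> exists delta, delta > 0 /\
    forall x, Rabs x < delta -> Rabs (f x - f 0 - l * x) <= eps * Rabs x.
Proof.
  intros H He. destruct (H eps He) as [d Hd]. exists d. split; [apply cond_pos|].
  intros x Hx. destruct (Req_dec x 0) as [->|Hn].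
  - replace (f 0 - f 0 - l * 0) with 0 by ring. rewrite Rabs_R0. lra.
  - specialize (Hd x Hn Hx). rewrite Rplus_0_l in Hd.
    replace (f x - f 0 - l * x) with (((f x - f 0) / x - l) * x) by (field; exact Hn).
    rewrite Rabs_mult. apply Rmult_le_compat_r; [apply Rabs_pos|lra].
Qed.

Lemma is_cderiv_cexp_0 : is_cderiv cexp 0 1.
Proof.
  apply (is_cderiv_scaled 8). intros e [He He1].
  destruct (derivable_pt_lim_0_mult exp 1 e derivable_pt_lim_exp_0 He) as [d1 [Hd1 H1]].
  destruct (derivable_pt_lim_0_mult cos (- sin 0) e (derivable_pt_lim_cos 0) He) as [d2 [Hd2 H2]].
  destruct (derivable_pt_lim_0_mult sin (cos 0) e (derivable_pt_lim_sin 0) He) as [d3 [Hd3 H3]].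
  rewrite exp_0 in H1. rewrite cos_0, sin_0 in H2. rewrite sin_0, cos_0 in H3.
  exists (Rmin (Rmin d1 d2) (Rmin d3 e)). split; [repeat apply Rmin_pos; lra|].
  intros h Hh.
  assert (B1 := Rlt_min_l Hh).
  assert (B2 := Rlt_min_r Hh).
  assert (C1 := Rlt_min_l B1).
  assert (C2 := Rlt_min_r B1).
  assert (C3 := Rlt_min_l B2).
  assert (C4 := Rlt_min_r B2).
  assert (Rx := re_le_Cmod h). assert (Ry := im_le_Cmod h).
  destruct h as [x y]. simpl in Rx, Ry.
  set (H := Cmod (x, y)) in *.
  assert (A1 := H1 x ltac:(lra)). assert (A2 := H2 y ltac:(lra)). assert (A3 := H3 y ltac:(lra)).
  eapply Rle_trans; [apply Cmod_le_re_im|].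
  unfold cexp. rewrite Cplus_0_l. unfold Re, Im; simpl fst; simpl snd.
  rewrite exp_0, cos_0, sin_0.
  assert (0 <= Rabs x) by apply Rabs_pos. assert (0 <= Rabs y) by apply Rabs_pos.
  assert (Ex : Rabs (exp x - 1) <= 2 * Rabs x).
  { replace (exp x - 1) with ((exp x - 1 - 1 * x) + x) by ring.
    eapply Rle_trans; [apply Rabs_triang|]. nra. }
  assert (Cy : Rabs (cos y) <= 1) by (apply Rabs_le, COS_bound).
  assert (T1 : Rabs (exp x * cos y + - (1 * 1) + - (1 * x - 0 * y)) <= 3 * e * H).
  { replace (exp x * cos y + - (1 * 1) + - (1 * x - 0 * y)) with
      ((exp x - 1 - 1 * x) * cos y + (1 + x) * (cos y - 1 - - 0 * y)) by ring.
    eapply Rle_trans; [apply Rabs_triang|]. rewrite !Rabs_mult.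
    assert (Rabs (1 + x) <= 2).
    { eapply Rle_trans; [apply Rabs_triang|]. rewrite Rabs_R1. lra. }
    assert (Rabs (exp x - 1 - 1 * x) * Rabs (cos y) <= e * H * 1).
    { apply Rmult_le_compat; try apply Rabs_pos; nra. }
    assert (Rabs (1 + x) * Rabs (cos y - 1 - - 0 * y) <= 2 * (e * H)).
    { apply Rmult_le_compat; try apply Rabs_pos; nra. }
    lra. }
  assert (T2 : Rabs (exp x * sin y + - (1 * 0) + - (1 * y + 0 * x)) <= 5 * e * H).
  { replace (exp x * sin y + - (1 * 0) + - (1 * y + 0 * x)) with
      ((exp x - 1) * sin y + (sin y - 0 - 1 * y)) by ring.
    eapply Rle_trans; [apply Rabs_triang|]. rewrite !Rabs_mult.
    assert (Rabs (sin y) <= 1) by (apply Rabs_le, SIN_bound).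
    assert (Rabs (sin y) <= 2 * Rabs y).
    { replace (sin y) with ((sin y - 0 - 1 * y) + y) by ring.
      eapply Rle_trans; [apply Rabs_triang|]. nra. }
    assert (Rabs (exp x - 1) * Rabs (sin y) <= (2 * e) * (2 * Rabs y)).
    { apply Rmult_le_compat; try apply Rabs_pos; nra. }
    assert (Rabs (exp x - 1) * Rabs (sin y) <= (2 * Rabs x) * 1).
    { apply Rmult_le_compat; try apply Rabs_pos; nra. }
    nra. }
  match goal with |- ?a <= _ => replace a with
   (Rabs (exp x * cos y + - (1 * 1) + - (1 * x - 0 * y)) + Rabs (exp x * sin y + - (1 * 0) + - (1 * y + 0 * x))) end.
  - nra.
  - f_equal; f_equal; ring.
Qed.

Lemma is_cderiv_cexp (z : C) : is_cderiv cexp z (cexp z).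
Proof.
  apply (is_cderiv_scaled (Cmod (cexp z))). intros e [He _].
  destruct (is_cderiv_cexp_0 e He) as [d [Hd H]]. exists d. split; [exact Hd|].
  intros h Hh. specialize (H h Hh). rewrite cexp_plus. rewrite Cplus_0_l in H.
  assert (E0 : cexp 0 = 1%C) by (apply C_eq; unfold cexp, Re, Im; simpl; rewrite exp_0, ?cos_0, ?sin_0; ring).
  rewrite E0 in H.
  replace (cexp z * cexp h - cexp z - cexp z * h)%C with (cexp z * (cexp h - 1 - 1 * h))%C by ring.
  rewrite Cmod_mult. assert (P := Cmod_ge_0 (cexp z)). nra.
Qed.

(** [Im g dx + Re g dy] is the imaginary part of [g dz]; by the Cauchy-Riemann equations both mixed
    derivatives are [Re l]. *)
Lemma cderivable_closed_form (g : C -> C) (x y : R) :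
  cderivable g (x, y) ->
  closed_form_at (fun x y => Im (g (x, y))) (fun x y => Re (g (x, y))) x y.
Proof.
  intros [l Hl]. exists (Im l), (Re l), (- Im l). intros eps He.
  destruct (Hl eps He) as [d [Hd H]]. exists (d / 2). split; [lra|].
  intros x' y' Hx Hy.
  set (k := (x' - x, y' - y) : C).
  assert (Hm : Cmod k <= Rabs (x' - x) + Rabs (y' - y)) by apply (Cmod_le_re_im k).
  assert (A := H k ltac:(lra)).
  replace ((x, y) + k)%C with (x', y') in A
    by (apply C_eq; unfold Re, Im; simpl; ring).
  assert (B : eps * Cmod k <= eps * (Rabs (x' - x) + Rabs (y' - y)))
    by (apply Rmult_le_compat_l; lra).
  assert (A1 := re_le_Cmod (g (x', y') - g (x, y) - l * k)%C).
  assert (A2 := im_le_Cmod (g (x', y') - g (x, y) - l * k)%C).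
  rewrite !Re_minus, Re_mult in A1. rewrite !Im_minus, Im_mult in A2.
  change (Re k) with (x' - x) in *. change (Im k) with (y' - y) in *.
  split.
  - replace (Im (g (x', y')) - Im (g (x, y)) - Im l * (x' - x) - Re l * (y' - y))
     with (Im (g (x', y')) - Im (g (x, y)) - (Re l * (y' - y) + Im l * (x' - x))) by ring. lra.
  - replace (Re (g (x', y')) - Re (g (x, y)) - Re l * (x' - x) - - Im l * (y' - y))
     with (Re (g (x', y')) - Re (g (x, y)) - (Re l * (x' - x) - Im l * (y' - y))) by ring. lra.
Qed.

(* In the coordinate [log (z - z0)] the circle means become integrals over vertical
   segments, which Goursat's lemma and periodicity show to be constant. *)
Lemma circle_mean_value (h : C -> C) (z0 : C) (R0 r : R) :
  (forall z, 0 < Cmod (z - z0)%C < R0 -> cderivable h z) ->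
  cont_within (fun _ => True) h z0 ->
  0 < r < R0 ->
  ex_RInt (fun y => Re (h (z0 + cexp (ln r, y))%C)) 0 (2 * PI) /\
  RInt (fun y => Re (h (z0 + cexp (ln r, y))%C)) 0 (2 * PI) = 2 * PI * Re (h z0).
Proof.
  intros Hh Hc Hr.
  assert (HPI := PI_RGT_0).
  set (g := fun w => h (z0 + cexp w)%C).
  assert (Hg : forall x y, x < ln R0 -> cderivable g (x, y)).
  { intros x y Hx. unfold g. apply (cderivable_comp (fun w => z0 + cexp w)%C h).
    - apply cderivable_plus; [apply cderivable_const|]. eexists; apply is_cderiv_cexp.
    - apply Hh. replace (z0 + cexp (x, y) - z0)%C with (cexp (x, y)) by ring.
      rewrite Cmod_cexp. simpl Re. split; [apply exp_pos|].
      rewrite <- (exp_ln R0) by lra. apply exp_increasing, Hx. }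
  set (P := fun x y => Im (g (x, y))). set (Q := fun x y => Re (g (x, y))).
  assert (HPQ : forall x y, x < ln R0 -> closed_form_at P Q x y).
  { intros x y Hx. apply cderivable_closed_form, Hg, Hx. }
  assert (Hex : forall x, x < ln R0 -> ex_RInt (fun y => Q x y) 0 (2 * PI)).
  { intros x Hx. apply (ex_RInt_continuous (fun y => Q x y)). intros y _.
    apply (closed_form_continuous P Q x y), HPQ, Hx. }
  assert (Hln : ln r < ln R0) by (apply ln_increasing; lra).
  split; [apply (Hex (ln r) Hln)|].
  apply cond_eq. intros eps He.
  (* On a small circle of radius [r'] the integrand is this close to [Re (h z0)]; over the length
     [2 * PI] the error is [eps / 2]. *)
  destruct (Hc (eps / (4 * PI))) as [d [Hd Hcont]]; [apply Rdiv_lt_0_compat; lra|].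
  set (r' := Rmin (d / 2) r).
  assert (Hr' : 0 < r') by (apply Rmin_pos; lra).
  assert (Hle : ln r' <= ln r).
  { destruct (Rmin_r (d / 2) r) as [Hlt|Heq]; unfold r' in *.
    - apply Rlt_le, ln_increasing; lra.
    - rewrite Heq; lra. }
  assert (G := goursat_rectangle P Q (ln R0) HPQ (ln r') 0 (ln r - ln r') (2 * PI)
     ltac:(lra) ltac:(lra) ltac:(lra)).
  replace (ln r' + (ln r - ln r')) with (ln r) in G by ring. rewrite Rplus_0_l in G.
  unfold rect_int in G.
  (* The horizontal sides cancel since [cexp] has period [2 pi i], which leaves the equality of the
     two circle integrals. *)
  rewrite (RInt_ext (fun x => P x 0 - P x (2 * PI)) (fun _ => 0)) in G.
  2: { intros x _. unfold P, g, cexp. replace (Im (x, 2 * PI)) with (0 + 2 * PI) by (simpl; ring).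
       change (Im (x, 0)) with 0. change (Re (x, 2 * PI)) with x. change (Re (x, 0)) with x.
       rewrite cos_plus, sin_plus, cos_2PI, sin_2PI, cos_0, sin_0.
       replace (exp x * (1 * 1 - 0 * 0)) with (exp x * 1) by ring.
       replace (exp x * (0 * 1 + 1 * 0)) with (exp x * 0) by ring. apply Rplus_opp_r. }
  rewrite RInt_const in G. unfold scal in G; simpl in G; unfold mult in G; simpl in G.
  rewrite Rmult_0_r, Rplus_0_l in G.
  assert (G2 : RInt (fun y => Q (ln r) y - Q (ln r') y) 0 (2 * PI) =
    RInt (fun y => Q (ln r) y) 0 (2 * PI) - RInt (fun y => Q (ln r') y) 0 (2 * PI)).
  { apply (RInt_minus (fun y => Q (ln r) y) (fun y => Q (ln r') y)); apply Hex; lra. }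
  rewrite G2 in G.
  change (RInt (fun y => Re (h (z0 + cexp (ln r, y))%C)) 0 (2 * PI)) with
     (RInt (fun y => Q (ln r) y) 0 (2 * PI)).
  replace (RInt (fun y => Q (ln r) y) 0 (2 * PI)) with (RInt (fun y => Q (ln r') y) 0 (2 * PI)) by lra.
  assert (N : Rabs (RInt (fun y => Q (ln r') y) 0 (2 * PI) - Re (h z0) * (2 * PI - 0))
    <= eps / (4 * PI) * (2 * PI - 0)).
  { apply RInt_near_const; [lra|apply Hex; lra|].
    intros y _. unfold Q, g. rewrite <- Re_minus. eapply Rle_trans; [apply re_le_Cmod|].
    apply Rlt_le, Hcont; [exact I|].
    replace (z0 + cexp (ln r', y) - z0)%C with (cexp (ln r', y)) by ring.
    rewrite Cmod_cexp. change (Re (ln r', y)) with (ln r'). rewrite exp_ln by exact Hr'.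
    unfold r'. eapply Rle_lt_trans; [apply Rmin_l|]. lra. }
  replace (eps / (4 * PI) * (2 * PI - 0)) with (eps / 2) in N by (field; lra).
  replace (2 * PI * Re (h z0)) with (Re (h z0) * (2 * PI - 0)) by ring. lra.
Qed.

Lemma Cmod_sqr_plus (a k : C) :
  Cmod (a + k)%C ^ 2 = Cmod a ^ 2 + 2 * Re (Cconj a * k)%C + Cmod k ^ 2.
Proof.
  rewrite !Cmod2_alt, Re_mult, Re_plus, Im_plus. unfold Cconj, Re, Im; simpl. ring.
Qed.

Lemma cont_within_Re (S : C -> Prop) (h : C -> C) (z : C) :
  cont_within S h z -> forall eps, eps > 0 -> exists delta, delta > 0 /\
    forall w, S w -> Cmod (w - z)%C < delta -> Rabs (Re (h w) - Re (h z)) < eps.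
Proof.
  intros H eps He. destruct (H eps He) as [d [Hd Hw]]. exists d. split; [exact Hd|].
  intros w Sw D. rewrite <- Re_minus. eapply Rle_lt_trans; [apply re_le_Cmod|auto].
Qed.

Lemma cont_within_center (h : C -> C) (c : C) (r : R) :
  0 < r -> cont_within (fun w => Cmod (w - c)%C <= r) h c -> cont_within (fun _ => True) h c.
Proof.
  intros Hr H eps He. destruct (H eps He) as [d [Hd Hw]].
  exists (Rmin d r). split; [apply Rmin_pos; lra|]. intros w _ D.
  apply Hw; [apply Rlt_le|]; apply (Rlt_le_trans _ _ _ D); [apply Rmin_r|apply Rmin_l].
Qed.

(* Differentiability at the centre is not required, so that the Schwarz lemma can be
   obtained from difference quotients. *)
Lemma max_principle_Re (h : C -> C) (c : C) (r m : R) :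
  0 < r ->
  (forall z, Cmod (z - c)%C <= r -> cont_within (fun w => Cmod (w - c)%C <= r) h z) ->
  (forall z, 0 < Cmod (z - c)%C < r -> cderivable h z) ->
  (forall z, Cmod (z - c)%C = r -> Re (h z) <= m) ->
  forall z, Cmod (z - c)%C <= r -> Re (h z) <= m.
Proof.
  intros Hr Hcont Hder Hbd z1 Hz1. apply Rnot_lt_le; intros Hlt.
  (* Adding [e |z - c|^2] makes the real part strictly subharmonic. On the disk the perturbation is
     at most half of the excess over [m], so the maximum of [V] is still interior. *)
  set (e := (Re (h z1) - m) / (2 * r ^ 2)).
  assert (Hr2 : 0 < r ^ 2) by (simpl; nra).
  assert (He : 0 < e) by (apply Rdiv_lt_0_compat; lra).
  assert (Her : e * r ^ 2 = (Re (h z1) - m) / 2) by (unfold e; field; lra).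
  clearbody e.
  set (V := fun z => Re (h z) + e * Cmod (z - c)%C ^ 2).
  destruct (disk_max_attained V c r) as [z [Hz Hmax]]; [lra| |].
  { intros z Hz eps Heps.
    destruct (cont_within_Re _ h z (Hcont z Hz) (eps / 2)) as [d [Hd Hw]]; [lra|].
    assert (Hq : 0 < eps / (8 * e * r)).
    { apply Rdiv_lt_0_compat; [lra|]. repeat apply Rmult_lt_0_compat; lra. }
    exists (Rmin d (eps / (8 * e * r))). split; [apply Rmin_pos; lra|].
    intros w Hw1 Hw2.
    assert (A1 := Hw w Hw1 (Rlt_min_l Hw2)).
    assert (A2 := Rlt_min_r Hw2).
    assert (A3 : Rabs (Cmod (w - c)%C - Cmod (z - c)%C) <= Cmod (w - z)%C).
    { assert (Q1 := Cmod_minus_ge (w - c)%C (z - c)%C). assert (Q2 := Cmod_minus_ge (z - c)%C (w - c)%C).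
      replace (w - c - (z - c))%C with (w - z)%C in Q1 by ring.
      replace (z - c - (w - c))%C with (z - w)%C in Q2 by ring. rewrite (Cmod_minus_sym z w) in Q2.
      apply Rabs_le_between. lra. }
    assert (P1 := Cmod_ge_0 (w - c)%C). assert (P2 := Cmod_ge_0 (z - c)%C).
    unfold V.
    replace (Re (h w) + e * Cmod (w - c) ^ 2 - (Re (h z) + e * Cmod (z - c) ^ 2))
      with ((Re (h w) - Re (h z)) + e * (Cmod (w - c)%C - Cmod (z - c)%C) * (Cmod (w - c)%C + Cmod (z - c)%C)) by ring.
    eapply Rle_lt_trans; [apply Rabs_triang|].
    rewrite !Rabs_mult, (Rabs_pos_eq e), (Rabs_pos_eq (Cmod (w - c)%C + _)) by lra.
    assert (e * Rabs (Cmod (w - c)%C - Cmod (z - c)%C) * (Cmod (w - c)%C + Cmod (z - c)%C)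
       <= e * (eps / (8 * e * r)) * (2 * r)).
    { apply Rmult_le_compat; try lra.
      - apply Rmult_le_pos; [lra|apply Rabs_pos].
      - apply Rmult_le_compat_l; lra. }
    replace (e * (eps / (8 * e * r)) * (2 * r)) with (eps / 4) in H by (field; lra). lra. }
  assert (Hzr : Cmod (z - c)%C < r).
  { destruct Hz as [Hz|Hz]; [exact Hz|]. exfalso.
    assert (A := Hmax z1 Hz1). unfold V in A. rewrite Hz, Her in A. specialize (Hbd z Hz).
    assert (0 <= e * Cmod (z1 - c)%C ^ 2) by (apply Rmult_le_pos; [lra|apply pow2_ge_0]). lra. }
  (* The circle around the maximum must not enclose [c] unless it is centred there, since
     differentiability at [c] is not assumed. *)
  assert (Hrho : exists rho, 0 < rho /\ rho <= r - Cmod (z - c)%C /\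
     ((z = c) \/ rho <= Cmod (z - c)%C)).
  { destruct (Req_dec (Cmod (z - c)%C) 0) as [E|E].
    - exists (r - Cmod (z - c)%C). split; [lra|]. split; [lra|]. left.
      apply Cmod_eq_0 in E. replace z with (z - c + c)%C by ring. rewrite E. ring.
    - assert (P := Cmod_ge_0 (z - c)%C).
      exists (Rmin (r - Cmod (z - c)%C) (Cmod (z - c)%C)).
      split; [apply Rmin_pos; lra|]. split; [apply Rmin_l|]. right; apply Rmin_r. }
  destruct Hrho as [rho [Hrho [Hrho1 Hrho2]]].
  (* The linear term [k (w - z)] is holomorphic and carries the first-order variation of
     [e |w - c|^2]. At distance [rho / 2] from the maximum this gives
     [Re g <= Re (h z) - e (rho / 2)^2], against the mean value property. *)
  set (k := (2 * e * Cconj (z - c))%C).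
  set (g := fun w => (h w + k * (w - z))%C).
  assert (Hgz : g z = h z) by (unfold g; ring).
  destruct (circle_mean_value g z rho (rho / 2)) as [Ex MV].
  - intros w Hw. unfold g. apply cderivable_plus.
    + apply Hder. assert (T1 := Cmod_triangle_via z w c). split; [|lra].
      destruct Hrho2 as [->|Hrho2]; [lra|].
      assert (T2 := Cmod_triangle_via w z c). rewrite (Cmod_minus_sym z w) in T2. lra.
    + apply cderivable_mult; [apply cderivable_const|].
      apply cderivable_minus; [apply cderivable_id|apply cderivable_const].
  - unfold g. apply cont_within_plus.
    + destruct Hrho2 as [->|Hrho2].
      * apply (cont_within_center h c r Hr). apply Hcont. lra.
      * apply cderivable_cont, Hder. lra.
    + apply cont_within_mult; [apply cont_within_const|].
      apply cont_within_minus; [apply cont_within_id|apply cont_within_const].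
  - lra.
  - rewrite Hgz in MV.
    assert (HPI := PI_RGT_0).
    assert (Hle : RInt (fun y => Re (g (z + cexp (ln (rho / 2), y))%C)) 0 (2 * PI)
       <= RInt (fun _ => Re (h z) - e * (rho / 2) ^ 2) 0 (2 * PI)).
    { apply RInt_le; [lra|exact Ex|apply ex_RInt_const|]. intros y _.
      set (q := cexp (ln (rho / 2), y)).
      assert (Hq : Cmod q = rho / 2).
      { unfold q. rewrite Cmod_cexp. simpl Re. apply exp_ln. lra. }
      assert (Hin : Cmod (z + q - c)%C <= r).
      { replace (z + q - c)%C with ((z - c) + q)%C by ring.
        eapply Rle_trans; [apply Cmod_triangle|]. lra. }
      assert (A := Hmax _ Hin). unfold V in A.
      replace (z + q - c)%C with ((z - c) + q)%C in A by ring.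
      rewrite Cmod_sqr_plus, Hq in A. unfold g, k.
      rewrite Re_plus. replace (z + q - z)%C with q by ring.
      replace (Re (2 * e * Cconj (z - c) * q)%C) with (e * (2 * Re (Cconj (z - c) * q)%C)).
      - lra.
      - unfold Cconj, RtoC; rewrite !Re_mult, !Im_mult; unfold Re, Im; simpl. ring. }
    rewrite MV, (RInt_const 0 (2 * PI) (Re (h z) - e * (rho / 2) ^ 2)) in Hle.
    change (2 * PI * Re (h z) <= (2 * PI - 0) * (Re (h z) - e * (rho / 2) ^ 2)) in Hle.
    assert (0 < PI * (e * (rho * rho))) by (apply Rmult_lt_0_compat; [lra|]; apply Rmult_lt_0_compat; [lra|nra]).
    nra.
Qed.

(** Multiply [h] by the conjugate of its value at the chosen point: there the real part becomes the
    squared modulus, and the principle for real parts applies. *)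
Lemma max_modulus (h : C -> C) (c : C) (r m : R) :
  0 < r ->
  (forall z, Cmod (z - c)%C <= r -> cont_within (fun w => Cmod (w - c)%C <= r) h z) ->
  (forall z, 0 < Cmod (z - c)%C < r -> cderivable h z) ->
  (forall z, Cmod (z - c)%C = r -> Cmod (h z) <= m) ->
  forall z, Cmod (z - c)%C <= r -> Cmod (h z) <= m.
Proof.
  intros Hr Hcont Hder Hbd z1 Hz1.
  set (u := Cconj (h z1)).
  assert (A : Re (u * h z1)%C <= Cmod u * m).
  { apply (max_principle_Re (fun z => u * h z)%C c r (Cmod u * m) Hr); [| | |exact Hz1].
    - intros z Hz. apply cont_within_mult; [apply cont_within_const|auto].
    - intros z Hz. apply cderivable_mult; [apply cderivable_const|auto].
    - intros z Hz. eapply Rle_trans; [apply Rle_abs|].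
      eapply Rle_trans; [apply re_le_Cmod|]. rewrite Cmod_mult.
      apply Rmult_le_compat_l; [apply Cmod_ge_0|auto]. }
  replace (Re (u * h z1)%C) with (Cmod (h z1) ^ 2) in A.
  2: { rewrite Cmod2_alt. unfold u. rewrite Re_mult. unfold Cconj, Re, Im; simpl. ring. }
  unfold u in A. rewrite Cmod_conj in A.
  destruct (Cmod_ge_0 (h z1)) as [P|P].
  - apply (Rmult_le_reg_l (Cmod (h z1))); [exact P|]. simpl in A. lra.
  - rewrite <- P.
    assert (Hc : Cmod (c + r - c)%C = r).
    { replace (c + r - c)%C with (RtoC r) by ring. rewrite Cmod_R. apply Rabs_pos_eq; lra. }
    eapply Rle_trans; [apply Cmod_ge_0|apply (Hbd _ Hc)].
Qed.

(** * The Schwarz lemma and its consequences *)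

(** The passage [rho -> R0] of the Schwarz lemma, whose hypotheses hold on the open disk only. *)
Lemma Rle_of_scaled (x y r R0 : R) :
  r < R0 -> 0 <= x -> (forall rho, r < rho < R0 -> x * rho <= y) -> x * R0 <= y.
Proof.
  intros Hr Hx H. apply Rnot_lt_le; intros Hlt.
  assert (Hx' : 0 < x).
  { destruct Hx as [Hx|Hx]; [exact Hx|]. subst x. specialize (H ((r + R0) / 2) ltac:(lra)). lra. }
  set (rho := Rmax ((r + R0) / 2) ((y / x + R0) / 2)).
  assert (Hyx : y / x < R0).
  { apply (Rmult_lt_reg_r x); [exact Hx'|]. unfold Rdiv. rewrite Rmult_assoc, Rinv_l; lra. }
  assert (A : r < rho < R0).
  { split.
    - eapply Rlt_le_trans; [|apply Rmax_l]. lra.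
    - apply Rmax_lub_lt; lra. }
  specialize (H rho A).
  assert (B : (y / x + R0) / 2 <= rho) by apply Rmax_r.
  assert (y / x < rho) by lra.
  apply (Rmult_lt_compat_r x) in H0; [|exact Hx'].
  unfold Rdiv in H0. rewrite Rmult_assoc, Rinv_l in H0; lra.
Qed.

Lemma schwarz_lemma (h : C -> C) (c : C) (R0 m : R) :
  (forall z, Cmod (z - c)%C < R0 -> cderivable h z) ->
  (forall z, Cmod (z - c)%C < R0 -> Cmod (h z) <= m) ->
  h c = 0 ->
  forall z, Cmod (z - c)%C < R0 -> Cmod (h z) * R0 <= m * Cmod (z - c)%C.
Proof.
  intros Hd Hm Hc z Hz.
  assert (Hcc : Cmod (c - c)%C = 0) by (replace (c - c)%C with (RtoC 0) by ring; apply Cmod_0).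
  apply (Rle_of_scaled _ _ (Cmod (z - c)%C)); [exact Hz|apply Cmod_ge_0|].
  intros rho Hrho.
  assert (HR0 : 0 < R0) by (assert (Q := Cmod_ge_0 (z - c)%C); lra).
  destruct (Hd c) as [l Hl]; [rewrite Hcc; lra|].
  assert (Hrho0 : 0 < rho) by (assert (Q := Cmod_ge_0 (z - c)%C); lra).
  (* The quotient is extended continuously by the derivative at [c]. The maximum principle asks for
     no more than continuity there, so no removable-singularity theorem enters. *)
  set (q := fun w => if Ceq_dec w c then l else (h w / (w - c))%C).
  assert (Hq : forall w, w <> c -> q w = (h w / (w - c))%C).
  { intros w Hw. unfold q. destruct (Ceq_dec w c); [contradiction|reflexivity]. }
  assert (Hne : forall w, w <> c -> (w - c)%C <> 0).
  { intros w Hw E. apply Hw. replace w with (w - c + c)%C by ring. rewrite E. ring. }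
  assert (Hqd : forall w, w <> c -> Cmod (w - c)%C < R0 -> cderivable q w).
  { intros w Hw Hwr.
    apply (cderivable_ext_loc (fun w => h w / (w - c))%C q w (Cmod (w - c)%C)).
    - apply Cmod_gt_0, Hne, Hw.
    - intros k Hk. symmetry; apply Hq. intros E.
      assert (k = - (w - c))%C by (rewrite <- E; ring).
      rewrite H, Cmod_opp in Hk. lra.
    - apply cderivable_div; [auto| |auto].
      apply cderivable_minus; [apply cderivable_id|apply cderivable_const]. }
  assert (A : Cmod (q z) <= m / rho).
  { apply (max_modulus q c rho (m / rho) Hrho0); [| | |lra].
    - intros w Hw. destruct (Ceq_dec w c) as [->|Hwc].
      + intros eps He. destruct (Hl (eps / 2)) as [d [Hdp Hd']]; [lra|].
        exists d. split; [exact Hdp|]. intros v _ Hv.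
        assert (Eqc : q c = l) by (unfold q; destruct (Ceq_dec c c); [reflexivity|contradiction]).
        rewrite Eqc. destruct (Ceq_dec v c) as [->|Hvc].
        * rewrite Eqc. replace (l - l)%C with (RtoC 0) by ring. rewrite Cmod_0; lra.
        * rewrite Hq by exact Hvc. specialize (Hd' (v - c)%C Hv).
          replace (c + (v - c))%C with v in Hd' by ring. rewrite Hc in Hd'.
          assert (P := Hne v Hvc). assert (P' := P). apply Cmod_gt_0 in P'.
          replace (h v / (v - c) - l)%C with ((h v - 0 - l * (v - c)) / (v - c))%C by (field; exact P).
          rewrite Cmod_div by exact P.
          apply (Rmult_lt_reg_r (Cmod (v - c)%C)); [exact P'|].
          unfold Rdiv; rewrite Rmult_assoc, Rinv_l by lra. nra.
      + apply cderivable_cont, Hqd; [exact Hwc|lra].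
    - intros w Hw. apply Hqd; [|lra]. intros ->. lra.
    - intros w Hw. assert (Hwc : w <> c) by (intros ->; lra).
      rewrite Hq by exact Hwc. rewrite Cmod_div by (apply Hne, Hwc). rewrite Hw.
      apply Rmult_le_compat_r; [apply Rlt_le, Rinv_0_lt_compat; lra|]. apply Hm; lra. }
  destruct (Ceq_dec z c) as [->|Hzc].
  - rewrite Hc, Cmod_0, Hcc. lra.
  - rewrite Hq in A by exact Hzc. rewrite Cmod_div in A by (apply Hne, Hzc).
    assert (P := Hne z Hzc). apply Cmod_gt_0 in P.
    apply (Rmult_le_compat_r (rho * Cmod (z - c)%C)) in A; [|nra].
    replace (Cmod (h z) / Cmod (z - c)%C * (rho * Cmod (z - c)%C)) with (Cmod (h z) * rho) in A by (field; lra).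
    replace (m / rho * (rho * Cmod (z - c)%C)) with (m * Cmod (z - c)%C) in A by (field; lra). exact A.
Qed.

(** The map [h / (2 m - h)] sends the half plane [Re <= m] into the unit disk and fixes 0; the
    Schwarz lemma applied to it is solved for [|h|]. *)
Lemma borel_caratheodory (h : C -> C) (c : C) (R0 m : R) :
  (forall z, Cmod (z - c)%C < R0 -> cderivable h z) ->
  (forall z, Cmod (z - c)%C < R0 -> Re (h z) <= m) ->
  h c = 0 -> 0 < m ->
  forall z, Cmod (z - c)%C < R0 -> Cmod (h z) * (R0 - Cmod (z - c)%C) <= 2 * m * Cmod (z - c)%C.
Proof.
  intros Hd Hm Hc Hmp.
  assert (Hn : forall z, Cmod (z - c)%C < R0 -> (2 * m - h z)%C <> 0).
  { intros z Hz E. assert (Q : Re (2 * m - h z)%C = 0) by (rewrite E; reflexivity).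
    rewrite Re_minus, Re_mult in Q. unfold Re, Im in Q; simpl in Q. specialize (Hm z Hz).
    unfold Re in Hm. lra. }
  assert (Hle : forall z, Cmod (z - c)%C < R0 -> Cmod (h z) <= Cmod (2 * m - h z)%C).
  { intros z Hz. apply sqrt_le_1_alt. specialize (Hm z Hz).
    change (fst (h z)) with (Re (h z)). change (snd (h z)) with (Im (h z)).
    change (fst (2 * m - h z)%C) with (Re (2 * m - h z)%C).
    change (snd (2 * m - h z)%C) with (Im (2 * m - h z)%C).
    rewrite Re_minus, Im_minus, Re_mult, Im_mult. unfold RtoC, Re, Im in *; simpl. nra. }
  intros z Hz.
  assert (A : Cmod (h z / (2 * m - h z))%C * R0 <= 1 * Cmod (z - c)%C).
  { apply (schwarz_lemma (fun z => h z / (2 * m - h z))%C c R0 1); [| | |exact Hz].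
    - intros w Hw. apply cderivable_div; [auto| |auto].
      apply cderivable_minus; [apply cderivable_const|auto].
    - intros w Hw. rewrite Cmod_div by auto.
      assert (P := Hn w Hw). apply Cmod_gt_0 in P.
      apply (Rmult_le_reg_r (Cmod (2 * m - h w)%C)); [exact P|].
      unfold Rdiv. rewrite Rmult_assoc, Rinv_l by lra. specialize (Hle w Hw). lra.
    - rewrite Hc. unfold Cdiv. ring. }
  rewrite Cmod_div in A by auto.
  assert (P := Hn z Hz). apply Cmod_gt_0 in P.
  apply (Rmult_le_compat_r (Cmod (2 * m - h z)%C)) in A; [|lra].
  replace (Cmod (h z) / Cmod (2 * m - h z) * R0 * Cmod (2 * m - h z)) with (Cmod (h z) * R0) in A by (field; lra).
  assert (B := Cmod_triangle_minus (2 * m)%C (h z)).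
  rewrite Cmod_mult, !Cmod_R, !Rabs_pos_eq in B by lra.
  assert (Q := Cmod_ge_0 (z - c)%C). nra.
Qed.

(** Plays the part of Cauchy's estimate: the Schwarz lemma for [h - h c], which is bounded by
    [2 K]. *)
Lemma bounded_holo_lipschitz (h : C -> C) (c : C) (R0 K : R) :
  (forall z, Cmod (z - c)%C < R0 -> cderivable h z) ->
  (forall z, Cmod (z - c)%C < R0 -> Cmod (h z) <= K) ->
  forall z, Cmod (z - c)%C < R0 -> Cmod (h z - h c)%C * R0 <= 2 * K * Cmod (z - c)%C.
Proof.
  intros Hd HK z Hz.
  assert (Hcc : Cmod (c - c)%C = 0) by (replace (c - c)%C with (RtoC 0) by ring; apply Cmod_0).
  assert (HR0 : 0 < R0) by (assert (Q := Cmod_ge_0 (z - c)%C); lra).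
  apply (schwarz_lemma (fun w => h w - h c)%C c R0 (2 * K)); [| |ring|exact Hz].
  - intros w Hw. apply cderivable_minus; [auto|apply cderivable_const].
  - intros w Hw. eapply Rle_trans; [apply Cmod_triangle_minus|].
    assert (Q1 := HK w Hw). assert (Q2 := HK c ltac:(rewrite Hcc; lra)). lra.
Qed.

(** * Mean value inequalities along segments *)

Lemma is_derive_Re_segment (g : C -> C) (z0 k u l : C) (s : R) :
  is_cderiv g (z0 + s * k)%C l ->
  is_derive (fun s : R => Re (u * g (z0 + s * k)%C)%C) s (Re (u * (l * k))%C).
Proof.
  intros H. apply is_derive_Reals. intros eps He.
  set (K := Cmod u * Cmod k + 1).
  assert (P1 := Cmod_ge_0 u). assert (P2 := Cmod_ge_0 k).
  assert (HK : 0 < K) by (unfold K; nra).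
  destruct (H (eps / (2 * K))) as [d [Hd Hh]]; [apply Rdiv_lt_0_compat; lra|].
  assert (Hd' : 0 < d / (Cmod k + 1)) by (apply Rdiv_lt_0_compat; lra).
  exists (mkposreal _ Hd'). intros x Hx0 Hx. simpl in Hx.
  assert (Hm : Cmod (x * k)%C < d).
  { rewrite Cmod_mult, Cmod_R. apply (Rmult_lt_compat_r (Cmod k + 1)) in Hx; [|lra].
    unfold Rdiv in Hx. rewrite Rmult_assoc, Rinv_l in Hx by lra.
     nra. }
  specialize (Hh _ Hm).
  replace (z0 + s * k + x * k)%C with (z0 + RtoC (s + x) * k)%C in Hh by (rewrite RtoC_plus; ring).
  rewrite Cmod_mult, Cmod_R in Hh.
  assert (Hx' : 0 < Rabs x) by (apply Rabs_pos_lt, Hx0).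
  replace ((Re (u * g (z0 + (s + x)%R * k))%C - Re (u * g (z0 + s * k))%C) / x - Re (u * (l * k))%C)
    with (Re (u * (g (z0 + (s + x)%R * k) - g (z0 + s * k) - l * (x * k)))%C / x).
  2: { rewrite !Re_mult, !Re_minus, !Im_minus, !Re_mult, !Im_mult, ?Re_mult, ?Im_mult.
       change (Re (RtoC x)) with x. change (Im (RtoC x)) with 0. field. exact Hx0. }
  unfold Rdiv. rewrite Rabs_mult, Rabs_inv.
  apply (Rmult_lt_reg_r (Rabs x)); [exact Hx'|]. rewrite Rmult_assoc, Rinv_l, Rmult_1_r by lra.
  eapply Rle_lt_trans; [apply re_le_Cmod|]. rewrite Cmod_mult.
  apply Rle_lt_trans with (Cmod u * (eps / (2 * K) * (Rabs x * Cmod k))).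
  { apply Rmult_le_compat_l; lra. }
  replace (Cmod u * (eps / (2 * K) * (Rabs x * Cmod k))) with (((K - 1) / (2 * K)) * (eps * Rabs x))
    by (unfold K; field; fold K; lra).
  assert ((K - 1) / (2 * K) < 1).
  { apply (Rmult_lt_reg_r (2 * K)); [lra|]. unfold Rdiv. rewrite Rmult_assoc, Rinv_l; lra. }
  assert (0 < eps * Rabs x) by (apply Rmult_lt_0_compat; lra). nra.
Qed.

(** The increment [D] is projected onto its own direction, which reduces the claim to a real
    monotone function. A general majorant [v'] is allowed because the derivative bound used near the
    circle blows up at the end of the radius. *)
Lemma segment_mean_value (g : C -> C) (z0 k : C) (a b : R) (v v' : R -> R) :
  a <= b ->
  (forall s, a <= s <= b -> exists l, is_cderiv g (z0 + s * k)%C l /\ Cmod (l * k)%C <= v' s) ->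
  (forall s, a <= s <= b -> is_derive v s (v' s)) ->
  Cmod (g (z0 + b * k) - g (z0 + a * k))%C <= v b - v a.
Proof.
  intros Hab Hg Hv.
  set (D := (g (z0 + b * k) - g (z0 + a * k))%C).
  set (phi := fun s : R => Cmod D * v s - Re (Cconj D * g (z0 + s * k)%C)%C).
  assert (Hphi : forall s, a <= s <= b -> exists m, is_derive phi s m /\ 0 <= m).
  { intros s Hs. destruct (Hg s Hs) as [l [Hl Hb]].
    exists (Cmod D * v' s - Re (Cconj D * (l * k))%C). split.
    - apply (is_derive_minus (fun s => Cmod D * v s) (fun s => Re (Cconj D * g (z0 + s * k)%C)%C)).
      + apply (is_derive_scal v s (Cmod D) (v' s)). apply Hv, Hs.
      + apply is_derive_Re_segment, Hl.
    - assert (A := re_le_Cmod (Cconj D * (l * k))%C). rewrite Cmod_mult, Cmod_conj in A.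
      assert (B := Rle_abs (Re (Cconj D * (l * k))%C)).
      assert (Cmod D * Cmod (l * k)%C <= Cmod D * v' s) by (apply Rmult_le_compat_l; [apply Cmod_ge_0|exact Hb]).
      lra. }
  destruct (MVT_gen phi a b (Derive phi)) as [x [Hx E]].
  - rewrite Rmin_left, Rmax_right by exact Hab. intros x Hx. apply Derive_correct.
    destruct (Hphi x) as [m [Hm _]]; [lra|]. exists m; exact Hm.
  - rewrite Rmin_left, Rmax_right by exact Hab. intros x Hx.
    destruct (Hphi x Hx) as [m [Hm _]]. apply continuity_pt_filterlim.
    apply (ex_derive_continuous phi x). exists m; exact Hm.
  - rewrite Rmin_left, Rmax_right in Hx by exact Hab.
    destruct (Hphi x Hx) as [m [Hm Hm0]]. rewrite (is_derive_unique _ _ _ Hm) in E.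
    assert (F : 0 <= phi b - phi a) by (rewrite E; apply Rmult_le_pos; lra).
    unfold phi in F.
    assert (G : Re (Cconj D * g (z0 + b * k)%C)%C - Re (Cconj D * g (z0 + a * k)%C)%C = Cmod D ^ 2).
    { rewrite <- Re_minus.
      replace (Cconj D * g (z0 + b * k) - Cconj D * g (z0 + a * k))%C with (Cconj D * D)%C by (unfold D; ring).
      rewrite Cmod2_alt, Re_mult. unfold Cconj, Re, Im; simpl. ring. }
    destruct (Cmod_ge_0 D) as [P|P].
    + apply (Rmult_le_reg_l (Cmod D)); [exact P|].
      replace (Cmod D ^ 2) with (Cmod D * Cmod D) in G by ring. lra.
    (* If [D = 0] there is nothing to project on; it remains that [v] is nondecreasing, which holds
       because [v'] dominates a modulus. *)
    + rewrite <- P in *.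
      destruct (MVT_gen v a b v') as [x' [Hx' E']].
      * rewrite Rmin_left, Rmax_right by exact Hab. intros y Hy. apply Hv; lra.
      * rewrite Rmin_left, Rmax_right by exact Hab. intros y Hy.
        apply continuity_pt_filterlim. apply (ex_derive_continuous v y). exists (v' y). apply Hv; lra.
      * rewrite Rmin_left, Rmax_right in Hx' by exact Hab. rewrite E'.
        destruct (Hg x' Hx') as [l [_ Hb]]. assert (Q := Cmod_ge_0 (l * k)%C).
        apply Rmult_le_pos; lra.
Qed.

Lemma segment_mean_value_const (g : C -> C) (z0 k : C) (L : R) :
  (forall s, 0 <= s <= 1 -> exists l, is_cderiv g (z0 + s * k)%C l /\ Cmod (l * k)%C <= L) ->
  Cmod (g (z0 + k) - g z0)%C <= L.
Proof.
  intros H.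
  assert (A := segment_mean_value g z0 k 0 1 (fun s => L * s) (fun _ => L) ltac:(lra) H).
  replace (z0 + 1 * k)%C with (z0 + k)%C in A by ring.
  replace (z0 + 0 * k)%C with z0 in A by ring.
  replace (L * 1 - L * 0) with L in A by ring. apply A.
  intros s _. auto_derive; [exact I|ring].
Qed.

(** * Taylor estimates for bounded holomorphic functions *)

(** The Lipschitz estimate is used twice: in the increment [c] for [h], then in [k] for the first
    difference [D], which is itself holomorphic and bounded by [2 K |c| / d]. *)
Lemma second_difference_bound (h : C -> C) (z0 : C) (d K : R) (k c : C) :
  (forall z, Cmod (z - z0)%C < 2 * d -> cderivable h z) ->
  (forall z, Cmod (z - z0)%C < 2 * d -> Cmod (h z) <= K) ->
  Cmod k < d -> Cmod c < d ->
  Cmod ((h (z0 + k + c) - h (z0 + k)) - (h (z0 + c) - h z0))%C * (d * d)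
    <= 4 * K * (Cmod c * Cmod k).
Proof.
  intros Hd HK Hk Hc.
  assert (Hdp : 0 < d) by (assert (Q := Cmod_ge_0 k); lra).
  set (D := fun k => (h (z0 + k + c) - h (z0 + k))%C).
  assert (T : forall w v, Cmod w < d -> Cmod v < d -> Cmod (z0 + w + v - z0)%C < 2 * d).
  { intros w v Hw Hv. replace (z0 + w + v - z0)%C with (w + v)%C by ring.
    eapply Rle_lt_trans; [apply Cmod_triangle|lra]. }
  assert (T0 : forall w, Cmod w < d -> Cmod (z0 + w - z0)%C < 2 * d).
  { intros w Hw. replace (z0 + w - z0)%C with w by ring. lra. }
  assert (HD : forall w, Cmod w < d -> Cmod (D w) <= 2 * K * Cmod c / d).
  { intros w Hw. unfold D.
    assert (A := bounded_holo_lipschitz h (z0 + w)%C d K).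
    assert (B : Cmod (h (z0 + w + c) - h (z0 + w))%C * d <= 2 * K * Cmod (z0 + w + c - (z0 + w))%C).
    { apply A.
      - intros z Hz. apply Hd. replace z with (z0 + w + (z - (z0 + w)))%C by ring. apply T; assumption.
      - intros z Hz. apply HK. replace z with (z0 + w + (z - (z0 + w)))%C by ring. apply T; assumption.
      - replace (z0 + w + c - (z0 + w))%C with c by ring. exact Hc. }
    replace (z0 + w + c - (z0 + w))%C with c in B by ring.
    apply (Rmult_le_reg_r d); [exact Hdp|]. unfold Rdiv. rewrite Rmult_assoc, Rinv_l; lra. }
  assert (A := bounded_holo_lipschitz D 0 d (2 * K * Cmod c / d)).
  assert (E : forall w : C, (w - 0)%C = w) by (intros; ring).
  assert (B : Cmod (D k - D 0)%C * d <= 2 * (2 * K * Cmod c / d) * Cmod (k - 0)%C).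
  { apply A.
    - intros w Hw. rewrite E in Hw. unfold D. apply cderivable_minus.
      + apply (cderivable_comp (fun w => z0 + w + c)%C h); [|apply Hd, T; assumption].
        apply cderivable_plus; [|apply cderivable_const].
        apply cderivable_plus; [apply cderivable_const|apply cderivable_id].
      + apply (cderivable_comp (fun w => z0 + w)%C h); [|apply Hd, T0; assumption].
        apply cderivable_plus; [apply cderivable_const|apply cderivable_id].
    - intros w Hw. rewrite E in Hw. apply HD, Hw.
    - rewrite E. exact Hk. }
  rewrite E in B. unfold D in B. rewrite Cplus_0_r in B.
  apply (Rmult_le_compat_r d) in B; [|lra].
  replace (2 * (2 * K * Cmod c / d) * Cmod k * d) with (4 * K * (Cmod c * Cmod k)) in B by (field; lra).
  lra.
Qed.

(** Divide the second difference by a small real increment [x] and let [x] tend to 0. This controls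
    the derivative without knowing that it is holomorphic. *)
Lemma derivative_lipschitz (h : C -> C) (z0 k l lk : C) (d K : R) :
  (forall z, Cmod (z - z0)%C < 2 * d -> cderivable h z) ->
  (forall z, Cmod (z - z0)%C < 2 * d -> Cmod (h z) <= K) ->
  Cmod k < d -> is_cderiv h z0 l -> is_cderiv h (z0 + k)%C lk ->
  Cmod (lk - l)%C * (d * d) <= 4 * K * Cmod k.
Proof.
  intros Hd HK Hk Hl Hlk.
  assert (Hdp : 0 < d) by (assert (Q := Cmod_ge_0 k); lra).
  apply Rle_plus_epsilon. intros eps He.
  set (e := eps / (2 * (d * d))).
  assert (Hee : 0 < e) by (apply Rdiv_lt_0_compat; nra).
  destruct (Hl e Hee) as [d1 [Hd1 H1]]. destruct (Hlk e Hee) as [d2 [Hd2 H2]].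
  set (x := Rmin (d / 2) (Rmin (d1 / 2) (d2 / 2))).
  assert (Hx : 0 < x) by (repeat apply Rmin_pos; lra).
  assert (Hxd : x < d) by (unfold x; eapply Rle_lt_trans; [apply Rmin_l|lra]).
  assert (Hx1 : x < d1).
  { unfold x. eapply Rle_lt_trans; [apply Rmin_r|]. eapply Rle_lt_trans; [apply Rmin_l|lra]. }
  assert (Hx2 : x < d2).
  { unfold x. eapply Rle_lt_trans; [apply Rmin_r|]. eapply Rle_lt_trans; [apply Rmin_r|lra]. }
  assert (Hc : Cmod x = x) by (rewrite Cmod_R; apply Rabs_pos_eq; lra).
  assert (A := second_difference_bound h z0 d K k x Hd HK Hk ltac:(lra)).
  assert (B1 := H1 (RtoC x) ltac:(lra)). assert (B2 := H2 (RtoC x) ltac:(lra)).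
  rewrite Hc in *.
  assert (E : Cmod ((lk - l) * x)%C <= Cmod ((h (z0 + k + x) - h (z0 + k)) - (h (z0 + x) - h z0))%C + 2 * (e * x)).
  { replace ((lk - l) * x)%C with (((h (z0 + k + x) - h (z0 + k)) - (h (z0 + x) - h z0))
      + ((h (z0 + x) - h z0 - l * x) - (h (z0 + k + x) - h (z0 + k) - lk * x)))%C by ring.
    eapply Rle_trans; [apply Cmod_triangle|].
    assert (Q := Cmod_triangle_minus (h (z0 + x) - h z0 - l * x)%C (h (z0 + k + x) - h (z0 + k) - lk * x)%C). lra. }
  rewrite Cmod_mult, Hc in E.
  set (S := Cmod ((h (z0 + k + x) - h (z0 + k)) - (h (z0 + x) - h z0))%C) in *.
  apply (Rmult_le_reg_r x); [exact Hx|].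
  apply Rle_trans with ((S + 2 * (e * x)) * (d * d)).
  - replace (Cmod (lk - l) * (d * d) * x) with (Cmod (lk - l)%C * x * (d * d)) by ring.
    apply Rmult_le_compat_r; [nra|exact E].
  - replace ((S + 2 * (e * x)) * (d * d)) with (S * (d * d) + eps * x) by (unfold e; field; lra).
    lra.
Qed.

(** After subtracting the linear part, the derivative along the segment is at most
    [4 K |k| / d^2]. *)
Lemma taylor_second_order (h : C -> C) (z0 k l : C) (d K : R) :
  (forall z, Cmod (z - z0)%C < 2 * d -> cderivable h z) ->
  (forall z, Cmod (z - z0)%C < 2 * d -> Cmod (h z) <= K) ->
  Cmod k < d -> is_cderiv h z0 l ->
  Cmod (h (z0 + k) - h z0 - l * k)%C <= 4 * K / (d * d) * (Cmod k * Cmod k).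
Proof.
  intros Hd HK Hk Hl.
  assert (Hdp : 0 < d) by (assert (Q := Cmod_ge_0 k); lra).
  assert (HKp : 0 <= K).
  { eapply Rle_trans; [apply Cmod_ge_0|apply (HK z0)].
    replace (z0 - z0)%C with (RtoC 0) by ring. rewrite Cmod_0; lra. }
  assert (A := segment_mean_value_const (fun w => h w + (- l) * w)%C z0 k (4 * K / (d * d) * (Cmod k * Cmod k))).
  replace (h (z0 + k) - h z0 - l * k)%C with (h (z0 + k) + - l * (z0 + k) - (h z0 + - l * z0))%C by ring.
  apply A. intros s Hs.
  assert (Hsk : Cmod (s * k)%C <= Cmod k).
  { rewrite Cmod_mult, Cmod_R, Rabs_pos_eq by lra. assert (Q := Cmod_ge_0 k). nra. }
  destruct (Hd (z0 + s * k)%C) as [lk Hlk].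
  { replace (z0 + s * k - z0)%C with (s * k)%C by ring. lra. }
  exists (lk + ((0 * (z0 + s * k)) + - l * 1))%C. split.
  - apply is_cderiv_plus; [exact Hlk|].
    apply (is_cderiv_mult (fun _ => - l)%C (fun w => w)); [apply is_cderiv_const|apply is_cderiv_id].
  - assert (B := derivative_lipschitz h z0 (s * k)%C l lk d K Hd HK ltac:(lra) Hl Hlk).
    replace (lk + (0 * (z0 + s * k) + - l * 1))%C with (lk - l)%C by ring.
    rewrite Cmod_mult.
    assert (P := Cmod_ge_0 k).
    replace (4 * K / (d * d) * (Cmod k * Cmod k)) with ((4 * K / (d * d) * Cmod k) * Cmod k) by ring.
    apply Rmult_le_compat_r; [exact P|].
    apply (Rmult_le_reg_r (d * d)); [nra|].
    replace (4 * K / (d * d) * Cmod k * (d * d)) with (4 * K * Cmod k) by (field; lra). nra.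
Qed.

(** * The Loewner-Kufarev equation as a transport equation *)

(** The time derivative is taken relative to [[a, b]], one-sided at the end points, so that the
    notion is compatible with time reversal. *)
Definition transport_sol (f p : C -> R -> C) (a b : R) : Prop :=
  forall z t, Cmod z < 1 -> a <= t <= b ->
  exists l, is_cderiv (fun w => f w t) z l /\
    forall eps, eps > 0 -> exists delta, delta > 0 /\
      forall s, a <= s <= b -> Rabs (s - t) < delta ->
        Cmod (f z s - f z t + RtoC (s - t) * (z * l * p z t))%C <= eps * Rabs (s - t).

(** Reversal turns [p] into [- p], so real parts become negative and backward characteristics move
    outward. This is the reason for the shrinking speed [c] in the comparison below. *)
Lemma transport_sol_reverse (f p : C -> R -> C) (a b : R) :
  transport_sol f p a b ->
  transport_sol (fun z s => f z (- s)) (fun z s => Copp (p z (- s))) (- b) (- a).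
Proof.
  intros H z t Hz Ht. destruct (H z (- t) Hz ltac:(lra)) as [l [Hl Hd]].
  exists l. split; [exact Hl|]. intros eps He. destruct (Hd eps He) as [d [Hdp Hd']].
  exists d. split; [exact Hdp|]. intros s Hs Hst.
  assert (E : Rabs (- s - - t) = Rabs (s - t)).
  { replace (- s - - t) with (- (s - t)) by ring. apply Rabs_Ropp. }
  specialize (Hd' (- s) ltac:(lra)). rewrite E in Hd'. specialize (Hd' Hst).
  replace (RtoC (s - t) * (z * l * - p z (- t)%R))%C with (RtoC (- s - - t) * (z * l * p z (- t)%R))%C; [exact Hd'|].
  rewrite !RtoC_minus, !RtoC_opp. ring.
Qed.

Lemma transport_time_continuous (f p : C -> R -> C) (a b : R) (z : C) (t eps : R) :
  transport_sol f p a b -> Cmod z < 1 -> a <= t <= b -> eps > 0 ->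
  exists delta, delta > 0 /\
    forall s, a <= s <= b -> Rabs (s - t) < delta -> Cmod (f z s - f z t)%C < eps.
Proof.
  intros H Hz Ht He. destruct (H z t Hz Ht) as [l [_ Hd]].
  destruct (Hd 1) as [d [Hdp Hd']]; [lra|].
  set (B := Cmod (z * l * p z t)%C).
  assert (HB : 0 <= B) by apply Cmod_ge_0.
  exists (Rmin d (eps / (B + 2))). split; [apply Rmin_pos; [lra|apply Rdiv_lt_0_compat; lra]|].
  intros s Hs Hst.
  assert (A1 := Hd' s Hs (Rlt_min_l Hst)).
  assert (A2 := Rlt_min_r Hst).
  apply (Rmult_lt_compat_r (B + 2)) in A2; [|lra].
  replace (eps / (B + 2) * (B + 2)) with eps in A2 by (field; lra).
  replace (f z s - f z t)%C with ((f z s - f z t + RtoC (s - t) * (z * l * p z t)) - RtoC (s - t) * (z * l * p z t))%C by ring.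
  eapply Rle_lt_trans; [apply Cmod_triangle_minus|].
  rewrite (Cmod_mult (RtoC (s - t))), Cmod_R. fold B.
   nra.
Qed.

Section BoundedTransport.

Variables (f p : C -> R -> C) (a b rho K : R).
Hypothesis Hsol : transport_sol f p a b.
Hypothesis Hrho : rho <= 1.
Hypothesis HK : forall z s, Cmod z < rho -> a <= s <= b -> Cmod (f z s) <= K.

Lemma transport_slice_derivable (z : C) (s : R) :
  Cmod z < 1 -> a <= s <= b -> cderivable (fun w => f w s) z.
Proof. intros Hz Hs. destruct (Hsol z s Hz Hs) as [l [Hl _]]. exists l; exact Hl. Qed.

Let near (z w : C) : Cmod z < rho -> Cmod (w - z)%C < 2 * ((rho - Cmod z) / 2) -> Cmod w < rho.
Proof.
  intros Hz Hw. assert (A := Cmod_minus_ge w z). lra.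
Qed.

(** A difference quotient with fixed step [x] approximates the [z]-derivative uniformly in time, by
    the Taylor bound with the common constant [K], and it involves only two points, at each of which
    [f] is continuous in time. *)
Lemma transport_derivative_continuous (z l : C) (t eps : R) :
  Cmod z < rho -> a <= t <= b -> is_cderiv (fun w => f w t) z l -> eps > 0 ->
  exists delta, delta > 0 /\ forall s ls, a <= s <= b -> Rabs (s - t) < delta ->
    is_cderiv (fun w => f w s) z ls -> Cmod (ls - l)%C <= eps.
Proof.
  intros Hz Ht Hl He.
  set (d := (rho - Cmod z) / 2). assert (Hd : 0 < d) by (unfold d; lra).
  assert (HK0 : 0 <= K) by (eapply Rle_trans; [apply Cmod_ge_0|apply (HK z t Hz Ht)]).
  set (Q := 4 * K / (d * d)).
  assert (HQ : 0 <= Q).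
  { unfold Q. apply Rmult_le_pos; [lra|]. apply Rlt_le, Rinv_0_lt_compat; nra. }
  (* The two Taylor errors [Q x^2] and the two time errors [x^2] sum to [(2 Q + 2) x^2 <= eps x],
     and then [x] is divided out. *)
  set (x := Rmin (d / 2) (eps / (2 * Q + 2))).
  assert (Hx : 0 < x) by (apply Rmin_pos; [lra|apply Rdiv_lt_0_compat; lra]).
  assert (Hxd : x < d) by (unfold x; eapply Rle_lt_trans; [apply Rmin_l|lra]).
  assert (Hxe : x * (2 * Q + 2) <= eps).
  { apply Rle_trans with (eps / (2 * Q + 2) * (2 * Q + 2)).
    - apply Rmult_le_compat_r; [lra|apply Rmin_r].
    - right; field; lra. }
  assert (Hcx : Cmod x = x) by (rewrite Cmod_R; apply Rabs_pos_eq; lra).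
  assert (Hzx : Cmod (z + x)%C < rho).
  { apply (near z _ Hz). replace (z + x - z)%C with (RtoC x) by ring. rewrite Hcx. unfold d in *; lra. }
  assert (Hxx : x * x > 0) by nra.
  destruct (transport_time_continuous f p a b z t (x * x) Hsol ltac:(lra) Ht Hxx) as [d1 [Hd1 H1]].
  destruct (transport_time_continuous f p a b (z + x)%C t (x * x) Hsol ltac:(lra) Ht Hxx) as [d2 [Hd2 H2]].
  assert (T : forall s ls, a <= s <= b -> is_cderiv (fun w => f w s) z ls ->
     Cmod (f (z + x)%C s - f z s - ls * x)%C <= Q * (x * x)).
  { intros s ls Hs Hls.
    assert (A := taylor_second_order (fun w => f w s) z x ls d K).
    rewrite Hcx in A. apply A; [| |lra|exact Hls].
    - intros w Hw. apply transport_slice_derivable; [|exact Hs].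
      assert (Cmod w < rho) by (apply (near z w Hz); exact Hw). lra.
    - intros w Hw. apply HK; [|exact Hs]. apply (near z w Hz); exact Hw. }
  exists (Rmin d1 d2). split; [apply Rmin_pos; lra|]. intros s ls Hs Hst Hls.
  assert (A1 := H1 s Hs (Rlt_min_l Hst)).
  assert (A2 := H2 s Hs (Rlt_min_r Hst)).
  assert (B1 := T s ls Hs Hls). assert (B2 := T t l Ht Hl).
  assert (E : Cmod ((ls - l) * x)%C <= 2 * Q * (x * x) + 2 * (x * x)).
  { replace ((ls - l) * x)%C with
     ((f (z + x)%C t - f z t - l * x) - (f (z + x)%C s - f z s - ls * x)
        + ((f (z + x)%C s - f (z + x)%C t) - (f z s - f z t)))%C by ring.
    eapply Rle_trans; [apply Cmod_triangle|].
    assert (Q1 := Cmod_triangle_minus (f (z + x)%C t - f z t - l * x)%C (f (z + x)%C s - f z s - ls * x)%C).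
    assert (Q2 := Cmod_triangle_minus (f (z + x)%C s - f (z + x)%C t)%C (f z s - f z t)%C). lra. }
  rewrite Cmod_mult, Hcx in E. apply (Rmult_le_reg_r x); [exact Hx|]. nra.
Qed.

(** The chain rule along the characteristic [dz/dt = z p]: the spatial increment cancels the time
    increment up to [o(h)]. The Taylor expansion is made at time [t - h], hence the need for
    continuity of the [z]-derivative in time. *)
Lemma transport_backward (z : C) (t eps : R) :
  Cmod z < rho -> a < t <= b -> eps > 0 ->
  exists delta, delta > 0 /\ forall h, 0 < h < delta ->
    Cmod (f (z - h * (z * p z t))%C (t - h) - f z t)%C <= eps * h.
Proof.
  intros Hz Ht He.
  destruct (Hsol z t ltac:(lra) ltac:(lra)) as [l [Hl Htd]].
  set (d := (rho - Cmod z) / 2). assert (Hd : 0 < d) by (unfold d; lra).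
  assert (HK0 : 0 <= K).
  { eapply Rle_trans; [apply Cmod_ge_0|apply (HK z t Hz)]. lra. }
  set (Q := 4 * K / (d * d)).
  assert (HQ : 0 <= Q).
  { unfold Q. apply Rmult_le_pos; [lra|]. apply Rlt_le, Rinv_0_lt_compat; nra. }
  set (B := Cmod (z * p z t)%C). assert (HB : 0 <= B) by apply Cmod_ge_0.
  destruct (Htd (eps / 3)) as [d1 [Hd1 H1]]; [lra|].
  destruct (transport_derivative_continuous z l t (eps / (3 * (B + 1))) Hz ltac:(lra) Hl) as [d2 [Hd2 H2]].
  { apply Rdiv_lt_0_compat; lra. }
  set (d3 := d / (B + 1)). assert (Hd3 : 0 < d3) by (apply Rdiv_lt_0_compat; lra).
  set (d4 := eps / (3 * (Q * (B * B) + 1))).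
  assert (HQB : 0 <= Q * (B * B)) by (apply Rmult_le_pos; nra).
  assert (Hd4 : 0 < d4) by (apply Rdiv_lt_0_compat; lra).
  exists (Rmin (Rmin d1 d2) (Rmin (t - a) (Rmin d3 d4))).
  split; [repeat apply Rmin_pos; lra|]. intros h [Hh Hh'].
  assert (E1 := Rlt_le_trans _ _ _ Hh' (Rmin_l _ _)).
  assert (E2 := Rlt_le_trans _ _ _ Hh' (Rmin_r _ _)).
  assert (E3 := Rlt_min_l E1).
  assert (E4 := Rlt_min_r E1).
  assert (E5 := Rlt_min_l E2).
  assert (E6 := Rlt_min_r E2).
  assert (E7 := Rlt_min_l E6).
  assert (E8 := Rlt_min_r E6).
  clear Hh' E1 E2 E6.
  assert (Hs : a <= t - h <= b) by lra.
  assert (Hst : Rabs (t - h - t) = h) by (replace (t - h - t) with (- h) by ring; rewrite Rabs_Ropp; apply Rabs_pos_eq; lra).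
  destruct (Hsol z (t - h) ltac:(lra) Hs) as [ls [Hls _]].
  assert (A1 := H1 (t - h) Hs ltac:(lra)). rewrite Hst in A1.
  assert (A2 := H2 (t - h) ls Hs ltac:(lra) Hls).
  set (k := (- (h * (z * p z t)))%C).
  assert (Hk : Cmod k = h * B).
  { unfold k, B. rewrite Cmod_opp, Cmod_mult, Cmod_R, Rabs_pos_eq; lra. }
  assert (Hkd : h * B < d).
  { unfold d3 in E7. apply (Rmult_lt_compat_r (B + 1)) in E7; [|lra].
    unfold Rdiv in E7. rewrite Rmult_assoc, Rinv_l in E7; nra. }
  assert (A3 : Cmod (f (z + k)%C (t - h) - f z (t - h) - ls * k)%C <= Q * (h * B * (h * B))).
  { assert (A := taylor_second_order (fun w => f w (t - h)) z k ls d K).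
    rewrite Hk in A. apply A; [| |exact Hkd|exact Hls].
    - intros w Hw. apply transport_slice_derivable; [|exact Hs].
      assert (Cmod w < rho) by (apply (near z w Hz); exact Hw). lra.
    - intros w Hw. apply HK; [|exact Hs]. apply (near z w Hz); exact Hw. }
  replace (z - h * (z * p z t))%C with (z + k)%C by (unfold k; ring).
  replace (f (z + k)%C (t - h) - f z t)%C with
    ((f (z + k)%C (t - h) - f z (t - h) - ls * k) + ((ls - l) * k
       + (f z (t - h) - f z t + RtoC (t - h - t) * (z * l * p z t))))%C.
  2: { unfold k. rewrite !RtoC_minus. ring. }
  eapply Rle_trans; [apply Cmod_triangle|].
  eapply Rle_trans; [apply Rplus_le_compat_l, Cmod_triangle|].
  rewrite (Cmod_mult (ls - l)), Hk.
  assert (F1 : Q * (h * B * (h * B)) <= eps / 3 * h).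
  { unfold d4 in E8. apply (Rmult_lt_compat_r (3 * (Q * (B * B) + 1))) in E8; [|lra].
    unfold Rdiv in E8. rewrite Rmult_assoc, Rinv_l in E8 by lra. nra. }
  assert (F2 : Cmod (ls - l)%C * (h * B) <= eps / 3 * h).
  { apply (Rmult_le_compat_r (3 * (B + 1))) in A2; [|lra].
    unfold Rdiv in A2. rewrite (Rmult_assoc eps), Rinv_l in A2 by lra.
    assert (P := Cmod_ge_0 (ls - l)%C). nra. }
  lra.
Qed.

Lemma transport_jointly_continuous (z : C) (t eps : R) :
  Cmod z < rho -> a <= t <= b -> eps > 0 ->
  exists delta, delta > 0 /\ forall w s, Cmod (w - z)%C < delta -> a <= s <= b -> Rabs (s - t) < delta ->
    Cmod (f w s - f z t)%C < eps.
Proof.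
  intros Hz Ht He.
  destruct (transport_time_continuous f p a b z t (eps / 2) Hsol ltac:(lra) Ht ltac:(lra)) as [d1 [Hd1 H1]].
  set (d := (rho - Cmod z)). assert (Hd : 0 < d) by (unfold d; lra).
  assert (HK0 : 0 <= K) by (eapply Rle_trans; [apply Cmod_ge_0|apply (HK z t Hz Ht)]).
  set (d2 := eps * d / (4 * (K + 1))).
  assert (Hd2 : 0 < d2) by (apply Rdiv_lt_0_compat; nra).
  exists (Rmin d1 (Rmin d d2)). split; [repeat apply Rmin_pos; lra|]. intros w s Hw Hs Hst.
  assert (A1 := H1 s Hs (Rlt_min_l Hst)).
  assert (W := Rlt_min_r Hw).
  assert (W1 := Rlt_min_l W).
  assert (W2 := Rlt_min_r W).
  assert (NW : forall v, Cmod (v - z)%C < d -> Cmod v < rho).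
  { intros v Hv. assert (A := Cmod_minus_ge v z). unfold d in *. lra. }
  assert (A2 := bounded_holo_lipschitz (fun w => f w s) z d K).
  assert (A3 : Cmod (f w s - f z s)%C * d <= 2 * K * Cmod (w - z)%C).
  { apply A2; [| |exact W1].
    - intros v Hv. apply transport_slice_derivable; [|exact Hs]. specialize (NW v Hv). lra.
    - intros v Hv. apply HK; auto. }
  assert (A4 : Cmod (f w s - f z s)%C <= eps / 2).
  { apply (Rmult_le_reg_r d); [exact Hd|].
    apply Rle_trans with (1 := A3).
    apply (Rmult_lt_compat_r (4 * (K + 1))) in W2; [|lra].
    unfold d2, Rdiv in W2. rewrite (Rmult_assoc (eps * d)), Rinv_l in W2 by lra.
     nra. }
  eapply Rle_lt_trans; [apply (Cmod_triangle_via (f z s))|]. lra.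
Qed.

End BoundedTransport.

(** The modulus is multiplied by at most [1 - h Re q + h^2 |q|^2]; the strict gap [|z| Re q + c > 0]
    absorbs the quadratic term. The origin is stationary and needs no gap. *)
Lemma backward_step_in_disk (z q : C) (r c : R) :
  0 <= r -> Cmod z <= r -> (z <> 0 -> 0 < Cmod z * Re q + c) -> 0 <= c ->
  exists delta, delta > 0 /\ forall h, 0 < h < delta -> Cmod (z - h * (z * q))%C <= r + c * h.
Proof.
  intros Hr Hz Hq Hc. destruct (Ceq_dec z 0) as [->|Hz0].
  { exists 1. split; [lra|]. intros h Hh. replace (0 - h * (0 * q))%C with (RtoC 0) by ring.
    rewrite Cmod_0. nra. }
  specialize (Hq Hz0). set (g := Cmod z * Re q + c) in *.
  assert (P := Cmod_ge_0 q). assert (P0 := Cmod_ge_0 z).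
  set (m := Cmod q) in *.
  set (Z := Cmod z) in *.
  (* The first entry keeps [h |q|] below one half, the second makes the quadratic term smaller than
     the gap [g]. *)
  exists (Rmin (/ 2 / (m + 1)) (g / (Z * (m * m) + 1))).
  assert (Hzm : 0 <= Z * (m * m)) by (apply Rmult_le_pos; nra).
  split; [apply Rmin_pos; apply Rdiv_lt_0_compat; lra|].
  intros h [Hh Hh'].
  assert (E1 := Rlt_le_trans _ _ _ Hh' (Rmin_l _ _)).
  assert (E2 := Rlt_le_trans _ _ _ Hh' (Rmin_r _ _)).
  apply (Rmult_lt_compat_r (m + 1)) in E1; [|lra].
  unfold Rdiv in E1. rewrite Rmult_assoc, Rinv_l in E1 by lra.
  apply (Rmult_lt_compat_r (Z * (m * m) + 1)) in E2; [|lra].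
  unfold Rdiv in E2. rewrite Rmult_assoc, Rinv_l in E2 by lra.
  assert (Rq : Rabs (Re q) <= m) by apply re_le_Cmod. apply Rabs_le_between in Rq.
  assert (M : Cmod (1 - h * q)%C <= 1 - h * Re q + h * h * (m * m)).
  { assert (Hh2 : / 2 <= 1 - h * Re q) by nra.
    assert (0 <= h * h * (m * m)) by nra.
    (* With [A = 1 - h Re q >= / 2] one has [(A + B)^2 >= A^2 + B], which exceeds the squared
       modulus. *)
    apply Rsqr_incr_0_var; [|lra]. unfold Rsqr.
    replace (Cmod (1 - h * q)%C * Cmod (1 - h * q)%C) with (Cmod (1 - h * q)%C ^ 2) by ring.
    rewrite Cmod2_alt.
    assert (Hm2 : m * m = Re q ^ 2 + Im q ^ 2) by (rewrite <- Cmod2_alt; unfold m; ring).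
    rewrite Re_minus, Im_minus, Re_mult, Im_mult.
    change (Re (RtoC h)) with h. change (Im (RtoC h)) with 0.
    change (Re (RtoC 1)) with 1. change (Im (RtoC 1)) with 0.
    set (B := h * h * (m * m)) in *. set (A := 1 - h * Re q) in *.
    replace ((1 - (h * Re q - 0 * Im q)) ^ 2 + (0 - (h * Im q + 0 * Re q)) ^ 2) with
      (A * A + B - h * h * (Re q * Re q)) by (unfold A, B; rewrite Hm2; ring).
     nra. }
  replace (z - h * (z * q))%C with (z * (1 - h * q))%C by ring.
  rewrite Cmod_mult. fold Z.
  apply Rle_trans with (Z * (1 - h * Re q + h * h * (m * m))).
  { apply Rmult_le_compat_l; assumption. }
  unfold g in *. nra.
Qed.

(* At a maximum of [V - eps * (s - a)] over the tube, one step backwards along the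
   characteristics would increase the value unless [s = a]. *)
Lemma transport_comparison (p : C -> R -> C) (a b r c m : R) (V : C -> C -> R -> R) :
  r < 1 -> 0 <= c ->
  (forall z t, Cmod z < 1 -> a <= t <= b -> z <> 0 -> 0 < Cmod z * Re (p z t) + c) ->
  (forall z w t, a <= t <= b -> Cmod z <= r - c * (t - a) -> Cmod w <= r - c * (t - a) ->
     forall eps, eps > 0 -> exists delta, delta > 0 /\
       forall z' w' t', a <= t' <= b -> Cmod z' <= r - c * (t' - a) -> Cmod w' <= r - c * (t' - a) ->
         Cmod (z' - z)%C < delta -> Cmod (w' - w)%C < delta -> Rabs (t' - t) < delta ->
         Rabs (V z' w' t' - V z w t) < eps) ->
  (forall z w t, a < t <= b -> Cmod z <= r - c * (t - a) -> Cmod w <= r - c * (t - a) ->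
     forall eps, eps > 0 -> exists delta, delta > 0 /\ forall h, 0 < h < delta ->
       V z w t - eps * h <= V (z - h * (z * p z t))%C (w - h * (w * p w t))%C (t - h)) ->
  (forall z w, Cmod z <= r -> Cmod w <= r -> V z w a <= m) ->
  forall z w t, a <= t <= b -> Cmod z <= r - c * (t - a) -> Cmod w <= r - c * (t - a) -> V z w t <= m.
Proof.
  intros Hr Hc Hp Hcont Hback Hinit z w t Ht Hz Hw.
  set (D := fun x : C * C * R => a <= snd x <= b /\
    Cmod (fst (fst x)) <= r - c * (snd x - a) /\ Cmod (snd (fst x)) <= r - c * (snd x - a)).
  apply Rle_plus_epsilon. intros eps0 Heps0.
  (* The total penalty over the time interval stays below [eps0]; the added 1 covers [a = b]. *)
  set (eps := eps0 / (b - a + 1)).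
  assert (Heps : 0 < eps) by (apply Rdiv_lt_0_compat; lra).
  assert (Heps' : eps * (t - a) <= eps0).
  { unfold eps. apply (Rmult_le_reg_r (b - a + 1)); [lra|].
    replace (eps0 / (b - a + 1) * (t - a) * (b - a + 1)) with (eps0 * (t - a)) by (field; lra).
    apply Rmult_le_compat_l; lra. }
  set (W := fun x : C * C * R => V (fst (fst x)) (snd (fst x)) (snd x) - eps * (snd x - a)).
  destruct (sup_sequence D W) as [u [Hu Hs]].
  { exists (z, w, t). unfold D; simpl. auto. }
  destruct (joint_cluster_point (fun n => fst (fst (u n))) (fun n => snd (fst (u n))) (fun n => snd (u n)) r a b)
    as [z0 [w0 [s0 [Hs0 Hcl]]]].
  { intros n. destruct (Hu n) as [A [B _]]. nra. }
  { intros n. destruct (Hu n) as [A [_ B]]. nra. }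
  { intros n. destruct (Hu n) as [A _]. exact A. }
  assert (Hlim : forall q0 : C, (forall e (N : nat), e > 0 -> exists q s, a <= s <= b /\ Cmod q <= r - c * (s - a) /\
      Cmod (q - q0)%C < e /\ Rabs (s - s0) < e) -> Cmod q0 <= r - c * (s0 - a)).
  { intros q0 Hq0. apply Rnot_lt_le; intros Hlt.
    set (e := (Cmod q0 - (r - c * (s0 - a))) / (c + 2)).
    assert (He : 0 < e) by (apply Rdiv_lt_0_compat; lra).
    destruct (Hq0 e 0%nat He) as [q [s [_ [A [B B']]]]].
    rewrite Cmod_minus_sym in B. assert (T := Cmod_minus_ge q0 q). apply Rabs_def2 in B'.
    assert (E : e * (c + 2) = Cmod q0 - (r - c * (s0 - a))) by (unfold e; field; lra). nra. }
  assert (Hz0 : Cmod z0 <= r - c * (s0 - a)).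
  { apply Hlim. intros e N He. destruct (Hcl e N He) as [n [_ [A1 [_ A3]]]].
    destruct (Hu n) as [B1 [B2 B3]]. exists (fst (fst (u n))), (snd (u n)). auto. }
  assert (Hw0 : Cmod w0 <= r - c * (s0 - a)).
  { apply Hlim. intros e N He. destruct (Hcl e N He) as [n [_ [_ [A2 A3]]]].
    destruct (Hu n) as [B1 [B2 B3]]. exists (snd (fst (u n))), (snd (u n)). auto. }
  assert (Hmax : forall x, D x -> W x <= W (z0, w0, s0)).
  { intros x Dx. apply Rnot_lt_le; intros Hlt.
    set (e := (W x - W (z0, w0, s0)) / 4). assert (He : 0 < e) by (unfold e; lra).
    destruct (Hcont z0 w0 s0 Hs0 Hz0 Hw0 e He) as [d [Hd Hd']].
    destruct (Hs x Dx e He) as [N HN].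
    assert (He2 : 0 < e / eps) by (apply Rdiv_lt_0_compat; lra).
    destruct (Hcl (Rmin d (e / eps)) N) as [n [Hn [A1 [A2 A3]]]]; [apply Rmin_pos; lra|].
    specialize (HN n Hn). destruct (Hu n) as [B1 [B2 B3]].
    assert (Q := Hd' _ _ _ B1 B2 B3 (Rlt_min_l A1)
      (Rlt_min_l A2) (Rlt_min_l A3)).
    assert (A4 := Rlt_min_r A3).
    apply Rabs_def2 in Q. apply Rabs_def2 in A4.
    assert (E : eps * (e / eps) = e) by (field; lra).
    unfold W in *; simpl in *. unfold e in *. nra. }
  assert (Hs0a : s0 = a).
  { apply NNPP; intros Hne.
    (* A step back of length [h] loses at most [eps / 2 * h] of [V] but regains [eps * h] of the
       penalty, contradicting maximality. *)
    destruct (Hback z0 w0 s0 ltac:(lra) Hz0 Hw0 (eps / 2) ltac:(lra)) as [d1 [Hd1 H1]].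
    assert (Hz1 : Cmod z0 < 1) by nra. assert (Hw1 : Cmod w0 < 1) by nra.
    destruct (backward_step_in_disk z0 (p z0 s0) (r - c * (s0 - a)) c) as [d2 [Hd2 H2]]; auto.
    { assert (Q := Cmod_ge_0 z0). lra. }
    destruct (backward_step_in_disk w0 (p w0 s0) (r - c * (s0 - a)) c) as [d3 [Hd3 H3]]; auto.
    { assert (Q := Cmod_ge_0 w0). lra. }
    set (h := Rmin (Rmin d1 d2) (Rmin d3 (s0 - a)) / 2).
    assert (Hm : 0 < Rmin (Rmin d1 d2) (Rmin d3 (s0 - a))) by (repeat apply Rmin_pos; lra).
    assert (Hh : 0 < h) by (unfold h; lra).
    assert (L1 : h < d1).
    { apply Rlt_le_trans with (Rmin (Rmin d1 d2) (Rmin d3 (s0 - a))); [unfold h; lra|].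
      eapply Rle_trans; [apply Rmin_l|apply Rmin_l]. }
    assert (L2 : h < d2).
    { apply Rlt_le_trans with (Rmin (Rmin d1 d2) (Rmin d3 (s0 - a))); [unfold h; lra|].
      eapply Rle_trans; [apply Rmin_l|apply Rmin_r]. }
    assert (L3 : h < d3).
    { apply Rlt_le_trans with (Rmin (Rmin d1 d2) (Rmin d3 (s0 - a))); [unfold h; lra|].
      eapply Rle_trans; [apply Rmin_r|apply Rmin_l]. }
    assert (L4 : h < s0 - a).
    { apply Rlt_le_trans with (Rmin (Rmin d1 d2) (Rmin d3 (s0 - a))); [unfold h; lra|].
      eapply Rle_trans; [apply Rmin_r|apply Rmin_r]. }
    specialize (H1 h (conj Hh L1)). specialize (H2 h (conj Hh L2)). specialize (H3 h (conj Hh L3)).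
    assert (Q := Hmax ((z0 - h * (z0 * p z0 s0))%C, (w0 - h * (w0 * p w0 s0))%C, s0 - h)).
    unfold D, W in Q; simpl in Q.
    assert (Q' : V (z0 - h * (z0 * p z0 s0))%C (w0 - h * (w0 * p w0 s0))%C (s0 - h) - eps * (s0 - h - a)
       <= V z0 w0 s0 - eps * (s0 - a)).
    { apply Q. split; [lra|]. split; nra. }
    assert (0 < eps * h) by (apply Rmult_lt_0_compat; lra). lra. }
  assert (A := Hmax (z, w, t)). unfold D, W in A; simpl in A.
   rewrite Hs0a in *.
  replace (r - c * (a - a)) with r in * by ring.
  assert (B := Hinit z0 w0 Hz0 Hw0). nra.
Qed.

Lemma transport_sup_bound (f p : C -> R -> C) (a b r rho c m K : R) :
  transport_sol f p a b -> r < rho -> rho <= 1 -> 0 <= c ->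
  (forall z s, Cmod z < rho -> a <= s <= b -> Cmod (f z s) <= K) ->
  (forall z t, Cmod z < 1 -> a <= t <= b -> z <> 0 -> 0 < Cmod z * Re (p z t) + c) ->
  (forall z, Cmod z <= r -> Cmod (f z a) <= m) ->
  forall z t, a <= t <= b -> Cmod z <= r - c * (t - a) -> Cmod (f z t) <= m.
Proof.
  intros Hsol Hr Hrho Hc HK Hp Hm z t Ht Hz.
  assert (Cin : forall q s, a <= s <= b -> Cmod q <= r - c * (s - a) -> Cmod q < rho).
  { intros q s Hs Hq. nra. }
  (* For a bound at a single moving point the second point is kept at the stationary point 0. *)
  apply (transport_comparison p a b r c m (fun z _ s => Cmod (f z s))) with (w := RtoC 0); auto.
  - lra.
  - intros z0 w0 t0 Ht0 Hz0 _ eps He.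
    destruct (transport_jointly_continuous f p a b rho K Hsol Hrho HK z0 t0 eps (Cin _ _ Ht0 Hz0) Ht0 He)
      as [d [Hd H]].
    exists d. split; [exact Hd|]. intros z' w' t' Ht' _ _ Dz _ Dt.
    assert (A := H z' t' Dz Ht' Dt).
    assert (B1 := Cmod_minus_ge (f z' t') (f z0 t0)). assert (B2 := Cmod_minus_ge (f z0 t0) (f z' t')).
    rewrite (Cmod_minus_sym (f z0 t0)) in B2. apply Rabs_def1; lra.
  - intros z0 w0 t0 Ht0 Hz0 _ eps He.
    destruct (transport_backward f p a b rho K Hsol Hrho HK z0 t0 eps (Cin z0 t0 ltac:(lra) Hz0) Ht0 He)
      as [d [Hd H]].
    exists d. split; [exact Hd|]. intros h Hh. specialize (H h Hh).
    assert (B := Cmod_minus_ge (f z0 t0) (f (z0 - h * (z0 * p z0 t0))%C (t0 - h))).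
    rewrite Cmod_minus_sym in B. lra.
  - rewrite Cmod_0. assert (Q := Cmod_ge_0 z). lra.
Qed.

(** * Local boundedness in time *)

(* The solution is only separately regular in [z] and [t]. A Baire category argument on
   the set of times near which it is unbounded gives local boundedness: on a portion of
   that set the solution is bounded, and the a priori estimates, forwards and backwards
   in time, extend the bound to the complementary intervals. *)
Section LocalBoundedness.

Variables (f p : C -> R -> C) (T M : R).
Hypothesis Hsol : forall a b, 0 <= a -> b < T -> transport_sol f p a b.
Hypothesis Hslice : forall t, 0 <= t < T -> exists K, forall z, Cmod z < 1 -> Cmod (f z t) <= K.
Hypothesis Hre : forall z t, Cmod z < 1 -> 0 <= t < T -> 0 < Re (p z t).
Hypothesis HM : forall z t, Cmod z < 1 -> 0 <= t < T -> Cmod (p z t) <= M.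

Definition bounded_on (rho a b : R) : Prop :=
  exists K, forall z s, Cmod z < rho -> a <= s <= b -> Cmod (f z s) <= K.

(** One time neighbourhood serves all radii below 1, while the bound may blow up as [rho] tends to
    1. *)
Definition tame (t : R) : Prop :=
  exists eta, 0 < eta /\ forall rho, rho < 1 -> exists K,
    forall z s, 0 <= s < T -> Rabs (s - t) < eta -> Cmod z < rho -> Cmod (f z s) <= K.

(** Backward characteristics stay in the disk since [Re p > 0], so a bound travels forward in time
    with no loss of radius. The qualitative bound on the larger disk justifies the comparison but
    does not enter the constant. *)
Lemma forward_bound (r rho a b m : R) :
  0 <= a -> b < T -> r < rho -> rho <= 1 -> bounded_on rho a b ->
  (forall z, Cmod z <= r -> Cmod (f z a) <= m) ->
  forall z t, a <= t <= b -> Cmod z <= r -> Cmod (f z t) <= m.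
Proof.
  intros Ha Hb Hr Hrho [K HK] Hm z t Ht Hz.
  apply (transport_sup_bound f p a b r rho 0 m K); auto; try lra.
  intros w s Hw Hs Hw0. apply Cmod_gt_0 in Hw0. rewrite Rplus_0_r.
  apply Rmult_lt_0_compat; [exact Hw0|]. apply Hre; [exact Hw|lra].
Qed.

(** The estimate for the reversed equation. Characteristics then move outward with speed at most
    [M], so the radius shrinks at the strictly larger rate [M + 1]. *)
Lemma backward_bound (r rho a b m : R) :
  0 <= a -> b < T -> r < rho -> rho <= 1 -> bounded_on rho a b ->
  (forall z, Cmod z <= r -> Cmod (f z b) <= m) ->
  forall z t, a <= t <= b -> Cmod z <= r - (M + 1) * (b - t) -> Cmod (f z t) <= m.
Proof.
  intros Ha Hb Hr Hrho [K HK] Hm z t Ht Hz.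
  assert (HM0 : 0 <= M).
  { eapply Rle_trans; [apply Cmod_ge_0|apply (HM 0 a)]; [rewrite Cmod_0; lra|lra]. }
  assert (A := transport_sup_bound (fun z s => f z (- s)) (fun z s => Copp (p z (- s))) (- b) (- a)
    r rho (M + 1) m K (transport_sol_reverse f p a b (Hsol a b Ha Hb)) Hr Hrho ltac:(lra)).
  rewrite <- (Ropp_involutive t). apply A; try lra.
  - intros w s Hw Hs. apply HK; [exact Hw|lra].
  - intros w s Hw Hs _. assert (Q := HM w (- s) Hw ltac:(lra)).
    assert (Q2 := re_le_Cmod (p w (- s))). apply Rabs_le_between in Q2.
    change (Re (- p w (- s))%C) with (- Re (p w (- s))).
    assert (Q3 := Cmod_ge_0 w). nra.
  - intros w Hw. rewrite Ropp_involutive. auto.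
Qed.

Lemma tame_interval_bounded (a b rho : R) :
  0 <= a -> b < T -> rho < 1 -> (forall t, a <= t <= b -> tame t) -> bounded_on rho a b.
Proof.
  intros Ha Hb Hrho Ht. apply NNPP; intros Hn.
  assert (Hc : forall n : nat, exists zs : C * R,
    Cmod (fst zs) < rho /\ a <= snd zs <= b /\ INR n < Cmod (f (fst zs) (snd zs))).
  { intros n. apply NNPP; intros Hn'. apply Hn. exists (INR n). intros z s Hz Hs.
    apply Rnot_lt_le; intros Hlt. apply Hn'. exists (z, s). auto. }
  destruct (choice _ Hc) as [u Hu].
  destruct (R_convergent_subseq (fun n => snd (u n)) a b) as [phi [l [Hphi [Hl Hlim]]]].
  { intros n. apply Hu. }
  destruct (Ht l Hl) as [eta [Heta Htame]]. destruct (Htame rho Hrho) as [K HK].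
  destruct (Hlim eta Heta) as [N HN].
  destruct (nfloor_ex (Rabs K)) as [N2 [_ HN2]]; [apply Rabs_pos|].
  set (n := Nat.max N (S N2)).
  assert (A1 := HN n ltac:(unfold n; lia)).
  destruct (Hu (phi n)) as [B1 [B2 B3]].
  assert (A2 := HK (fst (u (phi n))) (snd (u (phi n))) ltac:(lra) A1 B1).
  assert (A3 : INR (S N2) <= INR (phi n)) by (apply le_INR; specialize (Hphi n); unfold n in *; lia).
  rewrite S_INR in A3. assert (Q := Rle_abs K). lra.
Qed.

Lemma tame_open (t : R) : tame t -> exists eta, 0 < eta /\ forall s, Rabs (s - t) < eta -> tame s.
Proof.
  intros [eta [Heta H]]. exists (eta / 2). split; [lra|]. intros s Hs.
  exists (eta / 2). split; [lra|]. intros rho Hrho. destruct (H rho Hrho) as [K HK].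
  exists K. intros z s' Hs' Hss Hz. apply HK; auto.
  replace (s' - t) with ((s' - s) + (s - t)) by ring.
  eapply Rle_lt_trans; [apply Rabs_triang|lra].
Qed.

(** The time [c] need not be tame. Bounds near [c] come from a slightly later slice, carried
    backward at the cost of some radius; once boundedness is known, the forward estimate from [c]
    restores the constant [n]. *)
Lemma bounded_right_of (c e n : R) :
  0 <= c -> c < e -> e < T -> (forall s, c < s <= e -> tame s) ->
  (forall z, Cmod z < 1 -> Cmod (f z c) <= n) ->
  forall z, Cmod z < 1 -> Cmod (f z e) <= n.
Proof.
  intros Hc Hce He Htame Hn z Hz.
  assert (HM0 : 0 <= M).
  { eapply Rle_trans; [apply Cmod_ge_0|apply (HM 0 c)]; [rewrite Cmod_0; lra|lra]. }
  set (r := Cmod z) in *.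
  set (rho := (1 + r) / 2). set (r1 := (1 + rho) / 2). set (rho1 := (1 + r1) / 2).
  assert (Hrho : r < rho < 1) by (unfold rho; lra).
  assert (Hr1 : rho < r1 < 1) by (unfold r1; lra).
  assert (Hrho1 : r1 < rho1 < 1) by (unfold rho1; lra).
  (* So close to [c] that the radius lost on the way back, [(M + 1) (e1 - c)], fits between [rho]
     and [r1]. *)
  set (e1 := Rmin e (c + (r1 - rho) / (M + 1))).
  assert (Hq : 0 < (r1 - rho) / (M + 1)) by (apply Rdiv_lt_0_compat; lra).
  assert (He1 : c < e1 <= e).
  { split; [apply Rmin_glb_lt; lra|apply Rmin_l]. }
  assert (He1' : (M + 1) * (e1 - c) <= r1 - rho).
  { apply Rle_trans with ((M + 1) * ((r1 - rho) / (M + 1))).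
    - apply Rmult_le_compat_l; [lra|]. assert (Q := Rmin_r e (c + (r1 - rho) / (M + 1))). fold e1 in Q. lra.
    - right; field; lra. }
  destruct (Hslice e1 ltac:(lra)) as [K HK].
  assert (B : bounded_on rho c e1).
  { exists (Rmax K n). intros w s Hw Hs. destruct (Req_dec s c) as [->|Hsc].
    - eapply Rle_trans; [apply Hn; lra|apply Rmax_r].
    - eapply Rle_trans; [|apply Rmax_l].
      apply (backward_bound r1 rho1 s e1 K); try lra.
      + apply tame_interval_bounded; try lra. intros u Hu. apply Htame; lra.
      + intros v Hv. apply HK; lra.
      + assert ((M + 1) * (e1 - s) <= r1 - rho); [|lra].
        apply Rle_trans with (2 := He1'). apply Rmult_le_compat_l; lra. }
  assert (B2 : forall w, Cmod w <= r -> Cmod (f w e1) <= n).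
  { intros w Hw. apply (forward_bound r rho c e1 n); try lra; auto. intros v Hv. apply Hn; lra. }
  apply (forward_bound r rho e1 e n); try lra; auto; [|unfold r; lra].
  apply tame_interval_bounded; try lra. intros u Hu. apply Htame; lra.
Qed.

(** The Baire argument. Otherwise one finds nested intervals around untame times on the [n]-th of
    which [|f(z, .)| > n] for some fixed [z], by continuity in time; at a common time the slice
    would be unbounded. *)
Lemma untame_portion_bounded (x0 : R) :
  0 <= x0 < T -> ~ tame x0 ->
  exists (n : nat) (x eta : R), 0 <= x /\ x + eta < T /\ 0 < eta /\ ~ tame x /\
    forall y, 0 <= y < T -> Rabs (y - x) < eta -> ~ tame y -> forall z, Cmod z < 1 -> Cmod (f z y) <= INR n.
Proof.
  intros Hx0 Hx0t. apply NNPP; intros Hneg.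
  set (st := fun q : R * R => 0 <= fst q /\ fst q + snd q < T /\ 0 < snd q /\ ~ tame (fst q)).
  assert (step : forall nq : nat * (R * R), exists q' : R * R, st (snd nq) ->
    st q' /\ Rabs (fst q' - fst (snd nq)) + snd q' <= snd (snd nq) /\
    exists z, Cmod z < 1 /\ forall s, 0 <= s < T -> Rabs (s - fst q') <= snd q' -> INR (fst nq) < Cmod (f z s)).
  { intros [n [x eta]]. destruct (classic (st (x, eta))) as [[S1 [S2 [S3 S4]]]|Hs].
    2: { exists (0, 0). intros; contradiction. }
    simpl in S1, S2, S3, S4.
    assert (Hy : exists y z, 0 <= y < T /\ Rabs (y - x) < eta /\ ~ tame y /\ Cmod z < 1 /\ INR n < Cmod (f z y)).
    { apply NNPP; intros Hn. apply Hneg. exists n, x, eta. repeat (split; [assumption|]).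
      intros y Hy Hyx Hyt z Hz. apply Rnot_lt_le; intros Hlt. apply Hn. exists y, z. auto. }
    destruct Hy as [y [z [Hy [Hyx [Hyt [Hz Hlt]]]]]].
    set (b := (y + T) / 2).
    destruct (transport_time_continuous f p 0 b z y (Cmod (f z y) - INR n)) as [d [Hd Hcont]].
    { apply Hsol; unfold b; lra. } { exact Hz. } { unfold b; lra. } { lra. }
    set (eta' := Rmin (Rmin (d / 2) ((b - y) / 2)) (eta - Rabs (y - x))).
    assert (He1 : eta' <= d / 2) by (unfold eta'; eapply Rle_trans; [apply Rmin_l|apply Rmin_l]).
    assert (He2 : eta' <= (b - y) / 2) by (unfold eta'; eapply Rle_trans; [apply Rmin_l|apply Rmin_r]).
    assert (He3 : eta' <= eta - Rabs (y - x)) by apply Rmin_r.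
    assert (Hyb : y < b < T) by (unfold b; lra).
    assert (He0 : 0 < eta') by (repeat apply Rmin_pos; lra).
    exists (y, eta'). intros _. simpl. split; [|split].
    - unfold st; simpl. repeat split; try lra. exact Hyt.
    - lra.
    - exists z. split; [exact Hz|]. intros s Hs Hsy.
      assert (s <= b) by (apply Rabs_le_between in Hsy; lra).
      assert (A := Hcont s ltac:(lra) ltac:(lra)). rewrite Cmod_minus_sym in A.
      assert (Q := Cmod_minus_ge (f z y) (f z s)). lra. }
  destruct (choice _ step) as [nxt Hnxt].
  set (q := fix q n := match n with O => (x0, (T - x0) / 2) | S k => nxt (k, q k) end).
  assert (Hq : forall n, st (q n)).
  { induction n.
    - unfold st; simpl. repeat split; try lra. exact Hx0t.
    - apply (Hnxt (n, q n) IHn). }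
  assert (Hnest : forall n, Rabs (fst (q (S n)) - fst (q n)) + snd (q (S n)) <= snd (q n)).
  { intros n. apply (Hnxt (n, q n) (Hq n)). }
  assert (Hbig : forall n, exists z, Cmod z < 1 /\ forall s, 0 <= s < T ->
     Rabs (s - fst (q (S n))) <= snd (q (S n)) -> INR n < Cmod (f z s)).
  { intros n. apply (Hnxt (n, q n) (Hq n)). }
  assert (Hnk : forall n k, Rabs (fst (q (n + k)%nat) - fst (q n)) + snd (q (n + k)%nat) <= snd (q n)).
  { intros n k. induction k.
    - rewrite Nat.add_0_r. replace (fst (q n) - fst (q n)) with 0 by ring. rewrite Rabs_R0; lra.
    - rewrite Nat.add_succ_r. specialize (Hnest (n + k)%nat).
      replace (fst (q (S (n + k))) - fst (q n)) with
        ((fst (q (S (n + k))) - fst (q (n + k)%nat)) + (fst (q (n + k)%nat) - fst (q n))) by ring.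
      eapply Rle_trans; [apply Rplus_le_compat_r, Rabs_triang|]. lra. }
  assert (Hmn : forall n m, fst (q m) - snd (q m) <= fst (q n) + snd (q n)).
  { intros n m. destruct (Hq n) as [_ [_ [P1 _]]]. destruct (Hq m) as [_ [_ [P2 _]]].
    destruct (Nat.le_ge_cases n m) as [h|h].
    - assert (A := Hnk n (m - n)%nat). replace (n + (m - n))%nat with m in A by lia.
      assert (B := Rle_abs (fst (q m) - fst (q n))). lra.
    - assert (A := Hnk m (n - m)%nat). replace (m + (n - m))%nat with n in A by lia.
      assert (B := Rle_abs (- (fst (q n) - fst (q m)))). rewrite Rabs_Ropp in B. lra. }
  destruct (completeness (fun r => exists n, r = fst (q n) - snd (q n))) as [l [H1 H2]].
  { exists (fst (q 0%nat) + snd (q 0%nat)). intros r [n ->]. apply Hmn. }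
  { exists (fst (q 0%nat) - snd (q 0%nat)). eauto. }
  assert (Hl : forall n, fst (q n) - snd (q n) <= l <= fst (q n) + snd (q n)).
  { intros n. split; [apply H1; eauto|]. apply H2. intros r [m ->]. apply Hmn. }
  (* The intervals may extend below 0. Their centres are nonnegative, so truncation at 0 stays in
     all of them. *)
  set (t := Rmax l 0).
  assert (Ht : forall n, Rabs (t - fst (q n)) <= snd (q n)).
  { intros n. specialize (Hl n). destruct (Hq n) as [P1 _].
    apply Rabs_le_between. unfold t, Rmax. destruct (Rle_dec l 0); lra. }
  assert (HtT : 0 <= t < T).
  { split; [apply Rmax_r|]. specialize (Ht 0%nat). apply Rabs_le_between in Ht.
    destruct (Hq 0%nat) as [_ [P2 _]]. lra. }
  destruct (Hslice t HtT) as [K HK].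
  destruct (nfloor_ex (Rabs K)) as [N [_ HN]]; [apply Rabs_pos|].
  destruct (Hbig (S N)) as [z [Hz Hzs]].
  assert (A := Hzs t HtT (Ht _)). rewrite S_INR in A.
  assert (B := HK z Hz). assert (Q := Rle_abs K). lra.
Qed.

Lemma all_times_tame (t : R) : 0 <= t < T -> tame t.
Proof.
  intros Ht. apply NNPP; intros Hn.
  destruct (untame_portion_bounded t Ht Hn) as [n [x [eta [Hx0 [HxT [Heta [Hx Hport]]]]]]].
  (* The last untame time [c] before [s] lies in the portion, where the bound is [n]; the tame
     interval after [c] carries it to [s]. *)
  assert (Hright : forall y s, 0 <= y -> ~ tame y -> y <= s -> Rabs (y - x) < eta -> s < x + eta ->
     forall z, Cmod z < 1 -> Cmod (f z s) <= INR n).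
  { intros y s Hy0 Hy Hys Hyx Hs. assert (Hyx' := Hyx). apply Rabs_def2 in Hyx'.
    destruct (classic (tame s)) as [Hst|Hst].
    2: { apply Hport; auto; [lra|]. apply Rabs_def1; lra. }
    destruct (completeness (fun u => u <= s /\ ~ tame u)) as [c [C1 C2]].
    { exists s. intros u [Hu _]; exact Hu. }
    { exists y. auto. }
    assert (Hyc : y <= c) by (apply C1; auto).
    assert (Hcs : c <= s) by (apply C2; intros u [Hu _]; exact Hu).
    assert (Hct : ~ tame c).
    { intros Hct. destruct (tame_open c Hct) as [e [He Hopen]].
      assert (c <= c - e); [|lra]. apply C2. intros u [Hu Hut]. apply Rnot_lt_le; intros Hlt.
      assert (u <= c) by (apply C1; auto). apply Hut, Hopen, Rabs_def1; lra. }
    assert (Hcs' : c < s). { destruct Hcs as [Hcs|Hcs]; [exact Hcs|]. subst; contradiction. }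
    apply (bounded_right_of c s (INR n)); try lra.
    - intros u Hu. apply NNPP; intros Hut. assert (u <= c) by (apply C1; split; [lra|exact Hut]). lra.
    - apply Hport; auto; [lra|]. apply Rabs_def1; lra. }
  apply Hx.
  (* Either an untame time just left of [x] lets [Hright] cover a full neighbourhood, or the times
     just left of [x] are tame and a slice [s0] there bounds [f] up to [x]. Both make [x] tame. *)
  destruct (classic (exists y, 0 <= y < x /\ x - eta < y /\ ~ tame y)) as [[y [Hy [Hye Hyt]]]|Hno].
  - exists (Rmin (x - y) eta). split; [apply Rmin_pos; lra|]. intros rho Hrho. exists (INR n).
    intros z s Hs Hsx Hz.
    assert (A1 := Rlt_min_l Hsx). assert (A2 := Rlt_min_r Hsx).
    apply Rabs_def2 in A1. apply Rabs_def2 in A2.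
    apply (Hright y s); try lra; auto. apply Rabs_def1; lra.
  - set (s0 := Rmax 0 (x - eta / 2)).
    assert (Hs0 : 0 <= s0) by apply Rmax_l.
    assert (Hs0' : x - eta / 2 <= s0) by apply Rmax_r.
    assert (Hs0x : s0 <= x) by (apply Rmax_lub; lra).
    destruct (Hslice s0 ltac:(lra)) as [K HK].
    exists (eta / 2). split; [lra|]. intros rho Hrho. exists (Rmax K (INR n)).
    intros z s Hs Hsx Hz. apply Rabs_def2 in Hsx.
    destruct (Rle_lt_dec x s) as [Hxs|Hxs].
    + eapply Rle_trans; [|apply Rmax_r]. apply (Hright x s); try lra; auto.
      replace (x - x) with 0 by ring. rewrite Rabs_R0; lra.
    + eapply Rle_trans; [|apply Rmax_l].
      assert (Hs0s : s0 <= s) by (apply Rmax_lub; lra).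
      set (r := Cmod z) in *.
      apply (forward_bound r ((1 + r) / 2) s0 s K); try lra.
      * apply tame_interval_bounded; try lra. intros u Hu. apply NNPP; intros Hut.
        apply Hno. exists u. repeat split; try lra. exact Hut.
      * intros v Hv. apply HK; lra.
      * unfold r; lra.
Qed.

Lemma bounded_on_compact_times (b rho : R) : b < T -> rho < 1 -> bounded_on rho 0 b.
Proof.
  intros Hb Hrho. apply tame_interval_bounded; try lra. intros t Ht. apply all_times_tame; lra.
Qed.

End LocalBoundedness.

(** * Short-time asymptotics of the interior map *)

Lemma Rabs_Cmod_minus (a b : C) : Rabs (Cmod a - Cmod b) <= Cmod (a - b)%C.
Proof.
  assert (A := Cmod_minus_ge a b). assert (B := Cmod_minus_ge b a).
  rewrite (Cmod_minus_sym b a) in B. apply Rabs_le_between; lra.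
Qed.

Section ShortTime.

Variables (f p : C -> R -> C) (b M L : R).
Hypothesis Hb : 0 <= b.
Hypothesis Hsol : transport_sol f p 0 b.
Hypothesis Hbd : forall rho, rho < 1 -> bounded_on f rho 0 b.
Hypothesis Hre : forall z t, Cmod z < 1 -> 0 <= t <= b -> 0 < Re (p z t).
Hypothesis HM : forall z t, Cmod z < 1 -> 0 <= t <= b -> Cmod (p z t) <= M.
Hypothesis HL0 : 0 <= L.
Hypothesis HL : forall z w t, Cmod z < 1 -> Cmod w < 1 -> 0 <= t <= b ->
  Cmod (z * p z t - w * p w t)%C <= L * Cmod (z - w)%C.
Hypothesis Hinit : forall z, Cmod z < 1 -> f z 0 = z.

Let speed (z : C) (t : R) : Cmod z < 1 -> 0 <= t <= b -> z <> 0 -> 0 < Cmod z * Re (p z t) + 0.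
Proof.
  intros Hz Ht Hz0. apply Cmod_gt_0 in Hz0. rewrite Rplus_0_r.
  apply Rmult_lt_0_compat; [exact Hz0|apply Hre; assumption].
Qed.

(** During a backward step [h] the deviation changes by at most [h L |z - w|], and [|z - w|] grows
    by at most the factor [1 + L h]. The rate [2 L] pays for both as long as [2 L s <= 1]. *)
Lemma near_identity_lipschitz (z w : C) :
  2 * L * b <= 1 -> Cmod z < 1 -> Cmod w < 1 ->
  Cmod (f z b - f w b - (z - w))%C <= 2 * L * b * Cmod (z - w)%C.
Proof.
  intros HLb Hz Hw.
  set (r := Rmax (Cmod z) (Cmod w)).
  assert (Hr : r < 1) by (apply Rmax_lub_lt; assumption).
  set (rho := (1 + r) / 2). assert (Hrho : r < rho < 1) by (unfold rho; lra).
  destruct (Hbd rho ltac:(lra)) as [K HK].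
  set (V := fun (z w : C) (s : R) => Cmod (f z s - f w s - (z - w))%C - 2 * L * s * Cmod (z - w)%C).
  assert (A : V z w b <= 0).
  { apply (transport_comparison p 0 b r 0 0 V); auto; try lra.
    - intros z0 w0 t0 Ht0 Hz0 Hw0 eps He.
      replace (r - 0 * (t0 - 0)) with r in * by ring.
      destruct (transport_jointly_continuous f p 0 b rho K Hsol ltac:(lra) HK z0 t0 (eps / 8) ltac:(lra) Ht0 ltac:(lra))
        as [d1 [Hd1 H1]].
      destruct (transport_jointly_continuous f p 0 b rho K Hsol ltac:(lra) HK w0 t0 (eps / 8) ltac:(lra) Ht0 ltac:(lra))
        as [d2 [Hd2 H2]].
      set (d3 := eps / (8 * (1 + 2 * L))).
      assert (Hd3 : 0 < d3) by (apply Rdiv_lt_0_compat; lra).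
      assert (Ed3 : d3 * (1 + 2 * L) = eps / 8) by (unfold d3; field; lra).
      exists (Rmin (Rmin d1 d2) d3). split; [repeat apply Rmin_pos; lra|].
      intros z' w' t' Ht' Hz' Hw' Dz Dw Dt.
      replace (r - 0 * (t' - 0)) with r in * by ring.
      assert (Dz1 := Rlt_min_l Dz). assert (Dz2 := Rlt_min_r Dz).
      assert (Dw1 := Rlt_min_l Dw). assert (Dw2 := Rlt_min_r Dw).
      assert (Dt1 := Rlt_min_l Dt). assert (Dt2 := Rlt_min_r Dt).
      assert (F1 := H1 z' t' (Rlt_min_l Dz1) Ht' (Rlt_min_l Dt1)).
      assert (F2 := H2 w' t' (Rlt_min_r Dw1) Ht' (Rlt_min_r Dt1)).
      unfold V.
      assert (G1 := Rabs_Cmod_minus (f z' t' - f w' t' - (z' - w'))%C (f z0 t0 - f w0 t0 - (z0 - w0))%C).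
      assert (G2 : Cmod (f z' t' - f w' t' - (z' - w') - (f z0 t0 - f w0 t0 - (z0 - w0)))%C < eps / 2).
      { replace (f z' t' - f w' t' - (z' - w') - (f z0 t0 - f w0 t0 - (z0 - w0)))%C with
          (((f z' t' - f z0 t0) - (f w' t' - f w0 t0)) - ((z' - z0) - (w' - w0)))%C by ring.
        eapply Rle_lt_trans; [apply Cmod_triangle_minus|].
        assert (Q1 := Cmod_triangle_minus (f z' t' - f z0 t0)%C (f w' t' - f w0 t0)%C).
        assert (Q2 := Cmod_triangle_minus (z' - z0)%C (w' - w0)%C). nra. }
      assert (G3 := Rabs_Cmod_minus (z' - w')%C (z0 - w0)%C).
      assert (G4 : Cmod (z' - w' - (z0 - w0))%C <= 2 * d3).
      { replace (z' - w' - (z0 - w0))%C with ((z' - z0) - (w' - w0))%C by ring.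
        assert (Q2 := Cmod_triangle_minus (z' - z0)%C (w' - w0)%C). lra. }
      assert (G5 : Cmod (z' - w')%C <= 2).
      { assert (Q2 := Cmod_triangle_minus z' w'). lra. }
      set (X' := Cmod (z' - w')%C) in *. set (X := Cmod (z0 - w0)%C) in *.
      assert (P' : 0 <= X') by apply Cmod_ge_0.
      replace (Cmod (f z' t' - f w' t' - (z' - w'))%C - 2 * L * t' * X' - (Cmod (f z0 t0 - f w0 t0 - (z0 - w0))%C - 2 * L * t0 * X))
       with ((Cmod (f z' t' - f w' t' - (z' - w'))%C - Cmod (f z0 t0 - f w0 t0 - (z0 - w0))%C)
          + ((- (2 * L * X')) * (t' - t0) + (- (2 * L * t0)) * (X' - X))) by ring.
      eapply Rle_lt_trans; [apply Rabs_triang|].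
      assert (G6 : Rabs ((- (2 * L * X')) * (t' - t0) + (- (2 * L * t0)) * (X' - X)) <= eps / 8 * 2 + eps / 8 * 2).
      { eapply Rle_trans; [apply Rabs_triang|]. rewrite !Rabs_mult, !Rabs_Ropp.
        rewrite (Rabs_pos_eq (2 * L * X')) by (apply Rmult_le_pos; lra).
        rewrite (Rabs_pos_eq (2 * L * t0)) by (apply Rmult_le_pos; lra).
        apply Rplus_le_compat.
        - apply Rle_trans with ((2 * L * 2) * d3).
          + apply Rmult_le_compat; try apply Rabs_pos; try lra.
            * apply Rmult_le_pos; lra.
            * apply Rmult_le_compat_l; lra.
          + nra.
        - apply Rle_trans with (1 * (2 * d3)).
          + apply Rmult_le_compat; try apply Rabs_pos; try lra.
            * apply Rmult_le_pos; lra.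
            * apply Rle_trans with (2 := HLb). apply Rmult_le_compat_l; lra.
          + nra. }
      lra.
    - intros z0 w0 t0 Ht0 Hz0 Hw0 eps He.
      replace (r - 0 * (t0 - 0)) with r in * by ring.
      destruct (transport_backward f p 0 b rho K Hsol ltac:(lra) HK z0 t0 (eps / 2) ltac:(lra) Ht0 ltac:(lra))
        as [d1 [Hd1 H1]].
      destruct (transport_backward f p 0 b rho K Hsol ltac:(lra) HK w0 t0 (eps / 2) ltac:(lra) Ht0 ltac:(lra))
        as [d2 [Hd2 H2]].
      exists (Rmin (Rmin d1 d2) t0). split; [repeat apply Rmin_pos; lra|].
      intros h [Hh Hh'].
      assert (E1 := Rlt_le_trans _ _ _ Hh' (Rmin_l _ _)). assert (E2 := Rlt_le_trans _ _ _ Hh' (Rmin_r _ _)).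
      specialize (H1 h (conj Hh (Rlt_min_l E1))).
      specialize (H2 h (conj Hh (Rlt_min_r E1))).
      assert (HQ := HL z0 w0 t0 ltac:(lra) ltac:(lra) ltac:(lra)).
      unfold V.
      set (zh := (z0 - h * (z0 * p z0 t0))%C) in *. set (wh := (w0 - h * (w0 * p w0 t0))%C) in *.
      set (q := (z0 * p z0 t0 - w0 * p w0 t0)%C) in *.
      assert (Ezw : (zh - wh = (z0 - w0) - h * q)%C) by (unfold zh, wh, q; ring).
      set (X := Cmod (z0 - w0)%C) in *. assert (HX : 0 <= X) by apply Cmod_ge_0.
      assert (Hhq : Cmod (h * q)%C <= h * (L * X)).
      { rewrite Cmod_mult, Cmod_R, Rabs_pos_eq by lra. apply Rmult_le_compat_l; lra. }
      assert (G1 : Cmod (zh - wh)%C <= X + h * (L * X)).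
      { rewrite Ezw. eapply Rle_trans; [apply Cmod_triangle_minus|]. fold X. lra. }
      assert (G2 : Cmod (f z0 t0 - f w0 t0 - (z0 - w0))%C - eps * h - h * (L * X)
         <= Cmod (f zh (t0 - h) - f wh (t0 - h) - (zh - wh))%C).
      { assert (Q := Cmod_minus_ge (f z0 t0 - f w0 t0 - (z0 - w0))%C
          (f z0 t0 - f w0 t0 - (z0 - w0) - (f zh (t0 - h)%R - f wh (t0 - h)%R - (zh - wh)))%C).
        replace (f z0 t0 - f w0 t0 - (z0 - w0) -
          (f z0 t0 - f w0 t0 - (z0 - w0) - (f zh (t0 - h)%R - f wh (t0 - h)%R - (zh - wh))))%C
          with (f zh (t0 - h)%R - f wh (t0 - h)%R - (zh - wh))%C in Q by ring.
        replace (f z0 t0 - f w0 t0 - (z0 - w0) - (f zh (t0 - h)%R - f wh (t0 - h)%R - (zh - wh)))%C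
          with (((f wh (t0 - h)%R - f w0 t0) - (f zh (t0 - h)%R - f z0 t0)) - h * q)%C in Q
          by (rewrite Ezw; ring).
        assert (Q1 := Cmod_triangle_minus ((f wh (t0 - h)%R - f w0 t0) - (f zh (t0 - h)%R - f z0 t0))%C (h * q)%C).
        assert (Q2 := Cmod_triangle_minus (f wh (t0 - h)%R - f w0 t0)%C (f zh (t0 - h)%R - f z0 t0)%C).
        lra. }
      assert (G3 : 2 * L * (t0 - h) * Cmod (zh - wh)%C <= 2 * L * (t0 - h) * (X + h * (L * X))).
      { apply Rmult_le_compat_l; [apply Rmult_le_pos; lra|exact G1]. }
      assert (G4 : 2 * L * (t0 - h) * (X + h * (L * X)) <= 2 * L * t0 * X - h * (L * X)).
      { assert (0 <= h * (L * X)) by (repeat apply Rmult_le_pos; lra).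
        assert (2 * L * t0 <= 1) by (apply Rle_trans with (2 := HLb); apply Rmult_le_compat_l; lra).
        assert (0 <= L * h) by (apply Rmult_le_pos; lra).
        assert (2 * L * (t0 - h) * (h * (L * X)) <= 1 * (h * (L * X))) by (apply Rmult_le_compat_r; lra).
        lra. }
      lra.
    - intros z0 w0 Hz0 Hw0. unfold V. rewrite !Hinit by lra.
      replace (z0 - w0 - (z0 - w0))%C with (RtoC 0) by ring. rewrite Cmod_0. lra.
    - replace (r - 0 * (b - 0)) with r by ring. apply Rmax_l.
    - replace (r - 0 * (b - 0)) with r by ring. apply Rmax_r. }
  unfold V in A. lra.
Qed.

(** The approximation [N z s = z - s z p(z, 0)] is constant along characteristics up to the rate
    [D]: freezing the time in [p] costs [e], and the displacement [h M] of the point costs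
    [b L M]. *)
Lemma first_order_expansion (e : R) (z : C) :
  (forall w s, Cmod w < 1 -> 0 <= s <= b -> Cmod (p w s - p w 0)%C <= e) ->
  Cmod z < 1 ->
  Cmod (f z b - (z - b * (z * p z 0)))%C <= (e + L * M * b) * b.
Proof.
  intros He Hz.
  set (r := Cmod z) in *. assert (Hr0 : 0 <= r) by apply Cmod_ge_0.
  set (rho := (1 + r) / 2). assert (Hrho : r < rho < 1) by (unfold rho; lra).
  destruct (Hbd rho ltac:(lra)) as [K HK].
  assert (HM0 : 0 <= M) by (eapply Rle_trans; [apply Cmod_ge_0|apply (HM z 0); [exact Hz|lra]]).
  assert (He0 : 0 <= e) by (eapply Rle_trans; [apply Cmod_ge_0|apply (He z 0); [exact Hz|lra]]).
  set (D := e + L * M * b).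
  assert (HD : 0 <= D) by (unfold D; assert (0 <= L * M) by nra; nra).
  set (N := fun (z : C) (s : R) => (z - s * (z * p z 0))%C).
  set (V := fun (z w : C) (s : R) => Cmod (f z s - N z s)%C - D * s).
  assert (A : V z 0 b <= 0).
  { apply (transport_comparison p 0 b r 0 0 V); auto; try lra.
    - intros z0 w0 t0 Ht0 Hz0 Hw0 eps Heps.
      replace (r - 0 * (t0 - 0)) with r in * by ring.
      destruct (transport_jointly_continuous f p 0 b rho K Hsol ltac:(lra) HK z0 t0 (eps / 8) ltac:(lra) Ht0 ltac:(lra))
        as [d1 [Hd1 H1]].
      assert (Hbig : 0 < 8 * (1 + M + D + b * L)) by nra.
      set (d3 := eps / (8 * (1 + M + D + b * L))).
      assert (Hd3 : 0 < d3) by (apply Rdiv_lt_0_compat; lra).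
      assert (Ed3 : d3 * (1 + M + D + b * L) = eps / 8) by (unfold d3; field; lra).
      exists (Rmin d1 d3). split; [repeat apply Rmin_pos; lra|].
      intros z' w' t' Ht' Hz' Hw' Dz Dw Dt.
      replace (r - 0 * (t' - 0)) with r in * by ring.
      assert (Dz1 := Rlt_min_l Dz). assert (Dz2 := Rlt_min_r Dz).
      assert (Dt1 := Rlt_min_l Dt). assert (Dt2 := Rlt_min_r Dt).
      assert (F1 := H1 z' t' Dz1 Ht' Dt1).
      unfold V.
      assert (G1 := Rabs_Cmod_minus (f z' t' - N z' t')%C (f z0 t0 - N z0 t0)%C).
      assert (G2 : Cmod (N z' t' - N z0 t0)%C <= eps / 8 * 3).
      { unfold N.
        replace (z' - t' * (z' * p z' 0%R) - (z0 - t0 * (z0 * p z0 0%R)))%C with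
          ((z' - z0) - (RtoC (t' - t0) * (z' * p z' 0%R) + t0 * (z' * p z' 0%R - z0 * p z0 0%R)))%C
          by (rewrite RtoC_minus; ring).
        eapply Rle_trans; [apply Cmod_triangle_minus|].
        eapply Rle_trans; [apply Rplus_le_compat_l, Cmod_triangle|].
        rewrite !(Cmod_mult (RtoC _)), !Cmod_R, Cmod_mult, (Rabs_pos_eq t0) by lra.
        assert (Q1 := HM z' 0 ltac:(lra) ltac:(lra)).
        assert (Q2 := HL z' z0 0 ltac:(lra) ltac:(lra) ltac:(lra)).
        assert (P1 := Cmod_ge_0 z'). assert (P2 := Cmod_ge_0 (p z' 0)). assert (P3 := Rabs_pos (t' - t0)).
        assert (Q3 : Cmod z' * Cmod (p z' 0) <= 1 * M) by (apply Rmult_le_compat; lra).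
        assert (Q4 : Rabs (t' - t0) * (Cmod z' * Cmod (p z' 0)) <= d3 * (1 * M)).
        { apply Rmult_le_compat; try lra. apply Rmult_le_pos; lra. }
        assert (Q5 : t0 * Cmod (z' * p z' 0%R - z0 * p z0 0%R)%C <= b * (L * d3)).
        { apply Rmult_le_compat; try lra; [apply Cmod_ge_0|].
          apply Rle_trans with (1 := Q2). apply Rmult_le_compat_l; lra. }
        nra. }
      assert (G3 : Cmod (f z' t' - N z' t' - (f z0 t0 - N z0 t0))%C <= eps / 8 * 4).
      { replace (f z' t' - N z' t' - (f z0 t0 - N z0 t0))%C with ((f z' t' - f z0 t0) - (N z' t' - N z0 t0))%C by ring.
        eapply Rle_trans; [apply Cmod_triangle_minus|]. lra. }
      replace (Cmod (f z' t' - N z' t')%C - D * t' - (Cmod (f z0 t0 - N z0 t0)%C - D * t0)) with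
        ((Cmod (f z' t' - N z' t')%C - Cmod (f z0 t0 - N z0 t0)%C) + (- D) * (t' - t0)) by ring.
      eapply Rle_lt_trans; [apply Rabs_triang|]. rewrite Rabs_mult, Rabs_Ropp, (Rabs_pos_eq D) by exact HD.
      assert (0 <= d3 * (b * L)) by (apply Rmult_le_pos; nra).
      nra.
    - intros z0 w0 t0 Ht0 Hz0 Hw0 eps Heps.
      replace (r - 0 * (t0 - 0)) with r in * by ring.
      destruct (transport_backward f p 0 b rho K Hsol ltac:(lra) HK z0 t0 eps ltac:(lra) Ht0 ltac:(lra))
        as [d1 [Hd1 H1]].
      destruct (backward_step_in_disk z0 (p z0 t0) r 0 Hr0 Hz0 ltac:(apply speed; lra) ltac:(lra)) as [d2 [Hd2 H2]].
      exists (Rmin (Rmin d1 d2) t0). split; [repeat apply Rmin_pos; lra|].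
      intros h [Hh Hh'].
      assert (E1 := Rlt_le_trans _ _ _ Hh' (Rmin_l _ _)). assert (E2 := Rlt_le_trans _ _ _ Hh' (Rmin_r _ _)).
      specialize (H1 h (conj Hh (Rlt_min_l E1))).
      specialize (H2 h (conj Hh (Rlt_min_r E1))).
      unfold V.
      set (zh := (z0 - h * (z0 * p z0 t0))%C) in *.
      assert (B1 : Cmod (N zh (t0 - h)%R - N z0 t0)%C <= D * h).
      { unfold N.
        replace (zh - RtoC (t0 - h)%R * (zh * p zh 0%R) - (z0 - t0 * (z0 * p z0 0%R)))%C with
          (h * (z0 * (p z0 0%R - p z0 t0)) + RtoC (t0 - h) * (z0 * p z0 0%R - zh * p zh 0%R))%C
          by (generalize (p zh 0); intros ph; unfold zh; rewrite RtoC_minus; ring).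
        eapply Rle_trans; [apply Cmod_triangle|].
        rewrite !(Cmod_mult (RtoC _)), !Cmod_R, !Rabs_pos_eq by lra. rewrite Cmod_mult.
        assert (Q1 := He z0 t0 ltac:(lra) ltac:(lra)). rewrite Cmod_minus_sym in Q1.
        assert (Q2 := HL z0 zh 0 ltac:(lra) ltac:(lra) ltac:(lra)).
        assert (Q3 : Cmod (z0 - zh)%C <= h * M).
        { unfold zh. replace (z0 - (z0 - h * (z0 * p z0 t0)))%C with (h * (z0 * p z0 t0))%C by ring.
          rewrite !Cmod_mult, Cmod_R, Rabs_pos_eq by lra.
          assert (P1 := Cmod_ge_0 z0). assert (P2 := Cmod_ge_0 (p z0 t0)).
          assert (P3 := HM z0 t0 ltac:(lra) ltac:(lra)).
          apply Rmult_le_compat_l; [lra|]. replace M with (1 * M) by ring. apply Rmult_le_compat; lra. }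
        assert (P1 := Cmod_ge_0 z0). assert (P2 := Cmod_ge_0 (p z0 0 - p z0 t0)%C).
        assert (Q4 : h * (Cmod z0 * Cmod (p z0 0 - p z0 t0)%C) <= h * e).
        { apply Rmult_le_compat_l; [lra|]. replace e with (1 * e) by ring. apply Rmult_le_compat; lra. }
        assert (Q5 : (t0 - h) * Cmod (z0 * p z0 0%R - zh * p zh 0%R)%C <= b * (L * (h * M))).
        { apply Rmult_le_compat; try lra; [apply Cmod_ge_0|].
          apply Rle_trans with (1 := Q2). apply Rmult_le_compat_l; lra. }
        unfold D. lra. }
      assert (Q := Cmod_minus_ge (f z0 t0 - N z0 t0)%C
          (f z0 t0 - N z0 t0 - (f zh (t0 - h)%R - N zh (t0 - h)%R))%C).
      replace (f z0 t0 - N z0 t0 - (f z0 t0 - N z0 t0 - (f zh (t0 - h)%R - N zh (t0 - h)%R)))%C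
        with (f zh (t0 - h)%R - N zh (t0 - h)%R)%C in Q by ring.
      replace (f z0 t0 - N z0 t0 - (f zh (t0 - h)%R - N zh (t0 - h)%R))%C with
        ((N zh (t0 - h)%R - N z0 t0) - (f zh (t0 - h)%R - f z0 t0))%C in Q by ring.
      assert (Q1 := Cmod_triangle_minus (N zh (t0 - h)%R - N z0 t0)%C (f zh (t0 - h)%R - f z0 t0)%C).
      lra.
    - intros z0 w0 Hz0 Hw0. unfold V, N. rewrite Hinit by lra.
      replace (z0 - (z0 - 0 * (z0 * p z0 0%R)))%C with (RtoC 0) by ring. rewrite Cmod_0. lra.
    - replace (r - 0 * (b - 0)) with r by ring. unfold r; lra.
    - replace (r - 0 * (b - 0)) with r by ring. rewrite Cmod_0; exact Hr0. }
  unfold V, N, D in *. lra.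
Qed.

End ShortTime.

(** * Passage to the closed disk *)

Lemma cont_within_radial (g : C -> C) (z : C) (eps : R) :
  cont_within (fun w => Cmod w <= 1) g z -> Cmod z <= 1 -> eps > 0 ->
  exists x0, 0 <= x0 < 1 /\ forall x : R, x0 <= x < 1 -> Cmod (g (x * z)%C - g z)%C < eps.
Proof.
  intros Hg Hz He. destruct (Hg eps He) as [d [Hd H]].
  exists (Rmax 0 (1 - d / 2)). split; [split; [apply Rmax_l|apply Rmax_lub_lt; lra]|].
  intros x [Hx Hx1].
  assert (A1 := Rle_trans _ _ _ (Rmax_l _ _) Hx). assert (A2 := Rle_trans _ _ _ (Rmax_r _ _) Hx).
   apply H.
  - rewrite Cmod_mult, Cmod_R, Rabs_pos_eq by lra. nra.
  - replace (x * z - z)%C with (RtoC (x - 1) * z)%C by (rewrite RtoC_minus; ring).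
    rewrite Cmod_mult, Cmod_R, Rabs_minus_sym, Rabs_pos_eq by lra. nra.
Qed.

Lemma lipschitz_closed_disk (g : C -> C) (K : R) :
  0 <= K ->
  (forall z, Cmod z <= 1 -> cont_within (fun w => Cmod w <= 1) g z) ->
  (forall z w, Cmod z < 1 -> Cmod w < 1 -> Cmod (g z - g w)%C <= K * Cmod (z - w)%C) ->
  forall z w, Cmod z <= 1 -> Cmod w <= 1 -> Cmod (g z - g w)%C <= K * Cmod (z - w)%C.
Proof.
  intros HK Hc H z w Hz Hw. apply Rle_plus_epsilon. intros eps He.
  destruct (cont_within_radial g z (eps / 2) (Hc z Hz) Hz ltac:(lra)) as [x1 [Hx1 H1]].
  destruct (cont_within_radial g w (eps / 2) (Hc w Hw) Hw ltac:(lra)) as [x2 [Hx2 H2]].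
  set (x := Rmax x1 x2).
  assert (Hx : 0 <= x < 1) by (split; [eapply Rle_trans; [apply Hx1|apply Rmax_l]|apply Rmax_lub_lt; lra]).
  assert (A1 := H1 x ltac:(split; [apply Rmax_l|lra])).
  assert (A2 := H2 x ltac:(split; [apply Rmax_r|lra])).
  assert (B : forall v, Cmod v <= 1 -> Cmod (x * v)%C < 1).
  { intros v Hv. rewrite Cmod_mult, Cmod_R, Rabs_pos_eq by lra. nra. }
  assert (A3 := H (x * z)%C (x * w)%C (B z Hz) (B w Hw)).
  replace (x * z - x * w)%C with (x * (z - w))%C in A3 by ring.
  rewrite Cmod_mult, Cmod_R, Rabs_pos_eq in A3 by lra.
  replace (g z - g w)%C with ((g (x * z) - g (x * w)) - ((g (x * z) - g z) - (g (x * w) - g w)))%C by ring.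
  eapply Rle_trans; [apply Cmod_triangle_minus|].
  assert (Q := Cmod_triangle_minus (g (x * z) - g z)%C (g (x * w) - g w)%C).
  assert (P := Cmod_ge_0 (z - w)%C).
  assert (K * (x * Cmod (z - w)%C) <= K * Cmod (z - w)%C) by (apply Rmult_le_compat_l; nra).
  lra.
Qed.

Lemma bound_closed_disk (g : C -> C) (K : R) :
  (forall z, Cmod z <= 1 -> cont_within (fun w => Cmod w <= 1) g z) ->
  (forall z, Cmod z < 1 -> Cmod (g z)%C <= K) ->
  forall z, Cmod z <= 1 -> Cmod (g z)%C <= K.
Proof.
  intros Hc H z Hz. apply Rle_plus_epsilon. intros eps He.
  destruct (cont_within_radial g z eps (Hc z Hz) Hz He) as [x [Hx H1]].
  assert (A1 := H1 x ltac:(lra)).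
  assert (B : Cmod (x * z)%C < 1).
  { rewrite Cmod_mult, Cmod_R, Rabs_pos_eq by lra. nra. }
  assert (A2 := H _ B). rewrite Cmod_minus_sym in A1.
  assert (Q := Cmod_minus_ge (g z) (g (x * z)%C)). lra.
Qed.

Lemma holo_lipschitz_disk (g g' : C -> C) (K : R) :
  (forall z, Cmod z < 1 -> is_cderiv g z (g' z)) ->
  (forall z, Cmod z < 1 -> Cmod (g' z) <= K) ->
  forall z w, Cmod z < 1 -> Cmod w < 1 -> Cmod (g z - g w)%C <= K * Cmod (z - w)%C.
Proof.
  intros Hd HK z w Hz Hw.
  replace z with (w + (z - w))%C at 1 by ring.
  apply segment_mean_value_const. intros s Hs.
  assert (Hin : Cmod (w + s * (z - w))%C < 1).
  { replace (w + s * (z - w))%C with (RtoC (1 - s) * w + s * z)%C by (rewrite RtoC_minus; ring).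
    eapply Rle_lt_trans; [apply Cmod_triangle|].
    rewrite !Cmod_mult, !Cmod_R, !Rabs_pos_eq by lra.
    destruct (Req_dec s 0) as [->|Hs0]; [lra|].
    assert (s * Cmod z < s * 1) by (apply Rmult_lt_compat_l; lra).
    assert ((1 - s) * Cmod w <= (1 - s) * 1) by (apply Rmult_le_compat_l; lra). lra. }
  exists (g' (w + s * (z - w))%C). split; [apply Hd, Hin|].
  rewrite Cmod_mult. apply Rmult_le_compat_r; [apply Cmod_ge_0|apply HK, Hin].
Qed.

(** Continuity at time 0 is given for each [z] separately. The Lipschitz bound in [z], common to all
    times, together with compactness of the closed disk makes it uniform. *)
Lemma uniform_time_continuity (p : C -> R -> C) (T M : R) :
  0 < T -> 0 <= M ->
  (forall t z w, 0 <= t < T -> Cmod z <= 1 -> Cmod w <= 1 -> Cmod (p z t - p w t)%C <= M * Cmod (z - w)%C) ->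
  (forall z, Cmod z <= 1 -> forall eps, eps > 0 -> exists delta, delta > 0 /\
     forall s, 0 <= s < T -> s < delta -> Cmod (p z s - p z 0)%C < eps) ->
  forall eps, eps > 0 -> exists delta, delta > 0 /\
     forall z s, Cmod z <= 1 -> 0 <= s < T -> s < delta -> Cmod (p z s - p z 0)%C <= eps.
Proof.
  intros HT HM HL Hc eps He. apply NNPP; intros Hn.
  assert (Hs : forall n : nat, exists zs : C * R, Cmod (fst zs) <= 1 /\ 0 <= snd zs < T /\
     snd zs < / (INR n + 1) /\ eps < Cmod (p (fst zs) (snd zs) - p (fst zs) 0)%C).
  { intros n. apply NNPP; intros Hn'. apply Hn.
    assert (Hk : 0 < / (INR n + 1)) by (apply Rinv_0_lt_compat; generalize (pos_INR n); lra).
    exists (/ (INR n + 1)). split; [exact Hk|]. intros z s Hz Hs Hsn.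
    apply Rnot_lt_le; intros Hlt. apply Hn'. exists (z, s). auto. }
  destruct (choice _ Hs) as [u Hu].
  destruct (C_cluster_point (fun n => fst (u n)) 1) as [z0 [Hz0 Hcl]]; [intros n; apply Hu|].
  destruct (Hc z0 Hz0 (eps / 2)) as [d [Hd Hd']]; [lra|].
  destruct (nfloor_ex (/ d)) as [N [_ HN]]; [apply Rlt_le, Rinv_0_lt_compat; lra|].
  destruct (Hcl (eps / (4 * (M + 1))) N) as [n [Hn' Hz]]; [apply Rdiv_lt_0_compat; lra|].
  destruct (Hu n) as [U1 [U2 [U3 U4]]].
  assert (Hsd : snd (u n) < d).
  { eapply Rlt_le_trans; [exact U3|]. rewrite <- (Rinv_inv d).
    apply Rinv_le_contravar; [apply Rinv_0_lt_compat; lra|]. apply le_INR in Hn'. lra. }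
  assert (A1 := Hd' (snd (u n)) U2 Hsd).
  assert (A2 := HL (snd (u n)) (fst (u n)) z0 U2 U1 Hz0).
  assert (A3 := HL 0 (fst (u n)) z0 ltac:(lra) U1 Hz0).
  apply (Rmult_lt_compat_r (4 * (M + 1))) in Hz; [|lra].
  replace (eps / (4 * (M + 1)) * (4 * (M + 1))) with eps in Hz by (field; lra).
  set (X := Cmod (fst (u n) - z0)%C) in *.
  replace (p (fst (u n)) (snd (u n)) - p (fst (u n)) 0%R)%C with
    ((p (fst (u n)) (snd (u n)) - p z0 (snd (u n))) + ((p z0 (snd (u n)) - p z0 0%R) - (p (fst (u n)) 0%R - p z0 0%R)))%C in U4 by ring.
  assert (Q1 := Cmod_triangle (p (fst (u n)) (snd (u n)) - p z0 (snd (u n)))%C ((p z0 (snd (u n)) - p z0 0%R) - (p (fst (u n)) 0%R - p z0 0%R))%C).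
  assert (Q2 := Cmod_triangle_minus (p z0 (snd (u n)) - p z0 0%R)%C (p (fst (u n)) 0%R - p z0 0%R)%C).
  nra.
Qed.

(** * Holomorphic functions with values in a narrow cone *)

Lemma Cminus_0_r (z : C) : (z - 0)%C = z.
Proof. ring. Qed.

Lemma atan_abs_le (x : R) : Rabs (atan x) <= Rabs x.
Proof.
  destruct (MVT_abs atan (fun y => / (1 + y ^ 2)) 0 x) as [c [E _]].
  { intros c _. apply derivable_pt_lim_atan. }
  rewrite atan_0, !Rminus_0_r in E. rewrite E.
  assert (0 < 1 + c ^ 2) by (assert (Q := pow2_ge_0 c); lra).
  assert (Hc : 0 < / (1 + c ^ 2)) by (apply Rinv_0_lt_compat; assumption).
  rewrite (Rabs_pos_eq (/ (1 + c ^ 2))) by lra.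
  assert (/ (1 + c ^ 2) <= 1).
  { rewrite <- Rinv_1. apply Rinv_le_contravar; [lra|]. assert (Q := pow2_ge_0 c); lra. }
  assert (Q := Rabs_pos x). nra.
Qed.

Lemma Cpow_polar (r a : R) (n : nat) :
  Cpow ((r * cos a)%R, (r * sin a)%R) n = ((r ^ n * cos (INR n * a))%R, (r ^ n * sin (INR n * a))%R).
Proof.
  induction n.
  - simpl. rewrite Rmult_0_l, cos_0, sin_0. apply C_eq; unfold Re, Im; simpl; ring.
  - rewrite Cpow_S, IHn, S_INR. replace ((INR n + 1) * a) with (INR n * a + a) by ring.
    rewrite cos_plus, sin_plus. apply C_eq; rewrite ?Re_mult, ?Im_mult; unfold Re, Im; simpl; ring.
Qed.

(** The argument of [y] is at most [alpha], so that of the power is at most 1, which is less than a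
    right angle. *)
Lemma cone_pow_Re_pos (y : C) (alpha : R) (n : nat) :
  0 < Re y -> Rabs (Im y) <= alpha * Re y -> INR n * alpha <= 1 -> 0 <= Re (y ^ n)%C.
Proof.
  intros Hre Him Hn.
  set (a := atan (Im y / Re y)).
  assert (Ha : Rabs a <= alpha).
  { eapply Rle_trans; [apply atan_abs_le|]. unfold Rdiv. rewrite Rabs_mult, Rabs_inv, (Rabs_pos_eq (Re y)) by lra.
    apply (Rmult_le_reg_r (Re y)); [exact Hre|]. rewrite Rmult_assoc, Rinv_l; lra. }
  assert (Hc : 0 < cos a) by (assert (Q := atan_bound (Im y / Re y)); fold a in Q; apply cos_gt_0; lra).
  set (r := Re y / cos a).
  assert (Hr : 0 < r) by (apply Rdiv_lt_0_compat; assumption).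
  assert (Ey : y = ((r * cos a)%R, (r * sin a)%R)).
  { apply C_eq; [change (Re y = r * cos a); unfold r; field; lra|].
    change (Im y = r * sin a). assert (Ht : tan a = Im y / Re y) by apply tan_atan.
    unfold tan in Ht. unfold r. replace (Re y / cos a * sin a) with (Re y * (sin a / cos a)) by (field; lra).
    rewrite Ht. field. lra. }
  rewrite Ey, Cpow_polar.
  change (0 <= r ^ n * cos (INR n * a)).
  apply Rmult_le_pos; [apply pow_le; lra|].
  assert (Hna : Rabs (INR n * a) <= 1).
  { rewrite Rabs_mult, (Rabs_pos_eq (INR n)) by apply pos_INR.
    apply Rle_trans with (2 := Hn). apply Rmult_le_compat_l; [apply pos_INR|exact Ha]. }
  apply Rabs_le_between in Hna. assert (HP := PI2_1). apply cos_ge_0; lra.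
Qed.

(** The factor 2 in the opening pays for replacing [x^2] by [x^2 - y^2], the real part of the
    square. Zero-freeness keeps [Y] off the apex, and [Y 0 = 1] selects the right half. *)
Lemma cone_of_double_cone (Y : C -> C) (kappa : R) :
  0 < kappa <= / 2 ->
  (forall z, Cmod z <= 1 -> cont_within (fun w => Cmod w <= 1) Y z) ->
  (forall z, Cmod z < 1 -> cderivable Y z) ->
  Y 0 = 1 -> (forall z, Cmod z < 1 -> Y z <> 0) ->
  (forall z, Cmod z = 1 -> Rabs (Im (Y z)) <= kappa * Rabs (Re (Y z))) ->
  forall z, Cmod z < 1 -> 0 < Re (Y z) /\ Rabs (Im (Y z)) <= 2 * kappa * Re (Y z).
Proof.
  intros Hk Hcont Hder H0 Hne Hbd.
  (* Squaring merges the two halves of the double cone into one convex cone. *)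
  assert (Hsq : forall sg z, (sg = 1 \/ sg = -1) -> Cmod z <= 1 ->
     - (4 * kappa * (Re (Y z) ^ 2 - Im (Y z) ^ 2)) + sg * (2 * Re (Y z) * Im (Y z)) <= 0).
  { intros sg z Hsg Hz.
    (* With this constant [Re (c Y^2) <= 0] for both signs says [2 |x y| <= 4 kappa (x^2 - y^2)],
       the cone condition in terms of the square. *)
    set (c := ((- (4 * kappa))%R, (- sg)%R) : C).
    assert (E : forall w, Re (c * (Y w * Y w))%C =
       - (4 * kappa * (Re (Y w) ^ 2 - Im (Y w) ^ 2)) + sg * (2 * Re (Y w) * Im (Y w))).
    { intros w. rewrite !Re_mult, Im_mult. unfold c, Re, Im; simpl. ring. }
    rewrite <- E.
    apply (max_principle_Re (fun w => c * (Y w * Y w))%C 0 1 0); [lra| | | |rewrite Cminus_0_r; exact Hz].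
    - intros w Hw. rewrite Cminus_0_r in Hw.
      apply (cont_within_subset _ (fun w => Cmod w <= 1)); [intros v; rewrite Cminus_0_r; auto|].
      apply cont_within_mult; [apply cont_within_const|apply cont_within_mult; auto].
    - intros w Hw. rewrite Cminus_0_r in Hw.
      apply cderivable_mult; [apply cderivable_const|apply cderivable_mult; apply Hder; lra].
    - intros w Hw. rewrite Cminus_0_r in Hw. rewrite E. specialize (Hbd w Hw).
      set (x := Re (Y w)) in *. set (y := Im (Y w)) in *.
      assert (Ha : Rabs y * Rabs y = y ^ 2) by (rewrite <- Rabs_mult, Rabs_pos_eq; [ring|apply Rle_0_sqr]).
      assert (Hb : Rabs x * Rabs x = x ^ 2) by (rewrite <- Rabs_mult, Rabs_pos_eq; [ring|apply Rle_0_sqr]).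
      assert (Hxy : sg * (2 * x * y) <= 2 * (Rabs x * Rabs y)).
      { rewrite <- Rabs_mult. assert (Q1 := Rle_abs (x * y)). assert (Q2 := Rle_abs (- (x * y))).
        rewrite Rabs_Ropp in Q2. destruct Hsg as [-> | ->]; lra. }
       assert (Py := Rabs_pos y).
      assert (Hy2 : y ^ 2 <= kappa * kappa * x ^ 2) by (rewrite <- Ha, <- Hb; nra).
      assert (Hx2 : 0 <= x ^ 2) by apply pow2_ge_0.
      assert (Hkk : kappa * kappa <= / 4) by nra.
      assert (Hy3 : y ^ 2 <= / 4 * x ^ 2).
      { apply Rle_trans with (1 := Hy2). apply Rmult_le_compat_r; assumption. }
       nra. }
  assert (Hin : forall z, Cmod z < 1 -> Re (Y z) <> 0 /\ Rabs (Im (Y z)) <= 2 * kappa * Rabs (Re (Y z))).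
  { intros z Hz. assert (A := Hsq 1 z (or_introl eq_refl) ltac:(lra)).
    assert (B := Hsq (-1) z (or_intror eq_refl) ltac:(lra)).
    specialize (Hne z Hz).
    set (x := Re (Y z)) in *. set (y := Im (Y z)) in *.
    assert (Hxy2 : y ^ 2 <= x ^ 2) by nra.
    assert (Hx0 : x <> 0).
    { intros Ex. apply Hne. apply C_eq; [exact Ex|]. fold y. rewrite Ex in Hxy2. simpl in Hxy2.
      change (y = 0). nra. }
    split; [exact Hx0|].
    assert (Px : 0 < Rabs x) by (apply Rabs_pos_lt, Hx0).
    assert (Hb : Rabs x * Rabs x = x ^ 2) by (rewrite <- Rabs_mult, Rabs_pos_eq; [ring|apply Rle_0_sqr]).
    assert (Hxy : 2 * (Rabs x * Rabs y) <= 4 * kappa * x ^ 2).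
    { assert (0 <= kappa * y ^ 2) by (apply Rmult_le_pos; [lra|apply pow2_ge_0]).
      rewrite <- Rabs_mult. apply (Rmult_le_reg_l (/ 2)); [lra|].
      replace (/ 2 * (2 * Rabs (x * y))) with (Rabs (x * y)) by field.
      apply Rabs_le_between. lra. }
    apply (Rmult_le_reg_l (Rabs x)); [exact Px|]. nra. }
  intros z Hz. destruct (Hin z Hz) as [A B].
  (* [Re Y] has no zero in the disk and equals 1 at the origin; the intermediate value theorem on
     the radius to [z] excludes a change of sign. *)
  assert (Hpos : 0 < Re (Y z)).
  { apply Rnot_le_lt; intros Hle.
    set (g := fun s : R => Re ((- (1)) * Y (0 + s * z)%C)%C).
    assert (Eg : forall s, g s = - Re (Y (s * z)%C)).
    { intros s. unfold g. rewrite Cplus_0_l. rewrite Re_mult.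
      change (Re (- (1))%C) with (- (1)). change (Im (- (1))%C) with (- 0). ring. }
    destruct (IVT_interv g 0 1) as [s [Hs Es]].
    - intros s Hs.
      assert (Hsz : Cmod (0 + s * z)%C < 1).
      { rewrite Cplus_0_l, Cmod_mult, Cmod_R, Rabs_pos_eq by lra. assert (P := Cmod_ge_0 z). nra. }
      destruct (Hder _ Hsz) as [l Hl].
      apply continuity_pt_filterlim. apply (ex_derive_continuous g s).
      eexists. apply is_derive_Re_segment, Hl.
    - lra.
    - rewrite Eg. replace (0 * z)%C with (RtoC 0) by ring. rewrite H0. change (Re (RtoC 1)) with 1. lra.
    - rewrite Eg. replace (1 * z)%C with z by ring. lra.
    - rewrite Eg in Es. destruct (Hin (s * z)%C) as [A' _]; [|lra].
      rewrite Cmod_mult, Cmod_R, Rabs_pos_eq by lra. assert (P := Cmod_ge_0 z). nra. }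
  split; [exact Hpos|]. rewrite (Rabs_pos_eq (Re (Y z))) in B by lra. exact B.
Qed.

(** The quadratic term of the binomial expansion. From [y^n <= q^2] it yields [y - 1 = O(q / n)];
    Bernoulli's linear bound would give [q^2 / n] and lose the square root in the Hoelder
    estimate. *)
Lemma pow_quadratic_lower (v : R) (n : nat) :
  0 <= v -> (2 <= n)%nat -> (INR n * v) * (INR n * v) / 4 < (1 + v) ^ n.
Proof.
  intros Hv Hn.
  assert (A : forall m : nat, 1 + INR m * v + INR m * (INR m - 1) / 2 * (v * v) <= (1 + v) ^ m).
  { induction m; [simpl; lra|]. rewrite S_INR. simpl pow.
    assert (0 <= INR m * (INR m - 1) * (v * v * v)).
    { destruct m; [simpl; lra|]. rewrite S_INR. assert (Q := pos_INR m).
      repeat apply Rmult_le_pos; lra. }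
    assert ((1 + v) * (1 + INR m * v + INR m * (INR m - 1) / 2 * (v * v)) <= (1 + v) * (1 + v) ^ m)
      by (apply Rmult_le_compat_l; lra).
    nra. }
  specialize (A n).
  assert (Hn2 : 2 <= INR n) by (replace 2 with (INR 2) by (simpl; ring); apply le_INR, Hn).
  assert (0 <= v * v) by nra.
  assert (INR n * INR n / 4 <= INR n * (INR n - 1) / 2) by nra.
  nra.
Qed.

(** For [n] about [1 / alpha] the power [Y^n] has nonnegative real part. The Schwarz lemma for its
    Cayley transform confines [|Y|^n] between [(1 - r) / (1 + r)] and its inverse; taking the root
    gains the factor [alpha]. *)
Lemma cone_modulus_bound (Y : C -> C) (alpha : R) :
  0 < alpha <= / 8 ->
  (forall z, Cmod z < 1 -> cderivable Y z) -> Y 0 = 1 ->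
  (forall z, Cmod z < 1 -> 0 < Re (Y z) /\ Rabs (Im (Y z)) <= alpha * Re (Y z)) ->
  forall z, Cmod z < 1 -> Cmod (Y z - 1)%C * sqrt (1 - Cmod z) <= 14 * alpha.
Proof.
  intros Ha Hder H0 Hcone z Hz.
  set (r := Cmod z) in *. assert (Hr : 0 <= r) by apply Cmod_ge_0.
  destruct (nfloor_ex (/ alpha)) as [n [Hn1 Hn2]]; [apply Rlt_le, Rinv_0_lt_compat; lra|].
  assert (Hia : 8 <= / alpha).
  { rewrite <- (Rinv_inv 8). apply Rinv_le_contravar; lra. }
  assert (Hna : INR n * alpha <= 1).
  { apply (Rmult_le_compat_r alpha) in Hn1; [|lra]. rewrite Rinv_l in Hn1; lra. }
  assert (Hna2 : 1 <= 2 * alpha * INR n).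
  { apply (Rmult_lt_compat_r alpha) in Hn2; [|lra]. rewrite Rinv_l in Hn2 by lra. nra. }
  assert (Hn2' : (2 <= n)%nat).
  { apply INR_le. simpl. lra. }
  assert (HnR : 0 < INR n) by lra.
  assert (Hpn : forall w, Cmod w < 1 -> 0 <= Re (Y w ^ n)%C).
  { intros w Hw. destruct (Hcone w Hw). apply (cone_pow_Re_pos (Y w) alpha n); auto. }
  assert (Hnz : forall w, Cmod w < 1 -> (Y w ^ n + 1)%C <> 0).
  { intros w Hw E. assert (Q := Hpn w Hw). assert (Q2 : Re (Y w ^ n + 1)%C = 0) by (rewrite E; reflexivity).
    rewrite Re_plus in Q2. change (Re (RtoC 1)) with 1 in Q2. lra. }
  assert (HT : Cmod ((Y z ^ n - 1) / (Y z ^ n + 1))%C * 1 <= 1 * Cmod (z - 0)%C).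
  { apply (schwarz_lemma (fun w => (Y w ^ n - 1) / (Y w ^ n + 1))%C 0 1 1).
    - intros w Hw. rewrite Cminus_0_r in Hw.
      apply cderivable_div; [| |auto].
      + apply cderivable_minus; [apply cderivable_pow; auto|apply cderivable_const].
      + apply cderivable_plus; [apply cderivable_pow; auto|apply cderivable_const].
    - intros w Hw. rewrite Cminus_0_r in Hw. specialize (Hpn w Hw). specialize (Hnz w Hw).
      rewrite Cmod_div by exact Hnz. assert (P := Hnz). apply Cmod_gt_0 in P.
      apply (Rmult_le_reg_r (Cmod (Y w ^ n + 1)%C)); [exact P|].
      unfold Rdiv. rewrite Rmult_assoc, Rinv_l, Rmult_1_r, Rmult_1_l by lra.
      apply sqrt_le_1_alt. set (q := (Y w ^ n)%C) in *.
      change (Re (q - 1)%C ^ 2 + Im (q - 1)%C ^ 2 <= Re (q + 1)%C ^ 2 + Im (q + 1)%C ^ 2).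
      rewrite Re_minus, Im_minus, Re_plus, Im_plus. change (Re (RtoC 1)) with 1. change (Im (RtoC 1)) with 0. nra.
    - rewrite H0, Cpow_1_l. unfold Cdiv. ring.
    - rewrite Cminus_0_r. exact Hz. }
  rewrite Cminus_0_r in HT. fold r in HT.
  rewrite Cmod_div in HT by auto.
  assert (P := Hnz z Hz). apply Cmod_gt_0 in P.
  apply (Rmult_le_compat_r (Cmod (Y z ^ n + 1)%C)) in HT; [|lra].
  replace (Cmod (Y z ^ n - 1) / Cmod (Y z ^ n + 1) * 1 * Cmod (Y z ^ n + 1)) with (Cmod (Y z ^ n - 1)%C) in HT by (field; lra).
  assert (T1 := Cmod_triangle (Y z ^ n)%C 1). assert (T2 := Cmod_minus_ge (Y z ^ n)%C 1).
  assert (T3 := Cmod_minus_ge 1 (Y z ^ n)%C). rewrite (Cmod_minus_sym 1) in T3.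
  rewrite Cmod_1 in *. rewrite Cmod_pow in *.
  set (y := Cmod (Y z)) in *.
  assert (Hy0 : 0 <= y) by apply Cmod_ge_0.
  assert (Hup : y ^ n * (1 - r) <= 1 + r) by nra.
  assert (Hlo : 1 - r <= y ^ n * (1 + r)) by nra.
  (* [v] below is chosen with [n v = 2 q], so that [(1 + v)^n > q^2] and hence [|Y|] lies between
     [1 - v] and [1 + v]. Finally [q sqrt (1 - r) <= 2] turns [7 alpha q] into [14 alpha]. *)
  set (q := sqrt ((1 + r) / (1 - r))).
  assert (Hx1 : 1 <= (1 + r) / (1 - r)).
  { apply (Rmult_le_reg_r (1 - r)); [lra|]. unfold Rdiv. rewrite Rmult_assoc, Rinv_l; lra. }
  assert (Hq1 : 1 <= q) by (rewrite <- sqrt_1; apply sqrt_le_1_alt, Hx1).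
  assert (Hqq : q * q = (1 + r) / (1 - r)) by (apply sqrt_sqrt; lra).
  set (v := 2 * q / INR n).
  assert (Hv : 0 < v) by (apply Rdiv_lt_0_compat; lra).
  assert (Hnv : INR n * v = 2 * q) by (unfold v; field; lra).
  assert (Hvx := pow_quadratic_lower v n (Rlt_le _ _ Hv) Hn2').
  rewrite Hnv in Hvx. replace (2 * q * (2 * q) / 4) with (q * q) in Hvx by field.
  assert (Hv4 : v <= 4 * alpha * q).
  { apply (Rmult_le_reg_r (INR n)); [exact HnR|]. rewrite (Rmult_comm v), Hnv. nra. }
  assert (Hqq' : q * q * (1 - r) = 1 + r) by (rewrite Hqq; field; lra).
  assert (Hyu : y <= 1 + v).
  { apply Rnot_lt_le; intros Hlt.
    assert ((1 + v) ^ n <= y ^ n) by (apply pow_incr; lra).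
    assert (q * q * (1 - r) < y ^ n * (1 - r)) by (apply Rmult_lt_compat_r; lra). lra. }
  assert (Hyl : 1 <= y * (1 + v)).
  { apply Rnot_lt_le; intros Hlt.
    assert (B : (y * (1 + v)) ^ n <= 1 ^ n) by (apply pow_incr; split; [apply Rmult_le_pos; lra|lra]).
    rewrite pow1, Rpow_mult_distr in B.
    assert (Hyn : 0 < y ^ n).
    { apply Rnot_le_lt; intros Hle. assert (y ^ n * (1 + r) <= 0) by nra. lra. }
    assert (y ^ n * (q * q) < y ^ n * (1 + v) ^ n) by (apply Rmult_lt_compat_l; assumption).
    assert (y ^ n * (q * q) * (1 - r) < 1 * (1 - r)) by (apply Rmult_lt_compat_r; lra).
    assert (y ^ n * (q * q * (1 - r)) = y ^ n * (1 + r)) by (rewrite Hqq'; reflexivity). lra. }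
  destruct (Hcone z Hz) as [C1 C2].
  assert (Hry : Re (Y z) <= y).
  { eapply Rle_trans; [apply Rle_abs|apply re_le_Cmod]. }
  assert (Hyr : y <= Re (Y z) + Rabs (Im (Y z))).
  { assert (Q := Cmod_le_re_im (Y z)). rewrite (Rabs_pos_eq (Re (Y z))) in Q by lra. exact Q. }
  assert (Him : Rabs (Im (Y z)) <= alpha * (1 + v)).
  { apply Rle_trans with (1 := C2). apply Rmult_le_compat_l; lra. }
  assert (Hyl' : 1 - v <= y) by nra.
  assert (Hfin : Cmod (Y z - 1)%C <= 7 * alpha * q).
  { eapply Rle_trans; [apply Cmod_le_re_im|]. rewrite Re_minus, Im_minus.
    change (Re (RtoC 1)) with 1. change (Im (RtoC 1)) with 0. rewrite Rminus_0_r.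
    assert (Rabs (Re (Y z) - 1) <= v + alpha * (1 + v)) by (apply Rabs_le_between; lra).
    assert (alpha * v <= / 8 * v) by (apply Rmult_le_compat_r; lra).
    assert (alpha * 1 <= alpha * q) by (apply Rmult_le_compat_l; lra). lra. }
  set (u := sqrt (1 - r)). assert (Hu : 0 <= u) by apply sqrt_pos.
  assert (Hqu : q * u <= 2).
  { assert (Hquu : (q * u) * (q * u) = 1 + r).
    { replace (q * u * (q * u)) with (q * q * (u * u)) by ring.
      assert (Huu : u * u = 1 - r) by (apply sqrt_sqrt; lra). rewrite Huu. exact Hqq'. }
    nra. }
  apply Rle_trans with (7 * alpha * q * u); [apply Rmult_le_compat_r; assumption|]. nra.
Qed.

(** Adds the factor [|z|], needed because the rotation quotient yields [w A'(w)] and [w] has to be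
    divided out. Near the origin the factor comes from the Schwarz lemma, elsewhere from
    [|z| >= / 2]. *)
Lemma cone_estimate (Y : C -> C) (kappa : R) :
  0 < kappa <= / 16 ->
  (forall z, Cmod z <= 1 -> cont_within (fun w => Cmod w <= 1) Y z) ->
  (forall z, Cmod z < 1 -> cderivable Y z) ->
  Y 0 = 1 -> (forall z, Cmod z < 1 -> Y z <> 0) ->
  (forall z, Cmod z = 1 -> Rabs (Im (Y z)) <= kappa * Rabs (Re (Y z))) ->
  forall z, Cmod z < 1 -> Cmod (Y z - 1)%C * sqrt (1 - Cmod z) <= 112 * kappa * Cmod z.
Proof.
  intros Hk Hcont Hder H0 Hne Hbd.
  assert (Hcone := cone_of_double_cone Y kappa ltac:(lra) Hcont Hder H0 Hne Hbd).
  assert (B := cone_modulus_bound Y (2 * kappa) ltac:(lra) Hder H0 Hcone).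
  intros z Hz. set (r := Cmod z) in *. assert (Hr : 0 <= r) by apply Cmod_ge_0.
  destruct (Rle_lt_dec (/ 2) r) as [Hr2|Hr2].
  - assert (A := B z Hz). fold r in A. nra.
  - assert (Hs : forall w, Cmod w < / 2 -> / 2 <= sqrt (1 - Cmod w)).
    { intros w Hw. replace (/ 2) with (sqrt (/ 4)).
      - apply sqrt_le_1_alt. lra.
      - replace (/ 4) with (/ 2 * / 2) by field. apply sqrt_square. lra. }
    assert (A : Cmod (Y z - 1)%C * / 2 <= 56 * kappa * Cmod (z - 0)%C).
    { apply (schwarz_lemma (fun w => Y w - 1)%C 0 (/ 2) (56 * kappa)).
      - intros w Hw. rewrite Cminus_0_r in Hw. apply cderivable_minus; [apply Hder; lra|apply cderivable_const].
      - intros w Hw. rewrite Cminus_0_r in Hw. assert (Q := B w ltac:(lra)). assert (Q2 := Hs w Hw).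
         nra.
      - rewrite H0. ring.
      - rewrite Cminus_0_r. exact Hr2. }
    rewrite Cminus_0_r in A. fold r in A.
    assert (Hs1 : sqrt (1 - r) <= 1) by (apply Rle_trans with (sqrt 1); [apply sqrt_le_1_alt; lra|rewrite sqrt_1; lra]).
     assert (Q3 := Cmod_ge_0 (Y z - 1)%C). nra.
Qed.

(** * Boundary regularity of the exterior map *)

Lemma small_rotation_exists (eta : R) :
  eta > 0 -> exists e : C, Cmod e = 1 /\ e <> 1 /\ Cmod (e - 1)%C < eta.
Proof.
  intros He.
  destruct (is_cderiv_cont cexp 0 1 (fun _ => True) is_cderiv_cexp_0 eta He) as [d [Hd H]].
  set (x := Rmin 1 (d / 2)).
  assert (Hx : 0 < x) by (apply Rmin_pos; lra).
  assert (Hx1 : x <= 1) by apply Rmin_l. assert (Hxd : x <= d / 2) by apply Rmin_r.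
  exists (cexp (0, x)).
  assert (E0 : cexp 0 = 1%C) by (apply C_eq; unfold cexp, Re, Im; simpl; rewrite exp_0, ?cos_0, ?sin_0; ring).
  split; [|split].
  - rewrite Cmod_cexp. apply exp_0.
  - intros E. assert (Q : Im (cexp (0, x)) = 0) by (rewrite E; reflexivity).
    unfold cexp in Q. change (exp 0 * sin x = 0) in Q. rewrite exp_0, Rmult_1_l in Q.
    assert (0 < sin x); [|lra]. assert (HP := PI2_1). apply sin_gt_0; lra.
  - rewrite <- E0. apply H; [exact I|]. rewrite Cminus_0_r.
    eapply Rle_lt_trans; [apply Cmod_le_re_im|].
    change (Rabs 0 + Rabs x < d). rewrite Rabs_R0, Rabs_pos_eq; lra.
Qed.

(* Difference quotient of [A] under a rotation; when [A w = w F (1 / w)] it equals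
   [(F (e z) - F z) / ((e - 1) F z)] at [z = 1 / w], a discrete version of [z F' / F]. *)
Definition rotation_quotient (A : C -> C) (e w : C) : C :=
  ((e * A (w / e) / A w - 1) / (e - 1))%C.

Section RotationQuotient.

Variables (A : C -> C) (kappa eta0 : R).
Hypothesis Hk : 0 < kappa <= / 16.
Hypothesis HAc : forall w, Cmod w <= 1 -> cont_within (fun v => Cmod v <= 1) A w.
Hypothesis HAd : forall w, Cmod w < 1 -> cderivable A w.
Hypothesis HAnz : forall w, Cmod w <= 1 -> A w <> 0.
Hypothesis HA2 : forall w, Cmod w < 1 -> Cmod (A w) <= 2.
Hypothesis Heta0 : 0 < eta0.
Hypothesis Hinj : forall e w, Cmod e = 1 -> e <> 1 -> Cmod w < 1 -> (e * A (w / e))%C <> A w.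
Hypothesis Hcone : forall e w, Cmod e = 1 -> e <> 1 -> Cmod (e - 1)%C < eta0 -> Cmod w = 1 ->
  Rabs (Im (rotation_quotient A e w)) <= kappa * Rabs (Re (rotation_quotient A e w)).

Lemma rotation_quotient_estimate (e w : C) :
  Cmod e = 1 -> e <> 1 -> Cmod (e - 1)%C < eta0 -> Cmod w < 1 ->
  Cmod (rotation_quotient A e w - 1)%C * sqrt (1 - Cmod w) <= 112 * kappa * Cmod w.
Proof.
  intros He1 Hne Hee Hw.
  assert (He0 : e <> 0) by (apply Cmod_gt_0; lra).
  assert (Hem : (e - 1)%C <> 0).
  { intros E. apply Hne. replace e with (e - 1 + 1)%C by ring. rewrite E. ring. }
  assert (Hmod : forall v, Cmod (v / e)%C = Cmod v).
  { intros v. rewrite Cmod_div by exact He0. rewrite He1. field. }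
  apply (cone_estimate (rotation_quotient A e) kappa Hk); auto.
  - intros v Hv. unfold rotation_quotient.
    apply cont_within_div; [|apply cont_within_const|exact Hem].
    apply cont_within_minus; [|apply cont_within_const].
    apply cont_within_div; [|auto|auto].
    apply cont_within_mult; [apply cont_within_const|].
    apply (cont_within_comp _ (fun v => Cmod v <= 1) (fun w => w / e)%C A).
    + intros u Hu. rewrite Hmod. exact Hu.
    + apply cont_within_div; [apply cont_within_id|apply cont_within_const|exact He0].
    + apply HAc. rewrite Hmod. exact Hv.
  - intros v Hv. unfold rotation_quotient.
    apply cderivable_div; [|apply cderivable_const|exact Hem].
    apply cderivable_minus; [|apply cderivable_const].
    apply cderivable_div; [|auto|apply HAnz; lra].
    apply cderivable_mult; [apply cderivable_const|].
    apply (cderivable_comp (fun w => w / e)%C A).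
    + apply cderivable_div; [apply cderivable_id|apply cderivable_const|exact He0].
    + apply HAd. rewrite Hmod. exact Hv.
  - unfold rotation_quotient. replace (0 / e)%C with (RtoC 0) by (unfold Cdiv; ring).
    field. split; [|exact Hem]. apply HAnz. rewrite Cmod_0; lra.
  - intros v Hv E. apply (Hinj e v He1 Hne Hv).
    assert (HAv : A v <> 0) by (apply HAnz; lra).
    replace (e * A (v / e)%C)%C with (A v * (rotation_quotient A e v * (e - 1) + 1))%C
      by (unfold rotation_quotient; field; auto).
    rewrite E. ring.
Qed.

(** As [e] tends to 1 the rotation quotient minus 1 tends to [- w A'(w) / A(w)], and its bound does
    not depend on [e]. *)
Lemma derivative_bound_near_circle (w l : C) :
  Cmod w < 1 -> w <> 0 -> is_cderiv A w l -> Cmod l * sqrt (1 - Cmod w) <= 224 * kappa.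
Proof.
  intros Hw Hw0 Hl.
  assert (Hr : 0 < Cmod w) by (apply Cmod_gt_0, Hw0).
  assert (HAw : A w <> 0) by (apply HAnz; lra).
  assert (HAp : 0 < Cmod (A w)) by (apply Cmod_gt_0, HAw).
  assert (B : Cmod l * sqrt (1 - Cmod w) <= 112 * kappa * Cmod (A w)).
  { apply Rle_plus_epsilon. intros eps Heps.
    destruct (Hl eps Heps) as [d [Hd H]].
    destruct (small_rotation_exists (Rmin d eta0)) as [e [He1 [Hne Hee]]]; [apply Rmin_pos; lra|].
    assert (He0 : e <> 0) by (apply Cmod_gt_0; lra).
    assert (Hem : (e - 1)%C <> 0).
    { intros E. apply Hne. replace e with (e - 1 + 1)%C by ring. rewrite E. ring. }
    assert (Hemp : 0 < Cmod (e - 1)%C) by (apply Cmod_gt_0, Hem).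
    assert (E1 := Rlt_min_l Hee). assert (E2 := Rlt_min_r Hee).
    assert (Q := rotation_quotient_estimate e w He1 Hne E2 Hw).
    (* The displacement from [w] to [w / e], of modulus [|w| |e - 1|]; the expansion of [A] at [w]
       with remainder [rem] is used there. *)
    set (k := (w * (1 - e) / e)%C).
    assert (Hkm : Cmod k = Cmod w * Cmod (e - 1)%C).
    { unfold k. rewrite Cmod_div, Cmod_mult, He1, (Cmod_minus_sym 1 e) by exact He0. field. }
    assert (Hkd : Cmod k < d) by (rewrite Hkm; nra).
    specialize (H k Hkd).
    assert (Ewk : (w + k = w / e)%C) by (unfold k; field; exact He0).
    rewrite Ewk in H.
    set (rem := (A (w / e) - A w - l * k)%C) in *.
    assert (Eq : (l * w = rem * e / (e - 1) - A w * (rotation_quotient A e w - 1))%C).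
    { unfold rem, k, rotation_quotient. field. auto. }
    assert (N : Cmod (l * w)%C <= eps * Cmod w + Cmod (A w) * Cmod (rotation_quotient A e w - 1)%C).
    { rewrite Eq. eapply Rle_trans; [apply Cmod_triangle_minus|].
      rewrite Cmod_div by exact Hem. rewrite !Cmod_mult, He1. apply Rplus_le_compat_r.
      apply (Rmult_le_reg_r (Cmod (e - 1)%C)); [exact Hemp|].
      unfold Rdiv. rewrite Rmult_assoc, Rinv_l by lra. rewrite Hkm in H. lra. }
    rewrite Cmod_mult in N.
    set (u := sqrt (1 - Cmod w)) in *. assert (Hu : 0 <= u) by apply sqrt_pos.
    assert (Hu1 : u <= 1) by (apply Rle_trans with (sqrt 1); [apply sqrt_le_1_alt; lra|rewrite sqrt_1; lra]).
    apply (Rmult_le_reg_r (Cmod w)); [exact Hr|].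
    apply Rle_trans with ((eps * Cmod w + Cmod (A w) * Cmod (rotation_quotient A e w - 1)%C) * u).
    - replace (Cmod l * u * Cmod w) with (Cmod l * Cmod w * u) by ring. apply Rmult_le_compat_r; assumption.
    - assert (Cmod (A w) * (Cmod (rotation_quotient A e w - 1)%C * u) <= Cmod (A w) * (112 * kappa * Cmod w))
        by (apply Rmult_le_compat_l; lra).
      assert (eps * Cmod w * u <= eps * Cmod w * 1) by (apply Rmult_le_compat_l; [apply Rmult_le_pos|]; lra).
      lra. }
  assert (Q := HA2 w Hw). nra.
Qed.

(** The bound [224 kappa / sqrt (1 - s)] on the derivative is integrated along the radius, with
    primitive [- 448 kappa sqrt (1 - s)]. Both ends, the circle and the centre, are reached by
    continuity of [A]. *)
Lemma radial_holder (zeta : C) (s : R) :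
  Cmod zeta = 1 -> 0 <= s < 1 -> Cmod (A zeta - A (s * zeta))%C <= 448 * kappa * sqrt (1 - s).
Proof.
  intros Hz.
  assert (B : forall a b, 0 < a -> a <= b -> b < 1 -> Cmod (A (b * zeta) - A (a * zeta))%C <= 448 * kappa * sqrt (1 - a)).
  { intros a b Ha Hab Hb.
    set (v := fun s => - (448 * kappa) * sqrt (1 - s)).
    assert (Hv := segment_mean_value A 0 zeta a b v (fun s => 224 * kappa / sqrt (1 - s)) Hab).
    rewrite !Cplus_0_l in Hv.
    eapply Rle_trans; [apply Hv|].
    - intros u Hu. rewrite Cplus_0_l.
      assert (Hm : Cmod (u * zeta)%C = u) by (rewrite Cmod_mult, Hz, Cmod_R, Rabs_pos_eq; lra).
      destruct (HAd (u * zeta)%C) as [l Hl]; [lra|].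
      exists l. split; [exact Hl|]. rewrite Cmod_mult, Hz, Rmult_1_r.
      assert (Q := derivative_bound_near_circle (u * zeta)%C l ltac:(lra)).
      rewrite Hm in Q. assert (Hsq : 0 < sqrt (1 - u)) by (apply sqrt_lt_R0; lra).
      apply (Rmult_le_reg_r (sqrt (1 - u))); [exact Hsq|].
      unfold Rdiv. rewrite Rmult_assoc, Rinv_l, Rmult_1_r by lra. apply Q; [|exact Hl].
      apply Cmod_gt_0. lra.
    - intros u Hu. unfold v.
      assert (Hsq : 0 < sqrt (1 - u)) by (apply sqrt_lt_R0; lra).
      auto_derive; [lra|]. change (1 + - u) with (1 - u). field. lra.
    - unfold v. assert (Q := sqrt_pos (1 - b)).
      assert (0 <= kappa * sqrt (1 - b)) by (apply Rmult_le_pos; lra). lra. }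
  assert (B1 : forall a, 0 < a < 1 -> Cmod (A zeta - A (a * zeta))%C <= 448 * kappa * sqrt (1 - a)).
  { intros a Ha. apply Rle_plus_epsilon. intros eps He.
    assert (Hz1 : Cmod zeta <= 1) by lra.
    destruct (cont_within_radial A zeta eps (HAc zeta Hz1) Hz1 He) as [x [Hx Hr]].
    set (b := Rmax a x).
    assert (Hb : a <= b < 1) by (split; [apply Rmax_l|apply Rmax_lub_lt; lra]).
    assert (Hb' : x <= b) by apply Rmax_r.
    assert (Q1 := Hr b (conj Hb' (proj2 Hb))).
    assert (Q2 := B a b ltac:(lra) ltac:(lra) ltac:(lra)).
    assert (Q3 := Cmod_triangle_via (A (b * zeta)%C) (A zeta) (A (a * zeta)%C)).
    rewrite (Cmod_minus_sym (A zeta) (A (b * zeta)%C)) in Q3. lra. }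
  intros Hs. destruct (Req_dec s 0) as [->|Hs0]; [|apply B1; lra].
  apply Rle_plus_epsilon. intros eps He.
  destruct (HAc 0 ltac:(rewrite Cmod_0; lra) eps He) as [d [Hd H]].
  set (a := Rmin (/ 2) (d / 2)).
  assert (Ha : 0 < a) by (apply Rmin_pos; lra).
  assert (Ha1 : a <= / 2) by apply Rmin_l. assert (Ha2 : a <= d / 2) by apply Rmin_r.
  assert (Hm : Cmod (a * zeta)%C = a) by (rewrite Cmod_mult, Hz, Cmod_R, Rabs_pos_eq; lra).
  assert (Q1 := H (a * zeta)%C ltac:(lra) ltac:(rewrite Cminus_0_r; lra)).
  assert (Q2 := B1 a ltac:(lra)).
  replace (0 * zeta)%C with (RtoC 0) by ring.
  assert (Q3 := Cmod_triangle_via (A (a * zeta)%C) (A zeta) (A 0)).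
  assert (Q4 : sqrt (1 - a) <= sqrt (1 - 0)) by (apply sqrt_le_1_alt; lra).
  assert (448 * kappa * sqrt (1 - a) <= 448 * kappa * sqrt (1 - 0)) by (apply Rmult_le_compat_l; lra).
  lra.
Qed.

End RotationQuotient.

Lemma uniformly_continuous_closed_disk (A : C -> C) (eps : R) :
  (forall w, Cmod w <= 1 -> cont_within (fun v => Cmod v <= 1) A w) -> eps > 0 ->
  exists delta, delta > 0 /\ forall z w, Cmod z <= 1 -> Cmod w <= 1 -> Cmod (z - w)%C < delta ->
    Cmod (A z - A w)%C < eps.
Proof.
  intros Hc He. apply NNPP; intros Hn.
  assert (Hs : forall n : nat, exists zw : C * C, Cmod (fst zw) <= 1 /\ Cmod (snd zw) <= 1 /\
     Cmod (fst zw - snd zw)%C < / (INR n + 1) /\ eps <= Cmod (A (fst zw) - A (snd zw))%C).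
  { intros n. apply NNPP; intros Hn'. apply Hn.
    assert (Hk : 0 < / (INR n + 1)) by (apply Rinv_0_lt_compat; generalize (pos_INR n); lra).
    exists (/ (INR n + 1)). split; [exact Hk|]. intros z w Hz Hw Hzw.
    apply Rnot_le_lt; intros Hle. apply Hn'. exists (z, w). auto. }
  destruct (choice _ Hs) as [u Hu].
  destruct (C_cluster_point (fun n => fst (u n)) 1) as [z0 [Hz0 Hcl]]; [intros n; apply Hu|].
  destruct (Hc z0 Hz0 (eps / 2)) as [d [Hd Hd']]; [lra|].
  destruct (nfloor_ex (/ (d / 2))) as [N [_ HN]]; [apply Rlt_le, Rinv_0_lt_compat; lra|].
  destruct (Hcl (d / 2) N) as [n [Hn' Hz]]; [lra|].
  destruct (Hu n) as [U1 [U2 [U3 U4]]].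
  assert (Hsd : Cmod (fst (u n) - snd (u n))%C < d / 2).
  { eapply Rlt_le_trans; [exact U3|]. rewrite <- (Rinv_inv (d / 2)).
    apply Rinv_le_contravar; [apply Rinv_0_lt_compat; lra|]. apply le_INR in Hn'. lra. }
  assert (A1 := Hd' (fst (u n)) U1 ltac:(lra)).
  assert (T := Cmod_triangle_via (fst (u n)) (snd (u n)) z0). rewrite (Cmod_minus_sym (snd (u n)) (fst (u n))) in T.
  assert (A2 := Hd' (snd (u n)) U2 ltac:(lra)).
  assert (T2 := Cmod_triangle_via (A z0) (A (fst (u n))) (A (snd (u n)))).
  rewrite (Cmod_minus_sym (A z0)) in T2. lra.
Qed.

(** Near 1 the circle is almost vertical, so [g - 1] is nearly [i Im g]. A quotient of two such
    chords is then real up to a factor close to 1. *)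
Lemma unimodular_chord (g : C) :
  Cmod g = 1 -> g <> 1 -> Cmod (g - 1)%C <= / 2 ->
  Im g <> 0 /\ Cmod ((g - 1) / (Ci * Im g) - 1)%C <= Cmod (g - 1)%C.
Proof.
  intros Hg Hne Hs.
  assert (H1 := Cmod2_alt g). rewrite Hg in H1.
  assert (H2 := re_le_Cmod (g - 1)%C). rewrite Re_minus in H2. change (Re (RtoC 1)) with 1 in H2.
  assert (H3 := im_le_Cmod (g - 1)%C). rewrite Im_minus in H3. change (Im (RtoC 1)) with 0 in H3.
  rewrite Rminus_0_r in H3.
  set (c := Re g) in *. set (s := Im g) in *.
  assert (Hc : / 2 <= c) by (apply Rabs_le_between in H2; lra).
  assert (Hs0 : s <> 0).
  { intros E. apply Hne. apply C_eq; [|exact E]. change (c = 1). rewrite E in H1. nra. }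
  split; [exact Hs0|].
  assert (HC : (Ci * s)%C <> 0).
  { apply Cmult_neq_0.
    - intros E. assert (Q : Im Ci = 0) by (rewrite E; reflexivity). simpl in Q. lra.
    - intros E. apply Hs0. injection E. auto. }
  replace ((g - 1) / (Ci * s) - 1)%C with ((g - 1 - Ci * s) / (Ci * s))%C by (field; split;
    [intros E; apply Hs0; injection E; auto|intros E; assert (Q : Im Ci = 0) by (rewrite E; reflexivity); simpl in Q; lra]).
  replace (g - 1 - Ci * s)%C with (RtoC (c - 1)).
  2: { apply C_eq; rewrite ?Re_minus, ?Im_minus, ?Re_mult, ?Im_mult; fold c; fold s; unfold Ci, Re, Im; simpl; ring. }
  rewrite Cmod_div by exact HC. rewrite Cmod_mult, Cmod_Ci, !Cmod_R, Rmult_1_l.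
  assert (Ps : 0 < Rabs s) by (apply Rabs_pos_lt, Hs0).
  apply Rle_trans with (Rabs s); [|exact H3].
  apply (Rmult_le_reg_r (Rabs s)); [exact Ps|].
  unfold Rdiv. rewrite Rmult_assoc, Rinv_l, Rmult_1_r by lra.
  rewrite <- Rabs_mult, (Rabs_pos_eq (s * s)) by apply Rle_0_sqr.
  apply Rabs_le_between. nra.
Qed.

Lemma quotient_near_one (p1 p2 p3 p4 : C) (d : R) :
  0 <= d <= / 20 ->
  Cmod (p1 - 1)%C <= d -> Cmod (p2 - 1)%C <= d -> Cmod (p3 - 1)%C <= d -> Cmod (p4 - 1)%C <= d ->
  Rabs (Im (p1 * p3 / (p2 * p4))%C) <= 20 * d * Re (p1 * p3 / (p2 * p4))%C.
Proof.
  intros Hd H1 H2 H3 H4.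
  assert (Hn : forall q, Cmod (q - 1)%C <= d -> 1 - d <= Cmod q /\ Cmod q <= 1 + d).
  { intros q Hq. assert (A := Cmod_minus_ge 1 q). assert (B := Cmod_minus_ge q 1).
    rewrite (Cmod_minus_sym 1 q) in A. rewrite Cmod_1 in *. lra. }
  destruct (Hn p2 H2) as [L2 U2]. destruct (Hn p4 H4) as [L4 U4].
  assert (N2 : p2 <> 0) by (apply Cmod_gt_0; lra). assert (N4 : p4 <> 0) by (apply Cmod_gt_0; lra).
  set (N := (p1 * p3 / (p2 * p4))%C).
  assert (HN : Cmod (N - 1)%C <= 10 * d).
  { replace (N - 1)%C with (((p1 - 1) * (p3 - 1) + ((p1 - 1) + (p3 - 1)) - ((p2 - 1) * (p4 - 1) + ((p2 - 1) + (p4 - 1)))) / (p2 * p4))%C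
      by (unfold N; field; auto).
    rewrite Cmod_div by (apply Cmult_neq_0; auto). rewrite (Cmod_mult p2 p4).
    apply (Rmult_le_reg_r (Cmod p2 * Cmod p4)); [nra|].
    unfold Rdiv. rewrite Rmult_assoc, Rinv_l by nra. rewrite Rmult_1_r.
    eapply Rle_trans; [apply Cmod_triangle_minus|].
    assert (T1 := Cmod_triangle ((p1 - 1) * (p3 - 1))%C ((p1 - 1) + (p3 - 1))%C).
    assert (T2 := Cmod_triangle (p1 - 1)%C (p3 - 1)%C).
    assert (T3 := Cmod_triangle ((p2 - 1) * (p4 - 1))%C ((p2 - 1) + (p4 - 1))%C).
    assert (T4 := Cmod_triangle (p2 - 1)%C (p4 - 1)%C).
    rewrite Cmod_mult in T1, T3.
    assert (M1 : Cmod (p1 - 1)%C * Cmod (p3 - 1)%C <= d * d) by (apply Rmult_le_compat; try apply Cmod_ge_0; assumption).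
    assert (M2 : Cmod (p2 - 1)%C * Cmod (p4 - 1)%C <= d * d) by (apply Rmult_le_compat; try apply Cmod_ge_0; assumption).
    assert (M3 : (1 - d) * (1 - d) <= Cmod p2 * Cmod p4) by (apply Rmult_le_compat; lra).
    nra. }
  assert (A1 := re_le_Cmod (N - 1)%C). assert (A2 := im_le_Cmod (N - 1)%C).
  rewrite Re_minus in A1. rewrite Im_minus in A2. change (Re (RtoC 1)) with 1 in A1. change (Im (RtoC 1)) with 0 in A2.
  rewrite Rminus_0_r in A2. apply Rabs_le_between in A1.
  apply Rle_trans with (10 * d); [lra|]. nra.
Qed.

(* On the circle [A zeta = zeta * f omega] parametrises the curve [f(T)], which is a
   small Lipschitz perturbation of the circle. *)
Lemma rotation_quotient_cone (A f : C -> C) (d : R) :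
  0 < d <= / 20 ->
  (forall w, Cmod w <= 1 -> cont_within (fun v => Cmod v <= 1) A w) ->
  (forall z w, Cmod z <= 1 -> Cmod w <= 1 -> Cmod (f z - f w - (z - w))%C <= d * Cmod (z - w)%C) ->
  f 0 = 0 ->
  (forall zeta, Cmod zeta = 1 -> exists omega, Cmod omega = 1 /\ A zeta = (zeta * f omega)%C) ->
  exists eta0, 0 < eta0 /\ forall e w, Cmod e = 1 -> e <> 1 -> Cmod (e - 1)%C < eta0 -> Cmod w = 1 ->
    Rabs (Im (rotation_quotient A e w)) <= 20 * d * Rabs (Re (rotation_quotient A e w)).
Proof.
  intros Hd HAc Hf Hf0 Hbd.
  assert (Hf1 : forall o, Cmod o = 1 -> Cmod (f o - o)%C <= d).
  { intros o Ho. assert (Q := Hf o 0 ltac:(lra) ltac:(rewrite Cmod_0; lra)).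
    rewrite Hf0, !Cminus_0_r, Ho in Q. lra. }
  assert (HA2 : forall z, Cmod z = 1 -> Cmod (A z) <= 2).
  { intros z Hz. destruct (Hbd z Hz) as [o [Ho E]]. rewrite E, Cmod_mult, Hz.
    assert (Q := Cmod_minus_ge (f o) o). specialize (Hf1 o Ho). lra. }
  destruct (uniformly_continuous_closed_disk A (d / 4) HAc ltac:(lra)) as [eta [Heta Huc]].
  exists (Rmin eta (d / 8)). split; [apply Rmin_pos; lra|].
  intros e w He1 Hne Hee Hw.
  assert (E1 := Rlt_min_l Hee). assert (E2 := Rlt_min_r Hee).
  assert (He0 : e <> 0) by (apply Cmod_gt_0; lra).
  assert (Hw0 : w <> 0) by (apply Cmod_gt_0; lra).
  assert (Hem : (e - 1)%C <> 0).
  { intros E. apply Hne. replace e with (e - 1 + 1)%C by ring. rewrite E. ring. }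
  assert (Hwe : Cmod (w / e)%C = 1) by (rewrite Cmod_div, Hw, He1 by exact He0; field).
  destruct (Hbd w Hw) as [o [Ho Ew]]. destruct (Hbd (w / e)%C Hwe) as [o' [Ho' Ew']].
  assert (Fo := Hf1 o Ho).
  assert (Hfo : 1 - d <= Cmod (f o)).
  { assert (Q := Cmod_minus_ge o (f o)). rewrite Cmod_minus_sym in Q. lra. }
  assert (Hfo0 : f o <> 0) by (apply Cmod_gt_0; lra).
  assert (Ho0 : o <> 0) by (apply Cmod_gt_0; lra).
  assert (EY : rotation_quotient A e w = ((f o' - f o) / ((e - 1) * f o))%C).
  { unfold rotation_quotient. rewrite Ew, Ew'. field. auto. }
  (* Coinciding parameters give the quotient 0, the apex of the double cone. *)
  rewrite EY. destruct (Ceq_dec o' o) as [->|Hoo].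
  { replace ((f o - f o) / ((e - 1) * f o))%C with (RtoC 0) by (field; auto).
    simpl. rewrite Rabs_R0. lra. }
  assert (Hdiff : Cmod (f o' - f o)%C <= d / 2).
  { replace (f o' - f o)%C with ((e * (A (w / e) - A w) + (e - 1) * A w) / w)%C
      by (rewrite Ew', Ew; field; auto).
    rewrite Cmod_div, Hw by exact Hw0. replace (Cmod (e * (A (w / e) - A w) + (e - 1) * A w)%C / 1)
      with (Cmod (e * (A (w / e) - A w) + (e - 1) * A w)%C) by field.
    eapply Rle_trans; [apply Cmod_triangle|]. rewrite !Cmod_mult, He1.
    assert (Q1 := Huc (w / e)%C w ltac:(lra) ltac:(lra)).
    assert (Q2 : Cmod (w / e - w)%C = Cmod (e - 1)%C).
    { replace (w / e - w)%C with (w / e * (1 - e))%C by (field; exact He0).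
      rewrite Cmod_mult, Hwe, (Cmod_minus_sym 1 e). ring. }
    rewrite Q2 in Q1. specialize (Q1 E1). specialize (HA2 w Hw).
     assert (P2 := Cmod_ge_0 (A w)). nra. }
  set (g := (o' / o)%C).
  assert (Hg : Cmod g = 1) by (unfold g; rewrite Cmod_div, Ho, Ho' by exact Ho0; field).
  assert (Hg1 : g <> 1).
  { intros E. apply Hoo. replace o' with (g * o)%C by (unfold g; field; exact Ho0). rewrite E. ring. }
  assert (Hoo' : (o' - o)%C <> 0).
  { intros E. apply Hoo. replace o' with (o' - o + o)%C by ring. rewrite E. ring. }
  assert (Hoop : 0 < Cmod (o' - o)%C) by (apply Cmod_gt_0, Hoo').
  assert (Q := Hf o' o ltac:(lra) ltac:(lra)).
  assert (Hgd : Cmod (g - 1)%C <= d).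
  { replace (g - 1)%C with ((o' - o) / o)%C by (unfold g; field; exact Ho0).
    rewrite Cmod_div, Ho by exact Ho0.
    assert (Q1 := Cmod_minus_ge (o' - o)%C (f o' - f o)%C). rewrite (Cmod_minus_sym (o' - o)) in Q1.
    assert (Cmod (o' - o)%C <= d) by nra. lra. }
  destruct (unimodular_chord g Hg Hg1 ltac:(lra)) as [Sg Cg].
  destruct (unimodular_chord e He1 Hne ltac:(lra)) as [Se Ce].
  assert (HCi : Ci <> 0) by (intros E; assert (Q' : Im Ci = 0) by (rewrite E; reflexivity); simpl in Q'; lra).
  assert (Sg' : RtoC (Im g) <> 0) by (intros E; apply Sg; injection E; auto).
  assert (Se' : RtoC (Im e) <> 0) by (intros E; apply Se; injection E; auto).
  set (p1 := ((f o' - f o) / (o' - o))%C). set (p2 := (f o / o)%C).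
  set (p3 := ((g - 1) / (Ci * Im g))%C) in *. set (p4 := ((e - 1) / (Ci * Im e))%C) in *.
  (* A real factor of unknown sign times a factor close to 1: the values lie in a double cone, and
     nothing here selects one half. *)
  assert (EY2 : ((f o' - f o) / ((e - 1) * f o) = RtoC (Im g / Im e) * (p1 * p3 / (p2 * p4)))%C).
  { rewrite RtoC_div by exact Se. unfold p1, p2, p3, p4.
    replace (g - 1)%C with ((o' - o) / o)%C by (unfold g; field; exact Ho0).
    field. repeat split; auto. }
  rewrite EY2.
  assert (HN : Rabs (Im (p1 * p3 / (p2 * p4))%C) <= 20 * d * Re (p1 * p3 / (p2 * p4))%C).
  { apply quotient_near_one; [lra| | |lra|lra].
    - unfold p1. replace ((f o' - f o) / (o' - o) - 1)%C with ((f o' - f o - (o' - o)) / (o' - o))%C by (field; exact Hoo').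
      rewrite Cmod_div by exact Hoo'. apply (Rmult_le_reg_r (Cmod (o' - o)%C)); [exact Hoop|].
      unfold Rdiv. rewrite Rmult_assoc, Rinv_l by lra. lra.
    - unfold p2. replace (f o / o - 1)%C with ((f o - o) / o)%C by (field; exact Ho0).
      rewrite Cmod_div, Ho by exact Ho0. lra. }
  rewrite Re_mult, Im_mult. change (Re (RtoC (Im g / Im e))) with (Im g / Im e).
  change (Im (RtoC (Im g / Im e))) with 0.
  rewrite !Rmult_0_l, Rplus_0_r, Rminus_0_r, !Rabs_mult.
  assert (P := Rabs_pos (Im g / Im e)). assert (P2 := Rle_abs (Re (p1 * p3 / (p2 * p4))%C)).
  rewrite <- Rmult_assoc, (Rmult_comm (20 * d)), Rmult_assoc.
  apply Rmult_le_compat_l; [exact P|]. apply Rle_trans with (1 := HN).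
  apply Rmult_le_compat_l; lra.
Qed.

(** * The image domain *)

(** If [w] near [f z0] were omitted, [1 / (f - w)] would be holomorphic and larger at [z0] than on
    the circle of radius [rho], where [|f z - w| >= rho - rho / 2 - rho / 4]. *)
Lemma near_identity_open (f : C -> C) (d : R) (z0 : C) :
  d <= / 2 -> (forall z, Cmod z < 1 -> cderivable f z) ->
  (forall z w, Cmod z < 1 -> Cmod w < 1 -> Cmod (f z - f w - (z - w))%C <= d * Cmod (z - w)%C) ->
  Cmod z0 < 1 ->
  exists eps, eps > 0 /\ forall w, Cmod (w - f z0)%C < eps -> exists z, Cmod z < 1 /\ f z = w.
Proof.
  intros Hd Hder Hf Hz0.
  set (rho := (1 - Cmod z0) / 2). assert (Hrho : 0 < rho) by (unfold rho; lra).
  assert (Hin : forall z, Cmod (z - z0)%C <= rho -> Cmod z < 1).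
  { intros z Hz. assert (Q := Cmod_minus_ge z z0). unfold rho in *. lra. }
  exists (rho / 4). split; [lra|]. intros w Hw. apply NNPP; intros Hn.
  assert (Hnz : forall z, Cmod (z - z0)%C <= rho -> (f z - w)%C <> 0).
  { intros z Hz E. apply Hn. exists z. split; [apply Hin, Hz|].
    replace (f z) with (f z - w + w)%C by ring. rewrite E. ring. }
  assert (A : Cmod (/ (f z0 - w))%C <= 4 / rho).
  { apply (max_modulus (fun z => / (f z - w))%C z0 rho (4 / rho) Hrho).
    - intros z Hz. apply cderivable_cont. apply cderivable_inv; [|auto].
      apply cderivable_minus; [apply Hder, Hin, Hz|apply cderivable_const].
    - intros z Hz. apply cderivable_inv; [|apply Hnz; lra].
      apply cderivable_minus; [apply Hder, Hin; lra|apply cderivable_const].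
    - intros z Hz. assert (P := Hnz z ltac:(lra)). rewrite Cmod_inv by exact P. apply Cmod_gt_0 in P.
      replace (4 / rho) with (/ (rho / 4)) by (field; lra). apply Rinv_le_contravar; [lra|].
      assert (Q1 := Hf z z0 (Hin z ltac:(lra)) Hz0). rewrite Hz in Q1.
      assert (Q2 := Cmod_minus_ge (z - z0)%C (f z - f z0)%C). rewrite (Cmod_minus_sym (z - z0)), Hz in Q2.
      assert (Q3 := Cmod_triangle_via w (f z) (f z0)). nra.
    - replace (z0 - z0)%C with (RtoC 0) by ring. rewrite Cmod_0; lra. }
  assert (P := Hnz z0 ltac:(replace (z0 - z0)%C with (RtoC 0) by ring; rewrite Cmod_0; lra)).
  rewrite Cmod_inv in A by exact P. apply Cmod_gt_0 in P.
  rewrite Cmod_minus_sym in Hw.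
  apply (Rmult_le_compat_r (rho * Cmod (f z0 - w)%C)) in A; [|nra].
  replace (/ Cmod (f z0 - w)%C * (rho * Cmod (f z0 - w)%C)) with rho in A by (field; lra).
  replace (4 / rho * (rho * Cmod (f z0 - w)%C)) with (4 * Cmod (f z0 - w)%C) in A by (field; lra). lra.
Qed.

(** A path from [0 = f 0] to modulus 3 has to leave the image, which lies in [|w| < 2]. As the image
    is open, the first exit point is a boundary point. The lemma serves to show that [F] has no
    zero. *)
Lemma zero_not_in_unbounded_component (f : C -> C) (d : R) :
  d <= / 2 -> (forall z, Cmod z < 1 -> cderivable f z) ->
  (forall z w, Cmod z < 1 -> Cmod w < 1 -> Cmod (f z - f w - (z - w))%C <= d * Cmod (z - w)%C) ->
  f 0 = 0 ->
  ~ Defs.unbounded_component (Defs.boundary_image_disk f) (RtoC 0).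
Proof.
  intros Hd Hder Hf Hf0 [_ HU].
  assert (Hbd : forall z, Cmod z < 1 -> Cmod (f z) < 2).
  { intros z Hz. assert (Q := Hf z 0 Hz ltac:(rewrite Cmod_0; lra)).
    rewrite Hf0, !Cminus_0_r in Q. assert (Q2 := Cmod_minus_ge (f z) z).
    assert (P := Cmod_ge_0 z). nra. }
  destruct (HU 3) as [gam [Hcont [H0 [H1 Hav]]]].
  (* Parameters up to which the whole path stays in the image; the supremum [m] is the exit time. *)
  set (S := fun s => 0 <= s <= 1 /\ forall s', 0 <= s' <= s -> exists z, Cmod z < 1 /\ f z = gam s').
  assert (S0 : S 0).
  { split; [lra|]. intros s' Hs'. replace s' with 0 by lra. exists (RtoC 0).
    rewrite Cmod_0, Hf0, H0. split; [lra|reflexivity]. }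
  destruct (completeness S) as [m [M1 M2]].
  { exists 1. intros s [Hs _]; lra. }
  { exists 0; exact S0. }
  assert (Hm : 0 <= m <= 1).
  { split; [apply M1, S0|]. apply M2. intros s [Hs _]; lra. }
  assert (Hbelow : forall s', 0 <= s' < m -> exists z, Cmod z < 1 /\ f z = gam s').
  { intros s' Hs'. apply NNPP; intros Hn.
    assert (m <= s'); [|lra]. apply M2. intros s [Hs Hs2]. apply Rnot_lt_le; intros Hlt.
    apply Hn, Hs2; lra. }
  destruct (classic (exists z, Cmod z < 1 /\ f z = gam m)) as [[z [Hz Ez]]|Hno].
  - destruct (near_identity_open f d z Hd Hder Hf Hz) as [eps [He Hop]].
    destruct (Hcont m Hm eps He) as [dl [Hdl Hc]].
    destruct (Req_dec m 1) as [Em|Em].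
    + rewrite Em in Ez. specialize (Hbd z Hz). rewrite Ez in Hbd.
      change (Cmod (gam 1) >= 3) in H1. lra.
    + set (s1 := Rmin 1 (m + dl / 2)).
      assert (Hs1 : m < s1) by (apply Rmin_glb_lt; lra).
      assert (Hs1' : s1 <= 1) by apply Rmin_l. assert (Hs1d : s1 <= m + dl / 2) by apply Rmin_r.
      assert (s1 <= m); [|lra]. apply M1. split; [lra|]. intros s' Hs'.
      destruct (Rlt_le_dec s' m) as [Hlt|Hle]; [apply Hbelow; lra|].
      apply Hop. rewrite Ez. apply (Hc s' ltac:(lra)). apply Rabs_def1; lra.
  - apply (Hav m Hm). split.
    + intros eps He. destruct (Hcont m Hm eps He) as [dl [Hdl Hc]].
      assert (Hm0 : 0 < m).
      { destruct Hm as [[Hm|Hm] _]; [exact Hm|]. exfalso. apply Hno. rewrite <- Hm.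
        exists (RtoC 0). rewrite Cmod_0, Hf0, H0. split; [lra|reflexivity]. }
      set (s' := Rmax 0 (m - dl / 2)).
      assert (Hs1 : 0 <= s') by apply Rmax_l. assert (Hs2 : m - dl / 2 <= s') by apply Rmax_r.
      assert (Hs3 : s' < m) by (apply Rmax_lub_lt; lra).
      destruct (Hbelow s' ltac:(lra)) as [z [Hz Ez]]. exists z. split; [exact Hz|].
      rewrite Ez. apply (Hc s' ltac:(lra)). apply Rabs_def1; lra.
    + intros [z [Hz Ez]]. apply Hno. exists z. split; [exact Hz|exact Ez].
Qed.

(** * The welding estimate *)

Lemma is_cderiv_conj_conj (g : C -> C) (z l : C) :
  is_cderiv g (Cconj z) l -> is_cderiv (fun w => Cconj (g (Cconj w))) z (Cconj l).
Proof.
  intros H eps He. destruct (H eps He) as [d [Hd Hh]]. exists d. split; [exact Hd|].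
  intros h Hhd. specialize (Hh (Cconj h)). rewrite Cmod_conj in Hh. specialize (Hh Hhd).
  rewrite <- Cmod_conj.
  replace (Cconj (Cconj (g (Cconj (z + h))) - Cconj (g (Cconj z)) - Cconj l * h)%C)
    with (g (Cconj z + Cconj h) - g (Cconj z) - l * Cconj h)%C; [exact Hh|].
  rewrite <- Cplus_conj. apply C_eq; unfold Cconj, Re, Im; simpl; ring.
Qed.

Lemma lipschitz_cont_within (S : C -> Prop) (g : C -> C) (K : R) (z : C) :
  0 <= K -> S z -> (forall w v, S w -> S v -> Cmod (g w - g v)%C <= K * Cmod (w - v)%C) -> cont_within S g z.
Proof.
  intros HK Sz H eps He. exists (eps / (K + 1)). split; [apply Rdiv_lt_0_compat; lra|].
  intros w Sw Hw. specialize (H w z Sw Sz).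
  apply (Rmult_lt_compat_r (K + 1)) in Hw; [|lra].
  replace (eps / (K + 1) * (K + 1)) with eps in Hw by (field; lra).
   nra.
Qed.

Lemma sin_minus_id (x : R) : Rabs (x - sin x) <= x * x.
Proof.
  assert (Hcos : forall c, Rabs (1 - cos c) <= Rabs c).
  { intros c. destruct (MVT_abs cos (fun y => - sin y) 0 c) as [u [E _]].
    { intros u _. apply derivable_pt_lim_cos. }
    rewrite cos_0, Rminus_0_r in E. rewrite Rabs_minus_sym, E, Rabs_Ropp.
    assert (Q : Rabs (sin u) <= 1) by (apply Rabs_le, SIN_bound). assert (P := Rabs_pos c). nra. }
  destruct (MVT_abs (fun y => y - sin y) (fun y => 1 - cos y) 0 x) as [c [E Hc]].
  { intros c _. apply (derivable_pt_lim_minus (fun y => y) sin); [apply derivable_pt_lim_id|apply derivable_pt_lim_sin]. }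
  rewrite sin_0, !Rminus_0_r in E. rewrite E.
  assert (Hcx : Rabs c <= Rabs x).
  { unfold Rmin, Rmax in Hc. destruct (Rle_dec 0 x); apply Rabs_le_between;
      [rewrite Rabs_pos_eq by lra|rewrite Rabs_left by lra]; lra. }
  specialize (Hcos c). assert (P := Rabs_pos x).
  replace (x * x) with (Rabs x * Rabs x) by (rewrite <- Rabs_mult; apply Rabs_pos_eq, Rle_0_sqr).
  apply Rmult_le_compat_r; lra.
Qed.

Definition cis (x : R) : C := (cos x, sin x).

Lemma Cmod_cis (x : R) : Cmod (cis x) = 1.
Proof.
  unfold cis, Cmod; simpl fst; simpl snd. assert (H := sin2_cos2 x). unfold Rsqr in H.
  replace (cos x ^ 2 + sin x ^ 2) with 1 by (rewrite <- H; ring). apply sqrt_1.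
Qed.

Lemma Cconj_cis_mult (x y : R) : (Cconj (cis x) * cis y)%C = cis (y - x).
Proof.
  apply C_eq; unfold cis, Cconj, Re, Im; simpl; rewrite ?cos_minus, ?sin_minus; ring.
Qed.

Lemma Cmult_conj_unimodular (z : C) : Cmod z = 1 -> (z * Cconj z = 1)%C.
Proof. intros H. rewrite <- Cmod2_conj, H. rewrite pow1. reflexivity. Qed.

Section Welding.

Variables (A f p0 : C -> C) (t L M e1 a0 : R).
Hypothesis Ht : 0 < t.
Hypothesis HL : 0 < L.
Hypothesis HM : 0 <= M.
Hypothesis He1 : 0 <= e1 <= 1.
Hypothesis Hsmall : 2 * L * t <= / 320.
Hypothesis HAc : forall w, Cmod w <= 1 -> cont_within (fun v => Cmod v <= 1) A w.
Hypothesis HAd : forall w, Cmod w < 1 -> cderivable A w.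
Hypothesis HAnz : forall w, Cmod w < 1 -> A w <> 0.
Hypothesis Hinj : forall e w, Cmod e = 1 -> e <> 1 -> Cmod w < 1 -> (e * A (w / e))%C <> A w.
Hypothesis HA0 : A 0 = RtoC a0.
Hypothesis Ha0 : 0 < a0.
Hypothesis Hf : forall z w, Cmod z <= 1 -> Cmod w <= 1 ->
  Cmod (f z - f w - (z - w))%C <= 2 * L * t * Cmod (z - w)%C.
Hypothesis Hf0 : f 0 = 0.
Hypothesis Hexp : forall z, Cmod z <= 1 -> Cmod (f z - (z - t * (z * p0 z)))%C <= e1 * t.
Hypothesis Hp0M : forall z, Cmod z <= 1 -> Cmod (p0 z) <= M.
Hypothesis Hp0L : forall z w, Cmod z <= 1 -> Cmod w <= 1 -> Cmod (p0 z - p0 w)%C <= M * Cmod (z - w)%C.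
Hypothesis Hp0d : forall z, Cmod z < 1 -> cderivable p0 z.
Hypothesis Hp00 : p0 0 = 1.
Hypothesis Hbd : forall zeta, Cmod zeta = 1 -> exists omega, Cmod omega = 1 /\ A zeta = (zeta * f omega)%C.

Let d := 2 * L * t.
(** [Q t] bounds the displacement of the welding: [17922 L t = 8961 d] bounds [|A - 1|] on the
    circle, and [(M + 1) t] bounds [|f o - o|]. *)
Let Q := 17922 * L + M + 1.

(** The threshold makes the opening [20 * d] at most [/ 16], as the cone estimate demands. *)
Let Hd : 0 < d <= / 320.
Proof. split; [unfold d; apply Rmult_lt_0_compat; lra|exact Hsmall]. Qed.

Let HQ : 1 <= Q.
Proof. unfold Q; lra. Qed.

Let f_near_id (o : C) : Cmod o = 1 -> Cmod (f o - o)%C <= d.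
Proof.
  intros Ho. assert (q := Hf o 0 ltac:(lra) ltac:(rewrite Cmod_0; lra)).
  rewrite Hf0, !Cminus_0_r, Ho in q. unfold d. lra.
Qed.

Let A_circle (zeta : C) : Cmod zeta = 1 -> 1 - d <= Cmod (A zeta) <= 1 + d.
Proof.
  intros Hz. destruct (Hbd zeta Hz) as [o [Ho E]]. rewrite E, Cmod_mult, Hz, Rmult_1_l.
  assert (q := f_near_id o Ho). assert (q1 := Cmod_minus_ge (f o) o).
  assert (q2 := Cmod_minus_ge o (f o)). rewrite (Cmod_minus_sym o) in q2. lra.
Qed.

Let A_nonzero (w : C) : Cmod w <= 1 -> A w <> 0.
Proof.
  intros [Hw|Hw]; [auto|]. apply Cmod_gt_0. assert (q := A_circle w Hw). lra.
Qed.

Let A_upper (w : C) : Cmod w <= 1 -> Cmod (A w) <= 1 + d.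
Proof.
  intros Hw. apply (max_modulus A 0 1 (1 + d)); [lra| | | |rewrite Cminus_0_r; exact Hw].
  - intros z Hz. rewrite Cminus_0_r in Hz.
    apply (cont_within_subset _ (fun w => Cmod w <= 1)); [intros v; rewrite Cminus_0_r; auto|auto].
  - intros z Hz. rewrite Cminus_0_r in Hz. apply HAd; lra.
  - intros z Hz. rewrite Cminus_0_r in Hz. apply A_circle, Hz.
Qed.

(** The maximum principle for [A] and for [1 / A] carries the bounds on the circle to the centre. *)
Let A_center : Rabs (a0 - 1) <= d.
Proof.
  assert (H1 := A_upper 0 ltac:(rewrite Cmod_0; lra)).
  assert (H2 : Cmod (/ A 0)%C <= / (1 - d)).
  { apply (max_modulus (fun w => / A w)%C 0 1 (/ (1 - d))); [lra| | | |rewrite Cminus_0_r, Cmod_0; lra].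
    - intros z Hz. rewrite Cminus_0_r in Hz.
      apply (cont_within_subset _ (fun w => Cmod w <= 1)); [intros v; rewrite Cminus_0_r; auto|].
      apply cont_within_inv; auto.
    - intros z Hz. rewrite Cminus_0_r in Hz. apply cderivable_inv; [apply HAd|apply HAnz]; lra.
    - intros z Hz. rewrite Cminus_0_r in Hz.
      rewrite Cmod_inv by (apply A_nonzero; lra). assert (q := A_circle z Hz).
      apply Rinv_le_contravar; lra. }
  assert (N0 : A 0 <> 0) by (apply A_nonzero; rewrite Cmod_0; lra).
  rewrite Cmod_inv in H2 by exact N0. rewrite HA0, Cmod_R, Rabs_pos_eq in * by lra.
  assert (H3 : 1 - d <= a0).
  { apply Rnot_lt_le; intros Hlt. assert (/ (1 - d) < / a0); [|lra].
    apply Rinv_lt_contravar; [|lra]. apply Rmult_lt_0_compat; lra. }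
  apply Rabs_le_between; lra.
Qed.

Let A_radial (zeta : C) (s : R) :
  Cmod zeta = 1 -> 0 <= s < 1 -> Cmod (A zeta - A (s * zeta))%C <= 8960 * d * sqrt (1 - s).
Proof.
  intros Hz Hs.
  destruct (rotation_quotient_cone A f d ltac:(lra) HAc Hf Hf0 Hbd) as [eta0 [Heta Hcone]].
  replace (8960 * d) with (448 * (20 * d)) by ring.
  apply (radial_holder A (20 * d) eta0); auto; try lra.
  intros w Hw. assert (q := A_upper w ltac:(lra)). lra.
Qed.

Let A_near_one (zeta : C) : Cmod zeta = 1 -> Cmod (A zeta - 1)%C <= 8961 * d.
Proof.
  intros Hz. assert (q := A_radial zeta 0 Hz ltac:(lra)).
  rewrite Rminus_0_r, sqrt_1 in q. replace (0 * zeta)%C with (RtoC 0) in q by ring.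
  assert (q2 := Cmod_triangle_via (A 0) (A zeta) 1).
  assert (q3 : Cmod (A 0 - 1)%C <= d).
  { rewrite HA0, <- RtoC_minus, Cmod_R. apply A_center. }
  lra.
Qed.

Let f_linear (o : C) : Cmod o = 1 -> Cmod (f o - o)%C <= (M + e1) * t.
Proof.
  intros Ho. assert (q := Hexp o ltac:(lra)).
  replace (f o - o)%C with ((f o - (o - t * (o * p0 o))) - t * (o * p0 o))%C by ring.
  eapply Rle_trans; [apply Cmod_triangle_minus|].
  rewrite !Cmod_mult, Ho, Cmod_R, Rabs_pos_eq by lra.
  assert (q2 := Hp0M o ltac:(lra)). nra.
Qed.

(** A first crude form of the result: welded points differ by [O(t)], since both [A zeta] and
    [f omega / omega] are within [O(t)] of 1. *)
Let rotation_small (zeta omega : C) :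
  Cmod zeta = 1 -> Cmod omega = 1 -> A zeta = (zeta * f omega)%C -> Cmod (zeta * omega - 1)%C <= Q * t.
Proof.
  intros Hz Ho E. assert (q := A_near_one zeta Hz). assert (q2 := f_linear omega Ho).
  replace (zeta * omega - 1)%C with ((A zeta - 1) - zeta * (f omega - omega))%C by (rewrite E; ring).
  eapply Rle_trans; [apply Cmod_triangle_minus|]. rewrite Cmod_mult, Hz.
  unfold Q, d in *. nra.
Qed.

Let conj_close (zeta omega : C) :
  Cmod zeta = 1 -> Cmod (omega - Cconj zeta)%C = Cmod (zeta * omega - 1)%C.
Proof.
  intros Hz. rewrite <- (Rmult_1_l (Cmod (omega - Cconj zeta)%C)), <- Hz at 1. rewrite <- Cmod_mult.
  f_equal. rewrite <- (Cmult_conj_unimodular zeta Hz). ring.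
Qed.

(** The double conjugation makes the correction holomorphic and gives it the value
    [Cconj (p0 (cis th))] at [zeta = Cconj (cis th)]. *)
Let v (w : C) : C := (A w - 1 + t * Cconj (p0 (Cconj w)))%C.
Let E := e1 * t + 2 * (Q * Q) * (t * t).

(** On the circle [|A zeta| = |f omega|]. Expanding both squares gives
    [Re (A zeta - 1) = - t Re (p0 omega)] up to [e1 t] and quadratic terms; replacing [omega] by the
    conjugate of [zeta] costs another [O(t^2)] by [rotation_small]. *)
Let v_circle (zeta : C) : Cmod zeta = 1 -> Rabs (Re (v zeta)) <= E.
Proof.
  intros Hz. destruct (Hbd zeta Hz) as [o [Ho EA]].
  set (r := (f o - (o - t * (o * p0 o)))%C).
  assert (Hr : Cmod r <= e1 * t) by (apply Hexp; lra).
  set (y := (Cconj o * f o - 1)%C).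
  assert (Ey : y = (Cconj o * r - t * p0 o)%C).
  { replace (Cconj o * r - t * p0 o)%C
     with (Cconj o * f o - o * Cconj o + ((o * Cconj o) * (t * p0 o) - t * p0 o))%C by (unfold r; ring).
    rewrite (Cmult_conj_unimodular o Ho). unfold y. ring. }
  assert (Hp := Hp0M o ltac:(lra)).
  assert (Hy : Cmod y <= (M + 1) * t).
  { rewrite Ey. eapply Rle_trans; [apply Cmod_triangle_minus|].
    rewrite !Cmod_mult, Cmod_conj, Ho, Cmod_R, Rabs_pos_eq by lra. nra. }
  assert (EA2 : Cmod (A zeta) ^ 2 = 1 + 2 * Re y + Cmod y ^ 2).
  { assert (E1 : Cmod (A zeta) = Cmod (1 + y)%C).
    { replace (1 + y)%C with (Cconj o * f o)%C by (unfold y; ring).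
      rewrite EA, !Cmod_mult, Cmod_conj, Hz, Ho. reflexivity. }
    rewrite E1, Cmod_sqr_plus, Cmod_1.
    replace (Re (Cconj 1 * y)%C) with (Re y); [ring|]. rewrite Re_mult. unfold Cconj, Re, Im; simpl; ring. }
  assert (EA3 : Cmod (A zeta) ^ 2 = 1 + 2 * Re (A zeta - 1)%C + Cmod (A zeta - 1)%C ^ 2).
  { replace (A zeta) with (1 + (A zeta - 1))%C at 1 by ring. rewrite Cmod_sqr_plus, Cmod_1.
    replace (Re (Cconj 1 * (A zeta - 1))%C) with (Re (A zeta - 1)%C); [ring|].
    rewrite Re_mult. unfold Cconj, Re, Im; simpl; ring. }
  assert (Hrot := rotation_small zeta o Hz Ho EA).
  assert (Hcl := Hp0L o (Cconj zeta) ltac:(lra) ltac:(rewrite Cmod_conj; lra)).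
  rewrite (conj_close zeta o Hz) in Hcl.
  assert (Hcl2 : Rabs (Re (p0 o) - Re (p0 (Cconj zeta))) <= M * (Q * t)).
  { rewrite <- Re_minus. eapply Rle_trans; [apply re_le_Cmod|]. apply Rle_trans with (1 := Hcl).
    apply Rmult_le_compat_l; lra. }
  assert (Ev : Re (v zeta) = Re (Cconj o * r)%C + (Cmod y ^ 2 - Cmod (A zeta - 1)%C ^ 2) / 2
     - t * (Re (p0 o) - Re (p0 (Cconj zeta)))).
  { assert (Ry : Re y = Re (Cconj o * r)%C - t * Re (p0 o)).
    { rewrite Ey, Re_minus. f_equal. rewrite Re_mult. change (Im (RtoC t)) with 0. change (Re (RtoC t)) with t. ring. }
    assert (Rv : Re (v zeta) = Re (A zeta - 1)%C + t * Re (p0 (Cconj zeta))).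
    { unfold v. rewrite Re_plus. f_equal. rewrite Re_mult. change (Im (RtoC t)) with 0. change (Re (RtoC t)) with t.
      change (Re (Cconj (p0 (Cconj zeta)))) with (Re (p0 (Cconj zeta))). ring. }
    rewrite Rv. lra. }
  rewrite Ev.
  assert (B1 : Rabs (Re (Cconj o * r)%C) <= e1 * t).
  { eapply Rle_trans; [apply re_le_Cmod|]. rewrite Cmod_mult, Cmod_conj, Ho. lra. }
  assert (q1 := A_near_one zeta Hz).
  assert (Py := Cmod_ge_0 y). assert (PA := Cmod_ge_0 (A zeta - 1)%C).
  assert (B2 : Cmod y ^ 2 <= ((M + 1) * t) ^ 2) by (apply pow_incr; lra).
  assert (B3 : Cmod (A zeta - 1)%C ^ 2 <= (8961 * d) ^ 2) by (apply pow_incr; lra).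
  assert (B2' : 0 <= Cmod y ^ 2) by apply pow2_ge_0.
  assert (B3' : 0 <= Cmod (A zeta - 1)%C ^ 2) by apply pow2_ge_0.
  assert (B4 : ((M + 1) * t) ^ 2 <= Q * Q * (t * t)).
  { replace (((M + 1) * t) ^ 2) with ((M + 1) * (M + 1) * (t * t)) by ring.
    apply Rmult_le_compat_r; [nra|]. apply Rmult_le_compat; unfold Q; lra. }
  assert (B5 : (8961 * d) ^ 2 <= Q * Q * (t * t)).
  { replace ((8961 * d) ^ 2) with ((17922 * L) * (17922 * L) * (t * t)) by (unfold d; ring).
    apply Rmult_le_compat_r; [nra|]. apply Rmult_le_compat; unfold Q; lra. }
  assert (B6 : M * (Q * t) <= Q * (Q * t)).
  { apply Rmult_le_compat_r; [apply Rmult_le_pos; lra|unfold Q; lra]. }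
  assert (B7 : Rabs (t * (Re (p0 o) - Re (p0 (Cconj zeta)))) <= Q * Q * (t * t)).
  { rewrite Rabs_mult, (Rabs_pos_eq t) by lra.
    apply Rle_trans with (t * (Q * (Q * t))); [apply Rmult_le_compat_l; lra|right; ring]. }
  unfold E. apply Rabs_le_between in B1. apply Rabs_le_between in B7. apply Rabs_le_between. lra.
Qed.

Let v_cont (w : C) : Cmod w <= 1 -> cont_within (fun v => Cmod v <= 1) v w.
Proof.
  intros Hw. unfold v. apply cont_within_plus.
  - apply cont_within_minus; [auto|apply cont_within_const].
  - apply cont_within_mult; [apply cont_within_const|].
    apply (lipschitz_cont_within _ _ M); [exact HM|exact Hw|].
    intros u u' Hu Hu'. rewrite <- Cminus_conj, Cmod_conj.
    rewrite <- (Cmod_conj (u - u')), Cminus_conj. apply Hp0L; rewrite Cmod_conj; assumption.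
Qed.

Let v_deriv (w : C) : Cmod w < 1 -> cderivable v w.
Proof.
  intros Hw. unfold v. apply cderivable_plus.
  - apply cderivable_minus; [auto|apply cderivable_const].
  - apply cderivable_mult; [apply cderivable_const|].
    destruct (Hp0d (Cconj w)) as [l Hl]; [rewrite Cmod_conj; exact Hw|].
    exists (Cconj l). apply is_cderiv_conj_conj, Hl.
Qed.

Let v_disk (w : C) : Cmod w <= 1 -> Rabs (Re (v w)) <= E.
Proof.
  intros Hw.
  assert (HR : forall c : R, (forall z, Cmod z = 1 -> c * Re (v z) <= E) -> c * Re (v w) <= E).
  { intros c Hc. assert (Ec : forall z, Re (c * v z)%C = c * Re (v z)).
    { intros z. rewrite Re_mult. change (Im (RtoC c)) with 0. change (Re (RtoC c)) with c. ring. }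
    rewrite <- Ec.
    apply (max_principle_Re (fun z => c * v z)%C 0 1 E); [lra| | | |rewrite Cminus_0_r; exact Hw].
    - intros z Hz. rewrite Cminus_0_r in Hz.
      apply (cont_within_subset _ (fun w => Cmod w <= 1)); [intros u; rewrite Cminus_0_r; auto|].
      apply cont_within_mult; [apply cont_within_const|auto].
    - intros z Hz. rewrite Cminus_0_r in Hz.
      apply cderivable_mult; [apply cderivable_const|apply v_deriv; lra].
    - intros z Hz. rewrite Cminus_0_r in Hz. rewrite Ec. auto. }
  assert (H1 := HR 1). assert (H2 := HR (-1)).
  apply Rabs_le_between. split.
  - assert (-1 * Re (v w) <= E); [|lra]. apply H2. intros z Hz.
    assert (q := v_circle z Hz). apply Rabs_le_between in q. lra.
  - assert (1 * Re (v w) <= E); [|lra]. apply H1. intros z Hz.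
    assert (q := v_circle z Hz). apply Rabs_le_between in q. lra.
Qed.

(** Borel-Caratheodory reaches [s * zeta] at the cost of [1 / (1 - s)], and the Hoelder bound covers
    the rest of the radius. It starts from [Im (v 0) = 0], true because [A 0] and [p0 0] are
    real. *)
Let v_im (zeta : C) (s : R) : Cmod zeta = 1 -> 0 <= s < 1 ->
  Rabs (Im (v zeta)) * (1 - s) <= 4 * E + t * (17920 * L * sqrt (1 - s) + M * (1 - s)) * (1 - s).
Proof.
  intros Hz Hs.
  assert (HE : 0 < E).
  { unfold E. assert (0 < Q * Q * (t * t)) by (apply Rmult_lt_0_compat; nra). nra. }
  assert (Hv0 : Im (v 0) = 0).
  { unfold v. rewrite HA0. replace (Cconj 0) with (RtoC 0) by (apply C_eq; unfold Cconj, Re, Im; simpl; ring).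
    rewrite Hp00. rewrite Im_plus, Im_minus, Im_mult. unfold Cconj, Re, Im; simpl. ring. }
  assert (Hsz : Cmod (s * zeta - 0)%C = s).
  { rewrite Cminus_0_r, Cmod_mult, Hz, Cmod_R, Rabs_pos_eq; lra. }
  assert (B : Cmod (v (s * zeta) - v 0)%C * (1 - Cmod (s * zeta - 0)%C) <= 2 * (2 * E) * Cmod (s * zeta - 0)%C).
  { apply (borel_caratheodory (fun w => v w - v 0)%C 0 1 (2 * E)).
    - intros w Hw. rewrite Cminus_0_r in Hw. apply cderivable_minus; [auto|apply cderivable_const].
    - intros w Hw. rewrite Cminus_0_r in Hw. rewrite Re_minus.
      assert (q1 := v_disk w ltac:(lra)). assert (q2 := v_disk 0 ltac:(rewrite Cmod_0; lra)).
      apply Rabs_le_between in q1. apply Rabs_le_between in q2. lra.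
    - ring.
    - lra.
    - rewrite Hsz. lra. }
  rewrite Hsz in B.
  assert (C1 : Rabs (Im (v (s * zeta)%C)) * (1 - s) <= 4 * E).
  { assert (q := im_le_Cmod (v (s * zeta) - v 0)%C). rewrite Im_minus, Hv0, Rminus_0_r in q.
    apply Rle_trans with (Cmod (v (s * zeta) - v 0)%C * (1 - s)); [apply Rmult_le_compat_r; lra|].
    apply Rle_trans with (1 := B). nra. }
  assert (C2 : Cmod (v zeta - v (s * zeta))%C <= t * (17920 * L * sqrt (1 - s) + M * (1 - s))).
  { unfold v.
    replace (A zeta - 1 + t * Cconj (p0 (Cconj zeta)) - (A (s * zeta) - 1 + t * Cconj (p0 (Cconj (s * zeta)))))%C
      with ((A zeta - A (s * zeta)) + t * (Cconj (p0 (Cconj zeta)) - Cconj (p0 (Cconj (s * zeta)))))%C by ring.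
    eapply Rle_trans; [apply Cmod_triangle|].
    rewrite Cmod_mult, Cmod_R, (Rabs_pos_eq t) by lra. rewrite <- Cminus_conj, Cmod_conj.
    assert (q1 := A_radial zeta s Hz Hs).
    assert (q2 := Hp0L (Cconj zeta) (Cconj (s * zeta)%C) ltac:(rewrite Cmod_conj; lra)
       ltac:(rewrite Cmod_conj; rewrite Cminus_0_r in Hsz; lra)).
    rewrite <- Cminus_conj, Cmod_conj in q2.
    replace (zeta - s * zeta)%C with (RtoC (1 - s) * zeta)%C in q2 by (rewrite RtoC_minus; ring).
    rewrite Cmod_mult, Hz, Cmod_R, Rabs_pos_eq, Rmult_1_r in q2 by lra.
    assert (t * Cmod (p0 (Cconj zeta) - p0 (Cconj (s * zeta)))%C <= t * (M * (1 - s))) by (apply Rmult_le_compat_l; lra).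
    unfold d in q1. lra. }
  assert (C3 : Rabs (Im (v zeta)) <= Rabs (Im (v (s * zeta)%C)) + t * (17920 * L * sqrt (1 - s) + M * (1 - s))).
  { replace (Im (v zeta)) with (Im (v zeta - v (s * zeta))%C + Im (v (s * zeta)%C)) by (rewrite Im_minus; ring).
    eapply Rle_trans; [apply Rabs_triang|].
    assert (q := im_le_Cmod (v zeta - v (s * zeta))%C). lra. }
  apply (Rmult_le_compat_r (1 - s)) in C3; [|lra]. lra.
Qed.

(** With [x = ph - th] and [P = p0 (cis th)], the relation [A zeta = zeta * f o] gives
    [Im (A zeta) = sin x - t Im P] up to errors, while [Im (v zeta) = Im (A zeta) - t Im P] is
    small; so [sin x] is close to [2 t Im P]. The radius [s] is left free, to be chosen
    independently of [t]. *)
Lemma welding_estimate (th ph s : R) :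
  0 <= s < 1 ->
  A (Cconj (cis th)) = (Cconj (cis th) * f (cis ph))%C -> Rabs (ph - th) <= / 2 ->
  Rabs (ph - th - 2 * Im (p0 (cis th)) * t) <=
    t * (17920 * L * sqrt (1 - s) + M * (1 - s) + (5 * e1 + 14 * ((17922 * L + M + 1) * (17922 * L + M + 1)) * t) / (1 - s)).
Proof.
  intros Hs EA Hph. fold Q.
  set (zeta := Cconj (cis th)). set (o := cis ph). set (x := ph - th).
  assert (Hz : Cmod zeta = 1) by (unfold zeta; rewrite Cmod_conj; apply Cmod_cis).
  assert (Ho : Cmod o = 1) by apply Cmod_cis.
  assert (Hzo : (zeta * o)%C = cis x) by apply Cconj_cis_mult.
  assert (Ezc : Cconj zeta = cis th) by (unfold zeta; apply C_eq; unfold Cconj, Re, Im; simpl; ring).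
  assert (Hrot := rotation_small zeta o Hz Ho EA).
  assert (Hcl := Hp0L o (Cconj zeta) ltac:(lra) ltac:(rewrite Cmod_conj; lra)).
  rewrite (conj_close zeta o Hz) in Hcl. rewrite Ezc in Hcl.
  assert (HQt : 0 <= Q * t) by (apply Rmult_le_pos; lra).
  set (P := p0 (cis th)) in *.
  set (r := (f o - (o - t * (o * p0 o)))%C).
  assert (Hr : Cmod r <= e1 * t) by (apply Hexp; lra).
  assert (EIm : Im (A zeta) = sin x - t * Im P + (Im (zeta * r)%C - t * Im (zeta * o * p0 o - P)%C)).
  { assert (E1 : A zeta = (cis x - t * P + (zeta * r - t * (zeta * o * p0 o - P)))%C).
    { rewrite <- Hzo. unfold zeta at 1. rewrite EA. fold zeta. fold o. unfold r. ring. }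
    rewrite E1. rewrite Im_plus, !Im_minus, !(Im_mult (RtoC t)). change (Im (RtoC t)) with 0. change (Re (RtoC t)) with t.
    change (Im (cis x)) with (sin x). rewrite !Im_minus. ring. }
  assert (B1 : Rabs (Im (zeta * r)%C) <= e1 * t).
  { eapply Rle_trans; [apply im_le_Cmod|]. rewrite Cmod_mult, Hz. lra. }
  assert (B2 : Rabs (Im (zeta * o * p0 o - P)%C) <= 2 * (M * (Q * t))).
  { eapply Rle_trans; [apply im_le_Cmod|].
    replace (zeta * o * p0 o - P)%C with ((zeta * o - 1) * p0 o + (p0 o - P))%C by ring.
    eapply Rle_trans; [apply Cmod_triangle|]. rewrite Cmod_mult.
    assert (q := Hp0M o ltac:(lra)). assert (q2 := Cmod_ge_0 (p0 o)). assert (q3 := Cmod_ge_0 (zeta * o - 1)%C).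
    assert (Cmod (zeta * o - 1)%C * Cmod (p0 o) <= Q * t * M) by (apply Rmult_le_compat; lra).
    assert (M * Cmod (zeta * o - 1)%C <= M * (Q * t)) by (apply Rmult_le_compat_l; lra). lra. }
  assert (EIv : Im (v zeta) = Im (A zeta) - t * Im P).
  { unfold v. rewrite Ezc. fold P. rewrite Im_plus, Im_minus, Im_mult.
    change (Im (RtoC t)) with 0. change (Re (RtoC t)) with t. change (Im (Cconj P)) with (- Im P).
    change (Im (RtoC 1)) with 0. ring. }
  assert (B3 := v_im zeta s Hz Hs).
  assert (Hsin : Rabs (sin x) <= Q * t).
  { assert (q := im_le_Cmod (zeta * o - 1)%C). rewrite Hzo, Im_minus in q.
    change (Im (cis x)) with (sin x) in q. change (Im (RtoC 1)) with 0 in q. rewrite Rminus_0_r, <- Hzo in q. lra. }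
  assert (Hxs := sin_minus_id x).
  assert (Hx2 : x * x = Rabs x * Rabs x) by (rewrite <- Rabs_mult, Rabs_pos_eq; [reflexivity|apply Rle_0_sqr]).
  fold x in Hph.
  (* The sine determines the angle because [|x| <= / 2]: then [|x - sin x| <= x^2 <= |x| / 2]. *)
  assert (Hxx : Rabs x <= 2 * (Q * t)).
  { assert (q := Rabs_triang (x - sin x) (sin x)). replace (x - sin x + sin x) with x in q by ring.
     nra. }
  assert (Hxs2 : Rabs (x - sin x) <= 4 * (Q * Q) * (t * t)).
  { apply Rle_trans with (1 := Hxs). rewrite Hx2. assert (Px := Rabs_pos x).
    apply Rle_trans with ((2 * (Q * t)) * (2 * (Q * t))); [apply Rmult_le_compat; lra|right; ring]. }
  assert (B4 : t * Rabs (Im (zeta * o * p0 o - P)%C) <= 2 * (Q * Q) * (t * t)).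
  { apply Rle_trans with (t * (2 * (M * (Q * t)))); [apply Rmult_le_compat_l; lra|].
    assert (M * (Q * t) <= Q * (Q * t)) by (apply Rmult_le_compat_r; [lra|unfold Q; lra]). nra. }
  assert (Hfin : Rabs (x - 2 * Im P * t) <= Rabs (Im (v zeta)) + e1 * t + 6 * (Q * Q) * (t * t)).
  { replace (x - 2 * Im P * t) with ((x - sin x) + (Im (v zeta) + (- Im (zeta * r)%C + t * Im (zeta * o * p0 o - P)%C)))
      by (rewrite EIv, EIm; ring).
    eapply Rle_trans; [apply Rabs_triang|].
    assert (q1 := Rabs_triang (Im (v zeta)) (- Im (zeta * r)%C + t * Im (zeta * o * p0 o - P)%C)).
    assert (q2 := Rabs_triang (- Im (zeta * r)%C) (t * Im (zeta * o * p0 o - P)%C)).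
    rewrite Rabs_Ropp in q2. rewrite (Rabs_mult t), (Rabs_pos_eq t) in q2 by lra. lra. }
  apply Rle_trans with (1 := Hfin).
  apply (Rmult_le_reg_r (1 - s)); [lra|].
  replace (t * (17920 * L * sqrt (1 - s) + M * (1 - s) + (5 * e1 + 14 * (Q * Q) * t) / (1 - s)) * (1 - s))
    with (t * (17920 * L * sqrt (1 - s) + M * (1 - s)) * (1 - s) + 5 * (e1 * t) + 14 * (Q * Q) * (t * t)) by (field; lra).
  assert (G1 : e1 * t * (1 - s) <= e1 * t * 1) by (apply Rmult_le_compat_l; [apply Rmult_le_pos|]; lra).
  assert (G0 : 0 <= Q * Q * (t * t)) by (apply Rmult_le_pos; nra).
  assert (G2 : Q * Q * (t * t) * (1 - s) <= Q * Q * (t * t) * 1) by (apply Rmult_le_compat_l; lra).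
  unfold E in B3. lra.
Qed.

End Welding.

(** * The exterior map in the disk coordinate *)

Lemma has_cderiv_is_cderiv (g : C -> C) (z l : C) : Defs.has_cderiv g z l -> is_cderiv g z l.
Proof.
  intros H eps He. destruct (H eps He) as [d [Hd Hh]]. exists d. split; [exact Hd|].
  intros h Hhd. destruct (Ceq_dec h 0) as [->|Hn].
  - replace (g (z + 0) - g z - l * 0)%C with (RtoC 0) by (rewrite Cplus_0_r; ring).
    rewrite Cmod_0. lra.
  - assert (P := Hn). apply Cmod_gt_0 in P.
    assert (Q : Cmod ((g (z + h) - g z) / h - l)%C < eps) by exact (Hh h (conj P Hhd)).
    replace (g (z + h) - g z - l * h)%C with (((g (z + h) - g z) / h - l) * h)%C by (field; exact Hn).
    rewrite Cmod_mult. apply Rmult_le_compat_r; lra.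
Qed.

Lemma loewner_transport_sol (f p : C -> R -> C) (T : R) :
  (forall z t, Cmod z < 1 -> 0 <= t < T -> exists l, Defs.has_cderiv (fun w => f w t) z l /\
     Defs.has_tderiv_in T (fun s => f z s) t (- (z * l * p z t))%C) ->
  forall a b, 0 <= a -> b < T -> transport_sol f p a b.
Proof.
  intros H a b Ha Hb z t Hz Ht. destruct (H z t Hz ltac:(lra)) as [l [Hl Htd]].
  exists l. split; [apply has_cderiv_is_cderiv, Hl|]. intros eps He.
  destruct (Htd eps He) as [d [Hd Hs]]. exists d. split; [exact Hd|]. intros s Hs1 Hs2.
  destruct (Req_dec s t) as [->|Hne].
  - replace (f z t - f z t + RtoC (t - t) * (z * l * p z t))%C with (RtoC 0)
      by (rewrite RtoC_minus; ring).
    rewrite Cmod_0. assert (P := Rabs_pos (t - t)). nra.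
  - assert (Q : Cmod (RtoC (/ (s - t)) * (f z s - f z t) - - (z * l * p z t))%C < eps)
      by exact (Hs s ltac:(lra) Hne Hs2).
    assert (Hst : s - t <> 0) by lra.
    assert (Hst' : RtoC (s - t) <> 0) by (intros E; apply Hst; injection E; auto).
    replace (f z s - f z t + RtoC (s - t) * (z * l * p z t))%C with
      (RtoC (s - t) * (RtoC (/ (s - t)) * (f z s - f z t) - - (z * l * p z t)))%C
      by (rewrite RtoC_inv by exact Hst; field; exact Hst').
    rewrite Cmod_mult, Cmod_R. rewrite Rmult_comm. apply Rmult_le_compat_r; [apply Rabs_pos|lra].
Qed.

Lemma unimodular_is_cis (z : C) : Cmod z = 1 -> exists x, z = cis x.
Proof.
  intros Hz. assert (H := Cmod2_alt z). rewrite Hz in H.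
  assert (Hc : -1 <= Re z <= 1) by nra.
  destruct (Rle_lt_dec 0 (Im z)) as [Hs|Hs].
  - exists (acos (Re z)). apply C_eq; unfold cis; simpl.
    + symmetry; apply cos_acos, Hc.
    + rewrite sin_acos by exact Hc. replace (1 - Rsqr (Re z)) with (Im z ^ 2) by (unfold Rsqr; lra).
      symmetry; apply sqrt_pow2, Hs.
  - exists (- acos (Re z)). apply C_eq; unfold cis; simpl.
    + rewrite cos_neg. symmetry; apply cos_acos, Hc.
    + rewrite sin_neg, sin_acos by exact Hc. replace (1 - Rsqr (Re z)) with ((- Im z) ^ 2) by (unfold Rsqr; lra).
      rewrite sqrt_pow2 by lra. ring.
Qed.

Lemma bounded_closed_disk (g : C -> C) :
  (forall z, Cmod z <= 1 -> cont_within (fun w => Cmod w <= 1) g z) ->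
  exists K, forall z, Cmod z <= 1 -> Cmod (g z) <= K.
Proof.
  intros Hc.
  destruct (disk_max_attained (fun z => Cmod (g z)) 0 1) as [z0 [_ Hmax]]; [lra| |].
  - intros z Hz eps He. rewrite Cminus_0_r in Hz. destruct (Hc z Hz eps He) as [d [Hd H]].
    exists d. split; [exact Hd|]. intros w Hw Hwz. rewrite Cminus_0_r in Hw.
    eapply Rle_lt_trans; [apply Rabs_Cmod_minus|]. apply H; assumption.
  - exists (Cmod (g z0)). intros z Hz. apply Hmax. rewrite Cminus_0_r. exact Hz.
Qed.

(* [A w = w F (1 / w)], extended by its limit [exp (- tau)] at [w = 0]. *)
Definition exterior_in_disk (F : C -> C) (a0 : R) (w : C) : C :=
  if Ceq_dec w 0 then RtoC a0 else (w * F (/ w))%C.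

Section ExteriorInDisk.

Variables (F G : C -> C) (a0 : R).
Hypothesis Ha0 : 0 < a0.
Hypothesis HG : forall w, Cmod w < 1 -> cderivable G w.
Hypothesis HGF : forall w, 0 < Cmod w < 1 -> G w = (F (/ w) - RtoC a0 * / w)%C.
Hypothesis HFc : forall z, Cmod z >= 1 -> cont_within (fun w => Cmod w >= 1) F z.
Hypothesis HFinj : forall z w, Cmod z > 1 -> Cmod w > 1 -> F z = F w -> z = w.
Hypothesis HFnz : forall z, Cmod z > 1 -> F z <> 0.

Let A := exterior_in_disk F a0.

Lemma exterior_in_disk_nonzero (w : C) : w <> 0 -> A w = (w * F (/ w))%C.
Proof.
  intros Hw. unfold A, exterior_in_disk. destruct (Ceq_dec w 0); [contradiction|reflexivity].
Qed.

Lemma exterior_in_disk_0 : A 0 = RtoC a0.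
Proof.
  unfold A, exterior_in_disk. destruct (Ceq_dec 0 0); [reflexivity|]. exfalso; auto.
Qed.

(** [G] is what remains of [F (/ w)] after its pole is removed, so this formula shows that [A] is
    holomorphic across 0. *)
Let A_G (w : C) : Cmod w < 1 -> A w = (RtoC a0 + w * G w)%C.
Proof.
  intros Hw. destruct (Ceq_dec w 0) as [->|Hn].
  - rewrite exterior_in_disk_0. ring.
  - rewrite exterior_in_disk_nonzero by exact Hn. rewrite HGF by (split; [apply Cmod_gt_0, Hn|exact Hw]).
    field. exact Hn.
Qed.

Lemma exterior_in_disk_derivable (w : C) : Cmod w < 1 -> cderivable A w.
Proof.
  intros Hw. apply (cderivable_ext_loc (fun w => RtoC a0 + w * G w)%C A w (1 - Cmod w)); [lra| |].
  - intros h Hh. symmetry; apply A_G. assert (Q := Cmod_triangle w h). lra.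
  - apply cderivable_plus; [apply cderivable_const|]. apply cderivable_mult; [apply cderivable_id|auto].
Qed.

Let Cmod_inv_gt (w : C) : w <> 0 -> Cmod w < 1 -> Cmod (/ w)%C > 1.
Proof.
  intros Hn Hw. assert (P := Hn). apply Cmod_gt_0 in P. rewrite Cmod_inv by exact Hn.
  rewrite <- Rinv_1. apply Rinv_lt_contravar; lra.
Qed.

Lemma exterior_in_disk_cont (w : C) : Cmod w <= 1 -> cont_within (fun v => Cmod v <= 1) A w.
Proof.
  intros [Hw|Hw]; [apply cderivable_cont, exterior_in_disk_derivable, Hw|].
  assert (Hn : w <> 0) by (apply Cmod_gt_0; lra).
  set (S := fun v => Cmod v <= 1 /\ v <> 0).
  assert (H : cont_within S (fun v => v * F (/ v))%C w).
  { apply cont_within_mult; [apply cont_within_id|].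
    apply (cont_within_comp S (fun v => Cmod v >= 1) (fun v => / v)%C F).
    - intros v [Hv Hv0]. rewrite Cmod_inv by exact Hv0. apply Cmod_gt_0 in Hv0.
      rewrite <- Rinv_1. apply Rle_ge, Rinv_le_contravar; lra.
    - apply cont_within_inv; [apply cont_within_id|exact Hn].
    - apply HFc. rewrite Cmod_inv, Hw by exact Hn. rewrite Rinv_1. lra. }
  intros eps He. destruct (H eps He) as [d [Hd Hd']].
  exists (Rmin d 1). split; [apply Rmin_pos; lra|]. intros v Hv Hvw.
  assert (Hv0 : v <> 0).
  { intros ->. assert (q := Rlt_min_r Hvw). rewrite Cmod_minus_sym, Cminus_0_r in q. lra. }
  rewrite !exterior_in_disk_nonzero by assumption.
  apply Hd'; [split; assumption|]. apply (Rlt_min_l Hvw).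
Qed.

Lemma exterior_in_disk_neq_0 (w : C) : Cmod w < 1 -> A w <> 0.
Proof.
  intros Hw. destruct (Ceq_dec w 0) as [->|Hn].
  - rewrite exterior_in_disk_0. intros E. injection E. lra.
  - rewrite exterior_in_disk_nonzero by exact Hn.
    apply Cmult_neq_0; [exact Hn|]. apply HFnz, Cmod_inv_gt; assumption.
Qed.

(** For [w <> 0] equality would mean [F (e / w) = F (1 / w)], against injectivity; at [w = 0] it
    would force [A 0 = 0]. *)
Lemma exterior_in_disk_rotation (e w : C) :
  Cmod e = 1 -> e <> 1 -> Cmod w < 1 -> (e * A (w / e))%C <> A w.
Proof.
  intros He Hne Hw E.
  assert (He0 : e <> 0) by (apply Cmod_gt_0; lra).
  destruct (Ceq_dec w 0) as [->|Hn].
  - replace (0 / e)%C with (RtoC 0) in E by (unfold Cdiv; ring).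
    assert (Q : ((e - 1) * A 0 = 0)%C)
      by (replace ((e - 1) * A 0)%C with (e * A 0 - A 0)%C by ring; rewrite E; ring).
    revert Q. apply Cmult_neq_0.
    + intros E2. apply Hne. replace e with (e - 1 + 1)%C by ring. rewrite E2. ring.
    + apply exterior_in_disk_neq_0, Hw.
  - assert (Hwe : (w / e)%C <> 0).
    { unfold Cdiv. apply Cmult_neq_0; [exact Hn|]. apply Cmod_gt_0. rewrite Cmod_inv, He by exact He0. lra. }
    rewrite !exterior_in_disk_nonzero in E by assumption.
    assert (E2 : F (/ (w / e))%C = F (/ w)%C).
    { replace (F (/ (w / e))%C) with (e * (w / e * F (/ (w / e))) / w)%C by (field; auto).
      rewrite E. field. exact Hn. }
    apply HFinj in E2.
    + apply Hne. replace e with (w * / (w / e))%C by (field; auto). rewrite E2. field. exact Hn.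
    + apply Cmod_inv_gt; [exact Hwe|]. rewrite Cmod_div, He by exact He0. lra.
    + apply Cmod_inv_gt; assumption.
Qed.

End ExteriorInDisk.

(** * Assembly of the estimates and choice of the parameters *)

Section Main.

Variables (T M : R) (p p1 f F : C -> R -> C) (tau : R -> R) (phi : R -> R -> R).
Hypothesis HT : 0 < T.
Hypothesis Hp1 : forall t, 0 <= t < T -> forall z, Cmod z < 1 -> is_cderiv (fun w => p w t) z (p1 z t).
Hypothesis HpM : forall z t, Cmod z <= 1 -> 0 <= t < T -> Cmod (p z t) <= M /\ Cmod (p1 z t) <= M.
Hypothesis Hp0 : forall t, 0 <= t < T -> p 0 t = 1.
Hypothesis Hre : forall t, 0 <= t < T -> forall z, Cmod z < 1 -> 0 < Re (p z t).
Hypothesis Hpc : forall t, 0 <= t < T -> forall z, Cmod z <= 1 -> cont_within (fun w => Cmod w <= 1) (fun z => p z t) z.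
Hypothesis Hpt : forall z, Cmod z <= 1 -> forall eps, eps > 0 -> exists delta, delta > 0 /\
  forall s, 0 <= s < T -> s < delta -> Cmod (p z s - p z 0)%C < eps.
Hypothesis Hsol : forall a b, 0 <= a -> b < T -> transport_sol f p a b.
Hypothesis Hinit : forall z, Cmod z < 1 -> f z 0 = z.
Hypothesis Hfc : forall t, 0 <= t < T -> forall z, Cmod z <= 1 -> cont_within (fun w => Cmod w <= 1) (fun z => f z t) z.
Hypothesis HFinj : forall t, 0 <= t < T -> forall z w, Cmod z > 1 -> Cmod w > 1 -> F z t = F w t -> z = w.
Hypothesis HFrange : forall t, 0 <= t < T -> forall z, Cmod z > 1 ->
  Defs.unbounded_component (Defs.boundary_image_disk (fun z => f z t)) (F z t).
Hypothesis HG : forall t, 0 <= t < T -> exists G : C -> C, (forall w, Cmod w < 1 -> cderivable G w) /\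
  forall w, 0 < Cmod w < 1 -> G w = (F (/ w) t - RtoC (exp (- tau t)) * / w)%C.
Hypothesis HFc : forall t, 0 <= t < T -> forall z, Cmod z >= 1 -> cont_within (fun w => Cmod w >= 1) (fun z => F z t) z.
Hypothesis Hphi : forall t th, 0 < t < T -> f (cis (phi t th)) t = F (cis th) t.
Hypothesis Hphi0 : forall th eps, eps > 0 -> exists delta, delta > 0 /\
  forall t, 0 < t < T -> t < delta -> Rabs (phi t th - th) < eps.

Let HM1 : 1 <= M.
Proof.
  destruct (HpM 0 0 ltac:(rewrite Cmod_0; lra) ltac:(lra)) as [Q _].
  rewrite Hp0, Cmod_1 in Q by lra. exact Q.
Qed.

Let p_lipschitz (t : R) (z w : C) : 0 <= t < T -> Cmod z <= 1 -> Cmod w <= 1 ->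
  Cmod (p z t - p w t)%C <= M * Cmod (z - w)%C.
Proof.
  intros Ht. apply (lipschitz_closed_disk (fun z => p z t) M); [lra|apply Hpc, Ht|].
  apply (holo_lipschitz_disk (fun z => p z t) (fun z => p1 z t)); [apply Hp1, Ht|].
  intros u Hu. apply HpM; [lra|exact Ht].
Qed.

Let field_lipschitz (t : R) (z w : C) : 0 <= t < T -> Cmod z < 1 -> Cmod w < 1 ->
  Cmod (z * p z t - w * p w t)%C <= 2 * M * Cmod (z - w)%C.
Proof.
  intros Ht Hz Hw.
  replace (z * p z t - w * p w t)%C with ((z - w) * p z t + w * (p z t - p w t))%C by ring.
  eapply Rle_trans; [apply Cmod_triangle|]. rewrite !Cmod_mult.
  assert (q := p_lipschitz t z w Ht ltac:(lra) ltac:(lra)).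
  destruct (HpM z t ltac:(lra) Ht) as [q2 _].
  assert (P := Cmod_ge_0 (z - w)%C). assert (P2 := Cmod_ge_0 w). assert (P3 := Cmod_ge_0 (p z t - p w t)%C).
  assert (Cmod w * Cmod (p z t - p w t)%C <= 1 * (M * Cmod (z - w)%C)) by (apply Rmult_le_compat; lra).
  assert (Cmod (z - w)%C * Cmod (p z t) <= Cmod (z - w)%C * M) by (apply Rmult_le_compat_l; lra). lra.
Qed.

Let bounded (b rho : R) : b < T -> rho < 1 -> bounded_on f rho 0 b.
Proof.
  intros Hb Hrho. apply (bounded_on_compact_times f p T M); auto.
  - intros t Ht. destruct (bounded_closed_disk (fun z => f z t) (Hfc t Ht)) as [K HK].
    exists K. intros z Hz. apply HK; lra.
  - intros z t Hz Ht. apply HpM; [lra|exact Ht].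
Qed.

Let f_lipschitz_open (t : R) (z w : C) : 0 <= t < T -> 2 * (2 * M) * t <= 1 -> Cmod z < 1 -> Cmod w < 1 ->
  Cmod (f z t - f w t - (z - w))%C <= 2 * (2 * M) * t * Cmod (z - w)%C.
Proof.
  intros Ht Hs Hz Hw.
  apply (near_identity_lipschitz f p t (2 * M)); auto; try lra.
  - apply Hsol; lra.
  - intros rho Hrho. apply bounded; lra.
  - intros u s Hu Hs'. apply Hre; lra.
  - intros u u' s Hu Hu' Hs'. apply field_lipschitz; lra.
Qed.

Let f_lipschitz (t : R) (z w : C) : 0 <= t < T -> 2 * (2 * M) * t <= 1 -> Cmod z <= 1 -> Cmod w <= 1 ->
  Cmod (f z t - f w t - (z - w))%C <= 2 * (2 * M) * t * Cmod (z - w)%C.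
Proof.
  intros Ht Hs Hz Hw.
  replace (f z t - f w t - (z - w))%C with ((f z t - z) - (f w t - w))%C by ring.
  apply (lipschitz_closed_disk (fun z => f z t - z)%C (2 * (2 * M) * t)); auto.
  - repeat apply Rmult_le_pos; lra.
  - intros u Hu. apply cont_within_minus; [apply Hfc; auto|apply cont_within_id].
  - intros u u' Hu Hu'. replace (f u t - u - (f u' t - u'))%C with (f u t - f u' t - (u - u'))%C by ring.
    apply f_lipschitz_open; auto.
Qed.

(** The origin is a stationary characteristic, so the comparison is run on the tube of radius 0 with
    initial bound 0. *)
Let f_fixes_0 (t : R) : 0 <= t < T -> f 0 t = 0.
Proof.
  intros Ht. apply Cmod_eq_0. apply Rle_antisym; [|apply Cmod_ge_0].
  destruct (bounded t (/ 2) ltac:(lra) ltac:(lra)) as [K HK].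
  apply (transport_sup_bound f p 0 t 0 (/ 2) 0 0 K); auto; try lra.
  - apply Hsol; lra.
  - intros z s Hz Hs Hn. apply Cmod_gt_0 in Hn. assert (q := Hre s ltac:(lra) z Hz). nra.
  - intros z Hz. assert (Hz0 : Cmod z = 0) by (assert (q := Cmod_ge_0 z); lra).
    apply Cmod_eq_0 in Hz0. rewrite Hz0, Hinit, Cmod_0 by (rewrite Cmod_0; lra). lra.
  - rewrite Cmod_0. lra.
Qed.

Let f_expansion (e t : R) (z : C) : 0 <= t < T ->
  (forall w s, Cmod w <= 1 -> 0 <= s <= t -> Cmod (p w s - p w 0)%C <= e) -> Cmod z <= 1 ->
  Cmod (f z t - (z - t * (z * p z 0)))%C <= (e + 2 * M * M * t) * t.
Proof.
  intros Ht He Hz.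
  apply (bound_closed_disk (fun z => f z t - (z - t * (z * p z 0)))%C); auto.
  - intros u Hu. apply cont_within_minus; [apply Hfc; auto|].
    apply cont_within_minus; [apply cont_within_id|]. apply cont_within_mult; [apply cont_within_const|].
    apply cont_within_mult; [apply cont_within_id|apply Hpc; [lra|exact Hu]].
  - intros u Hu. apply (first_order_expansion f p t M (2 * M)); auto; try lra.
    + apply Hsol; lra.
    + intros rho Hrho. apply bounded; lra.
    + intros v s Hv Hs'. apply Hre; lra.
    + intros v s Hv Hs'. apply HpM; lra.
    + intros v v' s Hv Hv' Hs'. apply field_lipschitz; lra.
    + intros v s Hv Hs. apply He; lra.
Qed.

Let welding_bound (th t e1 s : R) :
  0 < t < T -> 0 <= e1 <= 1 -> 2 * (2 * M) * t <= / 320 -> 0 <= s < 1 ->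
  (forall z, Cmod z <= 1 -> Cmod (f z t - (z - t * (z * p z 0)))%C <= e1 * t) ->
  Rabs (phi t th - th) <= / 2 ->
  Rabs (phi t th - th - 2 * Im (p (cis th) 0) * t) <=
    t * (17920 * (2 * M) * sqrt (1 - s) + M * (1 - s)
      + (5 * e1 + 14 * ((17922 * (2 * M) + M + 1) * (17922 * (2 * M) + M + 1)) * t) / (1 - s)).
Proof.
  intros Ht He1 Hsm Hs Hexp Hph.
  assert (Ht' : 0 <= t < T) by lra.
  destruct (HG t Ht') as [G [HGd HGF]].
  assert (Ha0 := exp_pos (- tau t)). set (a0 := exp (- tau t)) in *.
  (* The range of [F] is the unbounded component, which misses 0 because 0 is surrounded by the
     curve. *)
  assert (HFnz : forall z, Cmod z > 1 -> F z t <> 0).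
  { intros z Hz E. apply (zero_not_in_unbounded_component (fun z => f z t) (2 * (2 * M) * t)).
    - lra.
    - intros w Hw. apply (transport_slice_derivable f p 0 t); [apply Hsol; lra|exact Hw|lra].
    - intros w w' Hw Hw'. apply f_lipschitz_open; lra.
    - apply f_fixes_0, Ht'.
    - rewrite <- E. apply HFrange; assumption. }
  assert (Hcirc : forall zeta, Cmod zeta = 1 -> exterior_in_disk (fun z => F z t) a0 zeta = (zeta * F (/ zeta)%C t)%C).
  { intros zeta Hz. apply (exterior_in_disk_nonzero (fun z => F z t)). apply Cmod_gt_0; lra. }
  apply (welding_estimate (exterior_in_disk (fun z => F z t) a0) (fun z => f z t) (fun z => p z 0) t (2 * M) M e1 a0);
    try lra; auto.
  - intros w Hw. apply (exterior_in_disk_cont _ G); auto.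
  - intros w Hw. apply (exterior_in_disk_derivable _ G); auto.
  - intros w Hw. apply exterior_in_disk_neq_0; auto.
  - intros e w He Hne Hw. apply (exterior_in_disk_rotation (fun z => F z t) a0 Ha0 (HFinj t Ht') HFnz); assumption.
  - apply (exterior_in_disk_0 (fun z => F z t)).
  - intros z w Hz Hw. apply f_lipschitz; lra.
  - intros z Hz. apply HpM; lra.
  - intros z w Hz Hw. apply p_lipschitz; lra.
  - intros z Hz. exists (p1 z 0). apply Hp1; lra.
  - apply Hp0; lra.
  (* The inversion in [A] sends [zeta] to its conjugate on the circle, so the parameter [omega] is
     the welding partner of [/ zeta]. *)
  - intros zeta Hz.
    destruct (unimodular_is_cis (/ zeta)%C) as [x Hx].
    { rewrite Cmod_inv, Hz by (apply Cmod_gt_0; lra). apply Rinv_1. }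
    exists (cis (phi t x)). split; [apply Cmod_cis|].
    rewrite Hcirc by exact Hz. rewrite Hx, Hphi by exact Ht. reflexivity.
  - rewrite Hcirc by (rewrite Cmod_conj; apply Cmod_cis).
    rewrite Hphi by exact Ht. f_equal. f_equal.
    assert (Hn : Cconj (cis th) <> 0) by (apply Cmod_gt_0; rewrite Cmod_conj, Cmod_cis; lra).
    assert (q := Cmult_conj_unimodular (cis th) (Cmod_cis th)).
    replace (/ Cconj (cis th))%C with (cis th * Cconj (cis th) / Cconj (cis th))%C by (rewrite q; unfold Cdiv; ring).
    field. exact Hn.
Qed.

Lemma welding_asymptotics (th eps : R) : eps > 0 ->
  exists delta, delta > 0 /\ forall t, 0 < t < T -> t < delta ->
    Rabs (phi t th - th - 2 * Im (p (cis th) 0) * t) <= eps * t.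
Proof.
  intros Heps.
  set (Lc := 17920 * (2 * M) + M). assert (HLc : 0 < Lc) by (unfold Lc; lra).
  (* The radius comes first: with [1 - s = u^2] the Hoelder and Lipschitz terms are at most
     [Lc u <= eps / 3], uniformly in [t]. *)
  set (u := Rmin 1 (eps / (3 * Lc))).
  assert (Hu : 0 < u) by (apply Rmin_pos; [lra|apply Rdiv_lt_0_compat; lra]).
  assert (Hu1 : u <= 1) by apply Rmin_l.
  assert (HuL : u * Lc <= eps / 3).
  { apply Rle_trans with (eps / (3 * Lc) * Lc); [apply Rmult_le_compat_r; [lra|apply Rmin_r]|right; field; lra]. }
  set (s := 1 - u * u). assert (Hs : 0 <= s < 1) by (unfold s; nra).
  assert (Hsq : sqrt (1 - s) = u) by (unfold s; replace (1 - (1 - u * u)) with (u * u) by ring; apply sqrt_square; lra).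
  (* Below [e1 <= 2 e]. Hence [e1 <= 1], and [5 e1] is at most [eps u^2 / 3], which compensates the
     division by [1 - s = u^2]. *)
  set (e := Rmin (/ 2) (eps * (u * u) / 30)).
  assert (Huu : 0 < eps * (u * u)) by (apply Rmult_lt_0_compat; nra).
  assert (He : 0 < e) by (apply Rmin_pos; lra).
  assert (He1 : e <= / 2) by apply Rmin_l. assert (He2 : e <= eps * (u * u) / 30) by apply Rmin_r.
  destruct (uniform_time_continuity p T M HT ltac:(lra) (fun t z w Ht => p_lipschitz t z w Ht) Hpt e He) as [d1 [Hd1 Hunif]].
  destruct (Hphi0 th (/ 2)) as [d2 [Hd2 Hph]]; [lra|].
  set (Q := 17922 * (2 * M) + M + 1).
  assert (HQ : 1 <= Q) by (unfold Q; lra).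
  assert (HMM : 1 <= M * M) by nra.
  (* [d3] ensures [4 M t <= / 320], [d4] ensures [2 M^2 t <= e], and [d5] makes the quadratic term
     [14 Q^2 t] at most [eps u^2 / 3]. *)
  set (d3 := / (1280 * M)). assert (Hd3 : 0 < d3) by (apply Rinv_0_lt_compat; lra).
  set (d4 := e / (2 * (M * M))). assert (Hd4 : 0 < d4) by (apply Rdiv_lt_0_compat; lra).
  set (d5 := eps * (u * u) / (42 * (Q * Q))). assert (Hd5 : 0 < d5) by (apply Rdiv_lt_0_compat; nra).
  exists (Rmin (Rmin d1 d2) (Rmin d3 (Rmin d4 d5))). split; [repeat apply Rmin_pos; lra|].
  intros t Ht Htd.
  assert (L1 := Rlt_min_l Htd). assert (L2 := Rlt_min_r Htd).
  assert (E1 := Rlt_min_l L1). assert (E2 := Rlt_min_r L1).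
  assert (E3 := Rlt_min_l L2). assert (L3 := Rlt_min_r L2).
  assert (E4 := Rlt_min_l L3). assert (E5 := Rlt_min_r L3).
  clear Htd L1 L2 L3.
  assert (F3 : 1280 * M * t <= 1).
  { apply (Rmult_lt_compat_l (1280 * M)) in E3; [|lra]. unfold d3 in E3. rewrite Rinv_r in E3; lra. }
  assert (F4 : 2 * M * M * t <= e).
  { apply (Rmult_lt_compat_l (2 * (M * M))) in E4; [|lra]. unfold d4 in E4.
    replace (2 * (M * M) * (e / (2 * (M * M)))) with e in E4 by (field; lra). lra. }
  assert (F5 : 14 * (Q * Q) * t <= eps * (u * u) / 3).
  { apply (Rmult_lt_compat_l (14 * (Q * Q))) in E5; [|nra]. unfold d5 in E5.
    replace (14 * (Q * Q) * (eps * (u * u) / (42 * (Q * Q)))) with (eps * (u * u) / 3) in E5 by (field; lra). lra. }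
  set (e1 := e + 2 * M * M * t).
  assert (He10 : 0 <= e1) by (unfold e1; assert (0 <= M * M * t) by nra; lra).
  assert (B := welding_bound th t e1 s Ht ltac:(unfold e1 in *; lra) ltac:(lra) Hs).
  eapply Rle_trans; [apply B|].
  - intros z Hz. apply f_expansion; [lra| |exact Hz].
    intros w r Hw Hr. apply Hunif; [exact Hw|lra|lra].
  - apply Rlt_le, Hph; assumption.
  - fold Q. rewrite (Rmult_comm eps). apply Rmult_le_compat_l; [lra|].
    rewrite Hsq. replace (1 - s) with (u * u) by (unfold s; ring).
    assert (G1 : M * (u * u) <= M * u) by (apply Rmult_le_compat_l; nra).
    assert (G2 : (5 * e1 + 14 * (Q * Q) * t) / (u * u) <= eps * 2 / 3).
    { apply (Rmult_le_reg_r (u * u)); [nra|]. unfold Rdiv at 1. rewrite Rmult_assoc, Rinv_l by nra.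
      unfold e1 in *. lra. }
    unfold Lc in HuL. lra.
Qed.

End Main.

Require Import Defs.

Theorem theorem1
  (T : R) (p p1 p2 : Cplx -> R -> Cplx) (f F : Cplx -> R -> Cplx) (tau : R -> R)
  (phi : R -> R -> R)
  (HT : T > 0)
  (* p(.,t) in the Caratheodory class *)
  (Hp_holo : forall t, 0 <= t < T -> holo_on disk (fun z => p z t))
  (Hp0 : forall t, 0 <= t < T -> p Czero t = Cone)
  (Hp_re : forall t, 0 <= t < T -> forall z, disk z -> Cre (p z t) > 0)
  (* p(.,t) is C^2 in the closed disk: p' = p1, p'' = p2 in D, and
     p, p1, p2 extend continuously to the closed disk *)
  (Hp1 : forall t, 0 <= t < T -> forall z, disk z ->
           has_cderiv (fun w => p w t) z (p1 z t))
  (Hp2 : forall t, 0 <= t < T -> forall z, disk z ->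
           has_cderiv (fun w => p1 w t) z (p2 z t))
  (Hpc : forall t, 0 <= t < T -> cont_on cdisk (fun z => p z t))
  (Hp1c : forall t, 0 <= t < T -> cont_on cdisk (fun z => p1 z t))
  (Hp2c : forall t, 0 <= t < T -> cont_on cdisk (fun z => p2 z t))
  (* p(z,.) continuous on [0,T) for z in the closed disk *)
  (Hp_tcont : forall z, cdisk z -> forall t, 0 <= t < T ->
     forall eps, eps > 0 -> exists delta, delta > 0 /\
       forall s, 0 <= s < T -> Rabs (s - t) < delta ->
         Cmod (Csub (p z s) (p z t)) < eps)
  (* boundedness *)
  (Hp_bdd : exists M, forall z t, cdisk z -> 0 <= t < T ->
     Cmod (p z t) <= M /\ Cmod (p1 z t) <= M /\ Cmod (p2 z t) <= M)
  (* f solves the Loewner-Kufarev equation, f(z,0) = z, f(.,t) conformal on D *)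
  (Hf_holo : forall t, 0 <= t < T -> holo_on disk (fun z => f z t))
  (Hf_inj : forall t, 0 <= t < T -> inj_on disk (fun z => f z t))
  (Hf_init : forall z, disk z -> f z 0 = z)
  (Hf_LK : forall z t, disk z -> 0 <= t < T ->
     exists l, has_cderiv (fun w => f w t) z l /\
       has_tderiv_in T (fun s => f z s) t (Copp (Cmul (Cmul z l) (p z t))))
  (* f(.,t) extended continuously to the closed disk *)
  (Hf_cont : forall t, 0 <= t < T -> cont_on cdisk (fun z => f z t))
  (* F(., tau(t)): conformal map of D^* onto the unbounded component of
     C \ Gamma(t), F(z) = e^{-tau(t)} z + b0 + b1/z + ... near infinity *)
  (HF_holo : forall t, 0 <= t < T -> holo_on ext_disk (fun z => F z t))
  (HF_inj : forall t, 0 <= t < T -> inj_on ext_disk (fun z => F z t))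
  (HF_onto : forall t, 0 <= t < T -> forall w,
     (exists z, ext_disk z /\ F z t = w) <->
     unbounded_component (boundary_image_disk (fun z => f z t)) w)
  (HF_infty : forall t, 0 <= t < T -> exists G : Cplx -> Cplx,
     holo_on disk G /\
     forall w, 0 < Cmod w < 1 ->
       G w = Csub (F (Cinv w) t) (Cmul (RtoC (exp (- tau t))) (Cinv w)))
  (* F(., tau(t)) extended continuously to |z| >= 1 *)
  (HF_cont : forall t, 0 <= t < T -> cont_on cext_disk (fun z => F z t))
  (* conformal welding: f(e^{i phi}, t) = F(e^{i phitilde}, tau(t)),
     phi = phi t phitilde, with the branch chosen so that phi -> phitilde *)
  (Hphi : forall t th, 0 < t < T -> f (Cexpi (phi t th)) t = F (Cexpi th) t)
  (Hphi0 : forall th eps, eps > 0 -> exists delta, delta > 0 /\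
     forall t, 0 < t < T -> t < delta -> Rabs (phi t th - th) < eps) :
  forall th eps, eps > 0 -> exists delta, delta > 0 /\
    forall t, 0 < t < T -> t < delta ->
      Rabs (phi t th - th - 2 * Cim (p (Cexpi th) 0) * t) <= eps * t.
Proof.
  destruct Hp_bdd as [M HM].
  intros th eps Heps.
  apply (welding_asymptotics T M p p1 f F tau phi HT); try assumption.
  - intros t Ht z Hz. apply has_cderiv_is_cderiv, (Hp1 t Ht z Hz).
  - intros z t Hz Ht. destruct (HM z t Hz Ht) as [A1 [A2 _]]. split; assumption.
  - intros z Hz e He. destruct (Hp_tcont z Hz 0 (conj (Rle_refl 0) HT) e He) as [d [Hd H]].
    exists d. split; [exact Hd|]. intros s Hs Hsd. apply H; [exact Hs|].
    rewrite Rminus_0_r, Rabs_pos_eq; lra.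
  - apply loewner_transport_sol. intros z t Hz Ht. exact (Hf_LK z t Hz Ht).
  - intros t Ht z Hz. apply (HF_onto t Ht). exists z. split; [exact Hz|reflexivity].
  - intros t Ht. destruct (HF_infty t Ht) as [G [HGh HGF]]. exists G. split.
    + intros w Hw. destruct (HGh w Hw) as [l Hl]. exists l. apply has_cderiv_is_cderiv, Hl.
    + exact HGF.
Qed.
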